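(* Let $(X,d_X)$ and $(Y,d_Y)$ be metric spaces with nets $(X_0,i_X,e_X)$ and $(Y_0,i_Y,e_Y)$ of $X$ and $Y$, respectively, and let $X\ast Y$ be their free product (formed with respect to these nets), equipped with its metric $d_\ast$. \begin{itemize} \item If $X$ and $Y$ are coarsely embeddable into a uniformly convex Banach space, then so is $X\ast Y$. \item If $X$ and $Y$ have Property A, then $X\ast Y$ has Property A. \item If $X$ and $Y$ are Gromov hyperbolic, then $X\ast Y$ is Gromov hyperbolic. \end{itemize}
   Context: **Nets.** A net of a metric space $(X,d_X)$ is a triple $(X_0,i_X,e_X)$ where $X_0$ is a set, $i_X:X_0\to X$ is a map such that $i_X^{-1}(K)$ is finite for every compact $K\subseteq X$, and $e_X\in i_X(X_0)$ (the base point). Write $\overline{x_0}=i_X(x_0)$ for $x_0\in X_0$. **Words.** Given nets of $X$ and $Y$, choose $\epsilon_X\in X_0$, $\epsilon_Y\in Y_0$ with $i_X(\epsilon_X)=e_X$, $i_Y(\epsilon_Y)=e_Y$; put $X_0^*=X_0\setminus\{\epsilon_X\}$, $Y_0^*=Y_0\setminus\{\epsilon_Y\}$. A normal word is a finite sequence $w_0w_1\cdots w_n$ ($n\ge 0$) of elements of $X_0^*\sqcup Y_0^*$ whose letters alternate between $X_0^*$ and $Y_0^*$. Let $\epsilon$ be the empty word. $W$ is the set of all normal words together with $\epsilon$; $W_X$ (resp. $W_Y$) consists of $\epsilon$ and all normal words whose last letter is not in $X_0^*$ (resp. not in $Y_0^*$). **Free product.** Let $$\widetilde{X\ast Y}=(W_X\times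 X)\sqcup(W_Y\times Y)\sqcup(W_X\times X_0^*\times[0,1])\sqcup(W_Y\times Y_0^*\times[0,1])\sqcup(\{\epsilon\}\times[0,1]).$$ Let $\sim$ be the equivalence relation generated by: (i) the point $(\epsilon,e_X)\in W_X\times X$ is identified with $(\epsilon,0)\in\{\epsilon\}\times[0,1]$, and $(\epsilon,e_Y)\in W_Y\times Y$ with $(\epsilon,1)\in\{\epsilon\}\times[0,1]$; (ii) for $\omega\in W_X$, $x_0\in X_0^*$: $(\omega,\overline{x_0})\sim(\omega,x_0,0)$ and $(\omega x_0,e_Y)\sim(\omega,x_0,1)$, where $(\omega,\overline{x_0})\in W_X\times X$ and $(\omega x_0,e_Y)\in W_Y\times Y$; (iii) for $\tau\in W_Y$, $y_0\in Y_0^*$: $(\tau,\overline{y_0})\sim(\tau,y_0,0)$ and $(\tau y_0,e_X)\sim(\tau,y_0,1)$, where $(\tau,\overline{y_0})\in W_Y\times Y$ and $(\tau y_0,e_X)\in W_X\times X$. The free product is $X\ast Y=\widetilde{X\ast Y}/\sim$. The sets $\{\omega\}\times X$ ($\omega\in W_X$) and $\{\tau\}\times Y$ ($\tau\in W_Y$) are called sheets; the sets $\{\epsilon\}\times[0,1]$, $\{\omega\}\times\{x_0\}\times[0,1]$, $\{\tau\}\times\{y_0\}\times[0,1]$ are called edges. The sheets (as vertices) and edges form a tree. **Metric $d_\ast$.** Each sheet carries the metric $d_X$ or $d_Y$, and each edge carries the metric $|t_1-t_2|$ of $[0,1]$. The metric $d_\ast$ on $X\ast Y$ is the shortest-path distance: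 $d_\ast(p,q)$ is the infimum of $\sum_{i=1}^n d_{C_i}(p_{i-1},p_i)$ over all finite chains $p=p_0,p_1,\dots,p_n=q$ in which $p_{i-1},p_i$ lie in a common sheet or edge $C_i$ with metric $d_{C_i}$. (By the tree structure it is attained along the unique route between $p$ and $q$; e.g. for $p=(x_0y_0,u)$ and $q=(\epsilon,v)$ with $u,v\in X$, $d_\ast(p,q)=d_X(v,\overline{x_0})+1+d_Y(\overline{y_0},e_Y)+1+d_X(e_X,u)$.) **Coarse embeddability.** A metric space $(Z,d)$ is coarsely embeddable into a uniformly convex Banach space if there exist a uniformly convex Banach space $E$, a map $F:Z\to E$ and non-decreasing functions $\rho_1,\rho_2:\mathbb{R}_+\to\mathbb{R}$ with $\lim_{t\to+\infty}\rho_i(t)=+\infty$ ($i=1,2$) such that $\rho_1(d(x,y))\le\|F(x)-F(y)\|_E\le\rho_2(d(x,y))$ for all $x,y\in Z$. A Banach space $E$ is uniformly convex if for every $\varepsilon\in(0,2]$ there is $\delta>0$ such that $\|x\|=\|y\|=1$ and $\|x-y\|\ge\varepsilon$ imply $\|\frac{x+y}{2}\|\le 1-\delta$. **Property A.** A metric space $(Z,d)$ has Property A if and only if for every $\varepsilon>0$ and $C>0$ there exist a Hilbert space $\mathcal{H}$ and a function $\xi:Z\to\mathcal{H}$, $x\mapsto\xi_x$, with $\|\xi_x\|=1$ for all $x$, such that (1) $\|\xi_x-\xi_{x'}\|<\varepsilon$ whenever $d(x,x')\le C$; (2) there exists $R>0$ such that $\langle\xi_x,\xi_{x'}\rangle=0$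 whenever $d(x,x')\ge R$. **Gromov hyperbolicity.** For a metric space $(Z,d)$ and $x,y,z\in Z$, put $(y\mid z)_x=\frac12(d(y,x)+d(z,x)-d(y,z))$. $Z$ is Gromov hyperbolic if there is $\delta\ge0$ such that $(x\mid z)_w\ge\min\{(x\mid y)_w,(y\mid z)_w\}-\delta$ for all $x,y,z,w\in Z$. No geodesicity is assumed. *)

(* Defs.v *)
From HB Require Import structures.
From mathcomp Require Import all_boot all_order all_algebra generic_quotient.
From mathcomp Require Import sesquilinear interval_inference.
From mathcomp Require Import all_classical all_reals all_analysis.
From Stdlib Require Import Relation_Operators.

Set Implicit Arguments.
Unset Strict Implicit.
Unset Printing Implicit Defensive.

Import Order.TTheory GRing.Theory Num.Def Num.Theory.
Import numFieldNormedType.Exports.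

Local Open Scope classical_set_scope.
Local Open Scope ring_scope.
Local Open Scope quotient_scope.

Section MetricProperties.
Context {R : realType}.

Definition uniformly_convex (E : normedModType R) : Prop :=
  forall eps : R, 0 < eps <= 2 ->
  exists2 delta : R, 0 < delta &
    forall x y : E, `|x| = 1 -> `|y| = 1 -> eps <= `|x - y| ->
      `|2^-1 *: (x + y)| <= 1 - delta.

(* The control functions live on R_+; they are encoded as functions on R whose
   values on negative reals are irrelevant. *)
Definition coarsely_embeddable_in_uniformly_convex_Banach
    (Z : metricType R) : Prop :=
  exists (E : completeNormedModType R) (F : Z -> E) (rho1 rho2 : R -> R),
    uniformly_convex E
    /\ (forall s t, 0 <= s -> s <= t -> rho1 s <= rho1 t)
    /\ (forall s t, 0 <= s -> s <= t -> rho2 s <= rho2 t)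
    /\ rho1 t @[t --> +oo] --> +oo
    /\ rho2 t @[t --> +oo] --> +oo
    /\ forall x y : Z,
         rho1 (mdist x y) <= `|F x - F y| <= rho2 (mdist x y).

(* A real Hilbert space is a Banach space [H] together with a positive definite
   symmetric bilinear form [dot] such that [hilbert_inner_product dot]. *)
Definition hilbert_inner_product (H : completeNormedModType R)
    (dot : {dot H for idfun}) : Prop :=
  forall u : H, `|u| ^+ 2 = dot u u.

Definition property_A (Z : metricType R) : Prop :=
  forall eps C : R, 0 < eps -> 0 < C ->
  exists (H : completeNormedModType R) (dot : {dot H for idfun}) (xi : Z -> H),
    hilbert_inner_product dot
    /\ (forall x, `|xi x| = 1)
    /\ (forall x x', mdist x x' <= C -> `|xi x - xi x'| < eps)
    /\ exists2 r : R, 0 < r &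
         forall x x', r <= mdist x x' -> dot (xi x) (xi x') = 0.

Definition gromov_product (Z : metricType R) (x y z : Z) : R :=
  2^-1 * (mdist y x + mdist z x - mdist y z).

Definition gromov_hyperbolic (Z : metricType R) : Prop :=
  exists2 delta : R, 0 <= delta &
    forall x y z w : Z,
      minr (gromov_product w x y) (gromov_product w y z) - delta
      <= gromov_product w x z.

End MetricProperties.

Record net (R : realType) (X : metricType R) := Net {
  net_set :> choiceType ;
  net_map : net_set -> X ;
  net_base : X ;
  net_finite : forall K : set X, compact K -> finite_set (net_map @^-1` K) ;
  net_base_range : range net_map net_base
}.

Lemma prefix_rconsE (T : eqType) (v w : seq T) a :
  prefix v (rcons w a) = prefix v w || (v == rcons w a).
Proof.
elim: w v => [|b w IH] [|c v] //=.
by rewrite IH eqseq_cons; case: (c == b).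
Qed.

Section FreeProduct.
Context {R : realType} {X Y : metricType R} {NX : net X} {NY : net Y}.
Variables (epsX : NX) (epsY : NY).

Local Notation "'X0*'" := {x0 : NX | x0 != epsX}.
Local Notation "'Y0*'" := {y0 : NY | y0 != epsY}.
Local Notation I01 := {i01 R}.
Local Notation letter := (X0* + Y0*)%type.

Definition in_X0 (l : letter) : bool := if l is inl _ then true else false.

Definition normal_word (w : seq letter) : bool :=
  sorted (fun l l' => in_X0 l != in_X0 l') w.

Definition last_in_X0 (w : seq letter) : bool :=
  last false [seq in_X0 l | l <- w].
Definition last_in_Y0 (w : seq letter) : bool :=
  last false [seq ~~ in_X0 l | l <- w].

Definition WX := {w : seq letter | normal_word w && ~~ last_in_X0 w}.
Definition WY := {w : seq letter | normal_word w && ~~ last_in_Y0 w}.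

Definition WX0 : WX := Sub [::] isT.
Definition WY0 : WY := Sub [::] isT.

Lemma rconsX_subproof (w : WX) (x0 : X0*) :
  normal_word (rcons (val w) (inl x0)) && ~~ last_in_Y0 (rcons (val w) (inl x0)).
Proof.
case: w => w /= /andP[nw lw]; apply/andP; split; last first.
  by rewrite /last_in_Y0 map_rcons last_rcons.
move: nw lw; rewrite /normal_word /last_in_X0.
case/lastP: w => [//|w l]; rewrite map_rcons last_rcons.
by case: w => [|a w] /=; rewrite ?rcons_path ?last_rcons /=
  => nw; rewrite ?nw; case: (in_X0 l).
Qed.

Lemma rconsY_subproof (w : WY) (y0 : Y0*) :
  normal_word (rcons (val w) (inr y0)) && ~~ last_in_X0 (rcons (val w) (inr y0)).
Proof.
case: w => w /= /andP[nw lw]; apply/andP; split; last first.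
  by rewrite /last_in_X0 map_rcons last_rcons.
move: nw lw; rewrite /normal_word /last_in_Y0.
case/lastP: w => [//|w l]; rewrite map_rcons last_rcons negbK.
by case: w => [|a w] /=; rewrite ?rcons_path ?last_rcons /=
  => nw; rewrite ?nw; case: (in_X0 l).
Qed.

Definition rconsX (w : WX) (x0 : X0*) : WY :=
  Sub (rcons (val w) (inl x0)) (rconsX_subproof w x0).
Definition rconsY (w : WY) (y0 : Y0*) : WX :=
  Sub (rcons (val w) (inr y0)) (rconsY_subproof w y0).

Inductive pre_free_product : Type :=
  | SheetX of WX & X
  | SheetY of WY & Y
  | EdgeX of WX & X0* & I01
  | EdgeY of WY & Y0* & I01
  | EdgeE of I01.

Inductive glue : pre_free_product -> pre_free_product -> Prop :=
  | glueE0 : glue (SheetX WX0 (net_base NX)) (EdgeE 0%:i01)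
  | glueE1 : glue (SheetY WY0 (net_base NY)) (EdgeE 1%:i01)
  | glueX0 w x0 : glue (SheetX w (net_map (val x0))) (EdgeX w x0 0%:i01)
  | glueX1 w x0 : glue (SheetY (rconsX w x0) (net_base NY)) (EdgeX w x0 1%:i01)
  | glueY0 w y0 : glue (SheetY w (net_map (val y0))) (EdgeY w y0 0%:i01)
  | glueY1 w y0 : glue (SheetX (rconsY w y0) (net_base NX)) (EdgeY w y0 1%:i01).

HB.instance Definition _ := gen_eqMixin pre_free_product.
HB.instance Definition _ := gen_choiceMixin pre_free_product.

Definition glue_equiv (p q : pre_free_product) : bool :=
  `[< clos_refl_sym_trans pre_free_product glue p q >].

Lemma glue_equiv_refl : reflexive glue_equiv.
Proof. by move=> p; apply/asboolP; apply: rst_refl. Qed.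

Lemma glue_equiv_sym : symmetric glue_equiv.
Proof. by move=> p q; apply/asboolP/asboolP; apply: rst_sym. Qed.

Lemma glue_equiv_trans : transitive glue_equiv.
Proof.
by move=> q p r /asboolP pq /asboolP qr; apply/asboolP; apply: rst_trans pq qr.
Qed.

Canonical glue_equiv_rel :=
  EquivRel glue_equiv glue_equiv_refl glue_equiv_sym glue_equiv_trans.

Definition free_product : Type := {eq_quot glue_equiv_rel}.
HB.instance Definition _ := Choice.copy free_product {eq_quot glue_equiv_rel}.

Definition to_free_product (p : pre_free_product) : free_product :=
  \pi_({eq_quot glue_equiv_rel}) p.
Local Notation "p %:fp" := (to_free_product p)
  (at level 2, format "p %:fp").

(* [cell_dist p q r]: [p] and [q] lie in a common sheet or edge [C], and
   [r = d_C(p, q)]. *)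
Inductive cell_dist : free_product -> free_product -> R -> Prop :=
  | cell_SheetX w x x' :
      cell_dist (SheetX w x)%:fp (SheetX w x')%:fp (mdist x x')
  | cell_SheetY w y y' :
      cell_dist (SheetY w y)%:fp (SheetY w y')%:fp (mdist y y')
  | cell_EdgeX w x0 (t t' : I01) :
      cell_dist (EdgeX w x0 t)%:fp (EdgeX w x0 t')%:fp `|t%:num - t'%:num|
  | cell_EdgeY w y0 (t t' : I01) :
      cell_dist (EdgeY w y0 t)%:fp (EdgeY w y0 t')%:fp `|t%:num - t'%:num|
  | cell_EdgeE (t t' : I01) :
      cell_dist (EdgeE t)%:fp (EdgeE t')%:fp `|t%:num - t'%:num|.

Inductive chain_length : free_product -> free_product -> R -> Prop :=
  | chain_nil p : chain_length p p 0
  | chain_cons p q q' r l :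
      cell_dist p q r -> chain_length q q' l -> chain_length p q' (r + l).

Definition free_product_dist (p q : free_product) : R :=
  inf [set l | chain_length p q l].


(* The remainder of this section shows that [free_product_dist] is a metric.
   Points are separated by functions on the free product that are 1-Lipschitz on
   every sheet and edge: the distance to a point after retraction onto a sheet,
   and the projection onto an edge. *)

Lemma cell_dist_ge0 p q r : cell_dist p q r -> 0 <= r.
Proof. by case=> *; rewrite ?normr_ge0 ?mdist_ge0. Qed.

Lemma cell_dist_sym p q r : cell_dist p q r -> cell_dist q p r.
Proof.
by case=> *; rewrite 1?metric_sym 1?distrC; constructor.
Qed.

Lemma chain_length_ge0 p q l : chain_length p q l -> 0 <= l.
Proof.
by elim=> // {}p {}q q' r {}l /cell_dist_ge0 r0 _ l0; apply: addr_ge0.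
Qed.

Lemma chain_length_cat p q r l l' :
  chain_length p q l -> chain_length q r l' -> chain_length p r (l + l').
Proof.
elim=> [{}p|{}p {}q q' a {}l pq _ IH] h; first by rewrite add0r.
by rewrite -addrA; apply: chain_cons pq (IH h).
Qed.

Lemma chain_length1 p q r : cell_dist p q r -> chain_length p q r.
Proof.
by move=> pq; rewrite -[r]addr0; apply: chain_cons pq (chain_nil q).
Qed.

Lemma chain_length_sym p q l : chain_length p q l -> chain_length q p l.
Proof.
elim=> [{}p|{}p {}q q' r {}l pq _ IH]; first exact: chain_nil.
by rewrite addrC; apply: chain_length_cat IH (chain_length1 (cell_dist_sym pq)).
Qed.

Lemma glueP p q : glue p q -> p%:fp = q%:fp.
Proof. by move=> pq; apply/eqmodP/asboolP; apply: rst_step. Qed.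

Lemma to_free_product_surj (p : free_product) : exists p', p = (p')%:fp.
Proof. by exists (repr p); rewrite /to_free_product reprK. Qed.

Lemma WXP (w : WX) : w = WX0 \/ exists v y0, w = rconsY v y0.
Proof.
case: w => w nw; case/lastP: w nw => [nw|w l nw].
  by left; apply: val_inj.
right; case: l nw => [x0|y0] nw.
  by exfalso; move: (nw); rewrite /last_in_X0 map_rcons last_rcons andbF.
have nv : normal_word w && ~~ last_in_Y0 w.
  move: nw; rewrite /normal_word /last_in_Y0 => /andP[+ _].
  case/lastP: w => // w l; rewrite map_rcons last_rcons negbK.
  case: w => [|a w] /=; rewrite ?rcons_path ?last_rcons /=.
    by case: (in_X0 l).
  by case/andP=> ->; case: (in_X0 l).
by exists (exist _ w nv), y0; apply: val_inj.
Qed.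

Lemma WYP (w : WY) : w = WY0 \/ exists v x0, w = rconsX v x0.
Proof.
case: w => w nw; case/lastP: w nw => [nw|w l nw].
  by left; apply: val_inj.
right; case: l nw => [x0|y0] nw; last first.
  by exfalso; move: (nw); rewrite /last_in_Y0 map_rcons last_rcons andbF.
have nv : normal_word w && ~~ last_in_X0 w.
  move: nw; rewrite /normal_word /last_in_X0 => /andP[+ _].
  case/lastP: w => // w l; rewrite map_rcons last_rcons.
  case: w => [|a w] /=; rewrite ?rcons_path ?last_rcons /=.
    by case: (in_X0 l).
  by case/andP=> ->; case: (in_X0 l).
by exists (exist _ w nv), x0; apply: val_inj.
Qed.

Definition connected_points p q := exists l, chain_length p q l.

Lemma connected_refl p : connected_points p p.
Proof. by exists 0; constructor. Qed.

Lemma connected_sym p q : connected_points p q -> connected_points q p.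
Proof. by case=> l ?; exists l; apply: chain_length_sym. Qed.

Lemma connected_trans q p r :
  connected_points p q -> connected_points q r -> connected_points p r.
Proof.
by case=> l pq [l' qr]; exists (l + l'); apply: chain_length_cat pq qr.
Qed.

Lemma connected_cell p q r : cell_dist p q r -> connected_points p q.
Proof. by exists r; apply: chain_length1. Qed.

Local Notation o := ((SheetX WX0 (net_base NX))%:fp).

Lemma connected_sheet n :
  (forall (w : WX) x, size (val w) = n -> connected_points o (SheetX w x)%:fp)
  /\ (forall (w : WY) y, size (val w) = n -> connected_points o (SheetY w y)%:fp).
Proof.
elim: n => [|n [IHX IHY]]; split.
- move=> w x; case: (WXP w) => [-> _|[v [y0 ->]]]; last by rewrite size_rcons.
  exact: connected_cell (cell_SheetX _ _ _).
- move=> w y; case: (WYP w) => [-> _|[v [x0 ->]]]; last by rewrite size_rcons.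
  rewrite (glueP glueE0).
  apply: connected_trans (connected_cell (cell_EdgeE _ 1%:i01)) _.
  rewrite -(glueP glueE1).
  exact: connected_cell (cell_SheetY _ _ _).
- move=> w x; case: (WXP w) => [->//|[v [y0 ->]]].
  rewrite size_rcons => -[] sv.
  apply: connected_trans (IHY v (net_map (val y0)) sv) _.
  rewrite (glueP (glueY0 _ _)).
  apply: connected_trans (connected_cell (cell_EdgeY _ _ _ 1%:i01)) _.
  rewrite -(glueP (glueY1 _ _)).
  exact: connected_cell (cell_SheetX _ _ _).
- move=> w y; case: (WYP w) => [->//|[v [x0 ->]]].
  rewrite size_rcons => -[] sv.
  apply: connected_trans (IHX v (net_map (val x0)) sv) _.
  rewrite (glueP (glueX0 _ _)).
  apply: connected_trans (connected_cell (cell_EdgeX _ _ _ 1%:i01)) _.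
  rewrite -(glueP (glueX1 _ _)).
  exact: connected_cell (cell_SheetY _ _ _).
Qed.

Lemma connected_base p : connected_points o p.
Proof.
have sX w x : connected_points o (SheetX w x)%:fp.
  exact: (connected_sheet _).1 erefl.
have sY w y : connected_points o (SheetY w y)%:fp.
  exact: (connected_sheet _).2 erefl.
case: (to_free_product_surj p) => -[w x|w y|w x0 t|w y0 t|t] ->.
- exact: sX.
- exact: sY.
- apply: connected_trans (sX w (net_map (val x0))) _.
  rewrite (glueP (glueX0 _ _)).
  exact: connected_cell (cell_EdgeX _ _ _ _).
- apply: connected_trans (sY w (net_map (val y0))) _.
  rewrite (glueP (glueY0 _ _)).
  exact: connected_cell (cell_EdgeY _ _ _ _).
- rewrite (glueP glueE0).
  exact: connected_cell (cell_EdgeE _ _).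
Qed.

Lemma chain_length_exists p q : exists l, chain_length p q l.
Proof.
exact: connected_trans (connected_sym (connected_base p)) (connected_base q).
Qed.

Lemma has_inf_chain_length p q : has_inf [set l | chain_length p q l].
Proof.
split; first by case: (chain_length_exists p q) => l ?; exists l.
by exists 0 => l /chain_length_ge0.
Qed.

Lemma free_product_dist_le p q l : chain_length p q l -> free_product_dist p q <= l.
Proof. by apply: ge_inf; case: (has_inf_chain_length p q). Qed.

Lemma free_product_dist_ge0 p q : 0 <= free_product_dist p q.
Proof.
apply: lb_le_inf; first by case: (has_inf_chain_length p q).
by move=> l /chain_length_ge0.
Qed.

Lemma free_product_distxx p : free_product_dist p p = 0.
Proof.
apply/eqP; rewrite eq_le free_product_dist_ge0 andbT.
exact: free_product_dist_le (chain_nil p).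
Qed.

Lemma free_product_dist_sym p q : free_product_dist p q = free_product_dist q p.
Proof.
by congr inf; apply/seteqP; split=> l /chain_length_sym.
Qed.

Lemma free_product_dist_triangle q p r :
  free_product_dist p r <= free_product_dist p q + free_product_dist q r.
Proof.
apply/ler_addgt0Pl => e e0.
have e20 : 0 < e / 2 by rewrite divr_gt0.
have [a /= pa al] := inf_adherent e20 (has_inf_chain_length p q).
have [b /= qb bl] := inf_adherent e20 (has_inf_chain_length q r).
apply: le_trans (free_product_dist_le (chain_length_cat pa qb)) _.
rewrite -/(free_product_dist p q) in al; rewrite -/(free_product_dist q r) in bl.
rewrite [e]splitr.
by rewrite [leRHS]addrC addrACA lerD // ltW.
Qed.

(* 1-Lipschitz functions given on representatives *)
Definition cell_lipschitz (f : pre_free_product -> R) : Prop :=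
  (forall p q, glue p q -> f p = f q)
  /\ (forall w x x', `|f (SheetX w x) - f (SheetX w x')| <= mdist x x')
  /\ (forall w y y', `|f (SheetY w y) - f (SheetY w y')| <= mdist y y')
  /\ (forall w x0 (t t' : I01),
       `|f (EdgeX w x0 t) - f (EdgeX w x0 t')| <= `|t%:num - t'%:num|)
  /\ (forall w y0 (t t' : I01),
       `|f (EdgeY w y0 t) - f (EdgeY w y0 t')| <= `|t%:num - t'%:num|)
  /\ (forall t t' : I01, `|f (EdgeE t) - f (EdgeE t')| <= `|t%:num - t'%:num|).

Lemma cell_lipschitz_repr f p : cell_lipschitz f -> f (repr p%:fp) = f p.
Proof.
case=> fg _.
have : (repr p%:fp)%:fp = p%:fp by rewrite /to_free_product reprK.
move/eqmodP/asboolP; move: (repr _) => q.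
by elim=> // a b c _ -> _ ->.
Qed.

Lemma cell_lipschitz_le f p q : cell_lipschitz f ->
  `|f p - f q| <= free_product_dist p%:fp q%:fp.
Proof.
move=> fL; rewrite -(cell_lipschitz_repr p fL) -(cell_lipschitz_repr q fL).
apply: lb_le_inf; first by case: (has_inf_chain_length p%:fp q%:fp).
move=> l /=; move: p%:fp q%:fp => {}p {}q; elim=> [{}p|{}p {}q q' r {}l pq _ IH].
  by rewrite subrr normr0.
apply: le_trans (ler_distD (f (repr q)) _ _) _; apply: lerD IH.
have [_ [? [? [? [? ?]]]]] := fL.
by case: pq => *; rewrite !(cell_lipschitz_repr _ fL).
Qed.

Definition word_dirX (v w : seq letter) : X :=
  if prefix v w then
    if drop (size v) w is inl x0 :: _ then net_map (val x0) else net_base NX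
  else net_base NX.

Definition retractX (v : WX) (p : pre_free_product) : X :=
  match p with
  | SheetX w x => if w == v then x else word_dirX (val v) (val w)
  | SheetY w _ => word_dirX (val v) (val w)
  | EdgeX w x0 _ => word_dirX (val v) (rcons (val w) (inl x0))
  | EdgeY w y0 _ => word_dirX (val v) (rcons (val w) (inr y0))
  | EdgeE _ => net_base NX
  end.

Definition word_dirY (v w : seq letter) : Y :=
  if prefix v w then
    if drop (size v) w is inr y0 :: _ then net_map (val y0) else net_base NY
  else net_base NY.

Definition retractY (v : WY) (p : pre_free_product) : Y :=
  match p with
  | SheetX w _ => word_dirY (val v) (val w)
  | SheetY w y => if w == v then y else word_dirY (val v) (val w)
  | EdgeX w x0 _ => word_dirY (val v) (rcons (val w) (inl x0))
  | EdgeY w y0 _ => word_dirY (val v) (rcons (val w) (inr y0))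
  | EdgeE _ => net_base NY
  end.

Lemma word_dirX_refl v : word_dirX v v = net_base NX.
Proof. by rewrite /word_dirX prefix_refl drop_size. Qed.

Lemma word_dirY_refl v : word_dirY v v = net_base NY.
Proof. by rewrite /word_dirY prefix_refl drop_size. Qed.

Lemma word_dirX_rcons v w a : v != w -> word_dirX v (rcons w a) = word_dirX v w.
Proof.
move=> vw; rewrite /word_dirX prefix_rconsE.
have [pvw|npvw] /= := boolP (prefix v w); last first.
  by case: eqP => // ->; rewrite drop_size.
move: pvw vw => /prefixP[[|b u] ->]; first by rewrite cats0 eqxx.
by rewrite rcons_cat !drop_size_cat.
Qed.

Lemma word_dirY_rcons v w a : v != w -> word_dirY v (rcons w a) = word_dirY v w.
Proof.
move=> vw; rewrite /word_dirY prefix_rconsE.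
have [pvw|npvw] /= := boolP (prefix v w); last first.
  by case: eqP => // ->; rewrite drop_size.
move: pvw vw => /prefixP[[|b u] ->]; first by rewrite cats0 eqxx.
by rewrite rcons_cat !drop_size_cat.
Qed.

Lemma word_dirX_next v a : word_dirX v (rcons v a) =
  if a is inl x0 then net_map (val x0) else net_base NX.
Proof.
rewrite /word_dirX prefix_rcons -cats1 drop_size_cat //.
Qed.

Lemma word_dirY_next v a : word_dirY v (rcons v a) =
  if a is inr y0 then net_map (val y0) else net_base NY.
Proof.
rewrite /word_dirY prefix_rcons -cats1 drop_size_cat //.
Qed.

Lemma word_dirX_nil v : word_dirX v [::] = net_base NX.
Proof. by case: v. Qed.

Lemma word_dirY_nil v : word_dirY v [::] = net_base NY.
Proof. by case: v. Qed.

Lemma WX_WY_nil (v : WX) (w : WY) : val v = val w -> val v = [::].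
Proof.
case: (WXP v) => [->//|[v' [y0 ->]]].
case: (WYP w) => [-> //|[w' [x0 ->]]] /=.
by move/(congr1 (last (inl x0))); rewrite !last_rcons.
Qed.

Lemma retractX_glue v p q : glue p q -> retractX v p = retractX v q.
Proof.
case=> [||w x0|w x0|w y0|w y0] /=.
- by case: eqP => // _; rewrite word_dirX_nil.
- by rewrite word_dirX_nil.
- have [->|wv] := eqVneq w v; first by rewrite word_dirX_next.
  by rewrite word_dirX_rcons // eq_sym.
- by [].
- have [vw|vw] := eqVneq (val v) (val w); last by rewrite word_dirX_rcons.
  by rewrite vw word_dirX_next word_dirX_refl.
- by have [<-|//] := eqVneq (rconsY w y0) v; rewrite word_dirX_refl.
Qed.

Lemma retractY_glue v p q : glue p q -> retractY v p = retractY v q.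
Proof.
case=> [||w x0|w x0|w y0|w y0] /=.
- by rewrite word_dirY_nil.
- by case: eqP => // _; rewrite word_dirY_nil.
- have [vw|vw] := eqVneq (val v) (val w); last by rewrite word_dirY_rcons.
  by rewrite vw word_dirY_next word_dirY_refl.
- by have [<-|//] := eqVneq (rconsX w x0) v; rewrite word_dirY_refl.
- have [->|wv] := eqVneq w v; first by rewrite word_dirY_next.
  by rewrite word_dirY_rcons // eq_sym.
- by [].
Qed.

Lemma mdist_lipschitz (Z : metricType R) (z x y : Z) :
  `|mdist x z - mdist y z| <= mdist x y.
Proof.
rewrite ler_norml lerBlDr metric_triangle andbT lerNl opprB lerBlDr.
by rewrite [mdist x y]metric_sym metric_triangle.
Qed.

Lemma retractX_lipschitz v z :
  cell_lipschitz (fun p => mdist (retractX v p) z).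
Proof.
split; first by move=> p q /(retractX_glue v) ->.
split=> [w x x'|] /=; last by do !split=> *; rewrite subrr normr0 ?mdist_ge0.
by case: eqP => _; [exact: mdist_lipschitz | rewrite subrr normr0 mdist_ge0].
Qed.

Lemma retractY_lipschitz v z :
  cell_lipschitz (fun p => mdist (retractY v p) z).
Proof.
split; first by move=> p q /(retractY_glue v) ->.
split=> [w x x'|] /=; first by rewrite subrr normr0 mdist_ge0.
split=> [w x x'|] /=; last by do !split=> *; rewrite subrr normr0.
by case: eqP => _; [exact: mdist_lipschitz | rewrite subrr normr0 mdist_ge0].
Qed.

Definition edge_coordE (p : pre_free_product) : R :=
  let side (w : seq letter) : R := if w is inr _ :: _ then 1 else 0 in
  match p with
  | SheetX w _ => side (val w)
  | SheetY w _ => if val w is inl _ :: _ then 0 else 1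
  | EdgeX w x0 _ => side (rcons (val w) (inl x0))
  | EdgeY w y0 _ => side (rcons (val w) (inr y0))
  | EdgeE t => t%:num
  end.

(* projection onto the edge joining the sheets of [v] and [rcons v a] *)
Definition edge_coord (v : seq letter) (a : letter) (p : pre_free_product) : R :=
  let side (w : seq letter) : R := (prefix (rcons v a) w)%:R in
  match p with
  | SheetX w _ => side (val w)
  | SheetY w _ => side (val w)
  | EdgeX w x0 t => if rcons (val w) (inl x0) == rcons v a then t%:num
                    else side (rcons (val w) (inl x0))
  | EdgeY w y0 t => if rcons (val w) (inr y0) == rcons v a then t%:num
                    else side (rcons (val w) (inr y0))
  | EdgeE _ => 0
  end.

Lemma edge_coordE_lipschitz : cell_lipschitz edge_coordE.
Proof.
split; last by do !split=> *; rewrite /= ?subrr ?normr0 ?mdist_ge0.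
by move=> p q; case=> [||w x0|w x0|w y0|w y0] //=; case: w => -[|[]].
Qed.

Lemma edge_coord_lipschitz v a : cell_lipschitz (edge_coord v a).
Proof.
have npre (w : seq letter) b :
    rcons w b == rcons v a -> prefix (rcons v a) w = false.
  move/eqP <-; apply/negbTE/negP => /size_prefix; rewrite size_rcons.
  by rewrite ltnn.
split.
  move=> p q; case=> [||w x0|w x0|w y0|w y0] //=; rewrite ?prefixs0.
  - by case: v npre.
  - by case: v npre.
  - case: ifPn => [/npre ->//|]; rewrite prefix_rconsE [_ == rcons (val w) _]eq_sym.
    by move/negbTE ->; rewrite orbF.
  - by case: eqP => // ->; rewrite prefix_refl.
  - case: ifPn => [/npre ->//|]; rewrite prefix_rconsE [_ == rcons (val w) _]eq_sym.
    by move/negbTE ->; rewrite orbF.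
  - by case: eqP => // ->; rewrite prefix_refl.
by do !split=> *; rewrite /= ?subrr ?normr0 ?mdist_ge0 //;
  case: ifP; rewrite // subrr normr0.
Qed.

Lemma free_product_dist0_lipschitz f p q : cell_lipschitz f ->
  free_product_dist p%:fp q%:fp = 0 -> f p = f q.
Proof.
move=> fL pq0; have := cell_lipschitz_le p q fL.
by rewrite pq0 normr_le0 subr_eq0 => /eqP.
Qed.


(* Every point is on a sheet or in the interior of an edge. *)
Lemma to_free_product_interior (p : free_product) :
  exists p' : pre_free_product, p = p'%:fp /\
    match p' with
    | EdgeX _ _ t | EdgeY _ _ t | EdgeE t => 0 < t%:num < 1
    | _ => True
    end.
Proof.
have int (t : I01) : [\/ t = 0%:i01, t = 1%:i01 | 0 < t%:num < 1].
  have [->|t0] := eqVneq t 0%:i01; first exact: Or31.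
  have [->|t1] := eqVneq t 1%:i01; first exact: Or32.
  apply: Or33; rewrite !lt_neqAle ge0 le1 !andbT; apply/andP; split.
    by apply: contra t0 => /eqP t0; apply/eqP/val_inj.
  by apply: contra t1 => /eqP t1; apply/eqP/val_inj.
case: (to_free_product_surj p) => -[w x|w y|w x0 t|w y0 t|t] ->.
- by exists (SheetX w x).
- by exists (SheetY w y).
- case: (int t) => [->|->|t01]; last by exists (EdgeX w x0 t).
  + by rewrite -(glueP (glueX0 _ _)); eexists; split; first by [].
  + by rewrite -(glueP (glueX1 _ _)); eexists; split; first by [].
- case: (int t) => [->|->|t01]; last by exists (EdgeY w y0 t).
  + by rewrite -(glueP (glueY0 _ _)); eexists; split; first by [].
  + by rewrite -(glueP (glueY1 _ _)); eexists; split; first by [].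
- case: (int t) => [->|->|t01]; last by exists (EdgeE t).
  + by rewrite -(glueP glueE0); eexists; split; first by [].
  + by rewrite -(glueP glueE1); eexists; split; first by [].
Qed.

Definition pre_word (p : pre_free_product) : seq letter :=
  match p with
  | SheetX w _ => val w
  | SheetY w _ => val w
  | EdgeX w x0 _ => rcons (val w) (inl x0)
  | EdgeY w y0 _ => rcons (val w) (inr y0)
  | EdgeE _ => [::]
  end.

Definition is_sheet (p : pre_free_product) : bool :=
  match p with SheetX _ _ | SheetY _ _ => true | _ => false end.

Lemma edge_coord_sheet v a p : is_sheet p ->
  edge_coord v a p = (prefix (rcons v a) (pre_word p))%:R.
Proof. by case: p. Qed.

Lemma sheet_word p q : is_sheet p -> is_sheet q ->
  free_product_dist p%:fp q%:fp = 0 -> pre_word p = pre_word q.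
Proof.
move=> sp sq.
wlog pq : p q sp sq / (size (pre_word p) <= size (pre_word q))%N.
  move=> H; case: (leqP (size (pre_word p)) (size (pre_word q))) => [/H|/ltnW/H].
    exact.
  by rewrite free_product_dist_sym => h /h ->.
case/lastP E : (pre_word q) pq => [|v a]; first by case: (pre_word p).
move=> pq; move/(free_product_dist0_lipschitz (edge_coord_lipschitz v a)).
rewrite !edge_coord_sheet // E prefix_refl.
case: (boolP (prefix _ _)) => [/prefixP[u pE] _|_ /esym/eqP]; last first.
  by rewrite oner_eq0.
move: pq; rewrite pE size_cat -{2}[size (rcons v a)]addn0 leq_add2l leqn0.
by move/nilP ->; rewrite cats0.
Qed.

Lemma interiorN (t : R) (b : bool) : 0 < t < 1 -> b%:R = t -> False.
Proof. by case: b => /andP[t0 t1] E; rewrite -E ltxx in t0 t1. Qed.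

Lemma free_product_dist_sheets p q : is_sheet p -> is_sheet q ->
  free_product_dist p%:fp q%:fp = 0 -> p%:fp = q%:fp.
Proof.
move=> sp sq pq0; have wE := sheet_word sp sq pq0.
case: p q sp sq pq0 wE => [w x|w y|||] // [w' x'|w' y'|||] //= _ _ pq0 wE.
- move: (wE) => /val_inj wE'; subst w'.
  have := free_product_dist0_lipschitz (retractX_lipschitz w x') pq0.
  by rewrite /= eqxx mdistxx => /mdist_positivity ->.
- have := free_product_dist0_lipschitz edge_coordE_lipschitz pq0.
  by rewrite /= -wE (WX_WY_nil wE) => /esym/eqP; rewrite oner_eq0.
- have := free_product_dist0_lipschitz edge_coordE_lipschitz pq0.
  by rewrite /= wE (WX_WY_nil (esym wE)) => /eqP; rewrite oner_eq0.
- move: (wE) => /val_inj wE'; subst w'.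
  have := free_product_dist0_lipschitz (retractY_lipschitz w y') pq0.
  by rewrite /= eqxx mdistxx => /mdist_positivity ->.
Qed.

Lemma free_product_dist_edgeX w x0 (t : I01) q : 0 < t%:num < 1 ->
  free_product_dist (EdgeX w x0 t)%:fp q%:fp = 0 -> (EdgeX w x0 t)%:fp = q%:fp.
Proof.
move=> t01 /(free_product_dist0_lipschitz
               (edge_coord_lipschitz (val w) (inl x0))).
rewrite /= eqxx; case: q => [w' x|w' y|w' x1 t'|w' y1 t'|t'] /= /esym.
- by move/(interiorN t01).
- by move/(interiorN t01).
- case: eqP => [/rcons_inj[/val_inj -> ->] /val_inj -> //|_].
  by move/(interiorN t01).
- case: eqP => [/rcons_inj[] //|_].
  by move/(interiorN t01).
- by move/(@interiorN _ false t01).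
Qed.

Lemma free_product_dist_edgeY w y0 (t : I01) q : 0 < t%:num < 1 ->
  free_product_dist (EdgeY w y0 t)%:fp q%:fp = 0 -> (EdgeY w y0 t)%:fp = q%:fp.
Proof.
move=> t01 /(free_product_dist0_lipschitz
               (edge_coord_lipschitz (val w) (inr y0))).
rewrite /= eqxx; case: q => [w' x|w' y|w' x1 t'|w' y1 t'|t'] /= /esym.
- by move/(interiorN t01).
- by move/(interiorN t01).
- case: eqP => [/rcons_inj[] //|_].
  by move/(interiorN t01).
- case: eqP => [/rcons_inj[/val_inj -> ->] /val_inj -> //|_].
  by move/(interiorN t01).
- by move/(@interiorN _ false t01).
Qed.

Lemma free_product_dist_edgeE (t : I01) q : 0 < t%:num < 1 ->
  free_product_dist (EdgeE t)%:fp q%:fp = 0 -> (EdgeE t)%:fp = q%:fp.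
Proof.
move=> t01 /(free_product_dist0_lipschitz edge_coordE_lipschitz) /=.
case: q => [w' x|w' y|w' x1 t'|w' y1 t'|t'] /= /esym.
- by case: (val w') => [|[] ? ?] /=;
    do ?[by move/(@interiorN _ false t01) | by move/(@interiorN _ true t01)].
- by case: (val w') => [|[] ? ?] /=;
    do ?[by move/(@interiorN _ false t01) | by move/(@interiorN _ true t01)].
- by case: (rcons _ _) => [|[] ? ?] /=;
    do ?[by move/(@interiorN _ false t01) | by move/(@interiorN _ true t01)].
- by case: (rcons _ _) => [|[] ? ?] /=;
    do ?[by move/(@interiorN _ false t01) | by move/(@interiorN _ true t01)].
- by move/val_inj ->.
Qed.

Lemma free_product_dist_positivity p q : free_product_dist p q = 0 -> p = q.
Proof.
have [p' [-> ip]] := to_free_product_interior p.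
have [q' [-> iq]] := to_free_product_interior q.
move=> pq0; have qp0 := pq0; rewrite free_product_dist_sym in qp0.
case: p' ip pq0 qp0 => [w x|w y|w x0 t|w y0 t|t] ip pq0 qp0.
- case: q' iq pq0 qp0 => [w' x'|w' y'|w' x0 t|w' y0 t|t] iq pq0 qp0.
  + exact: free_product_dist_sheets pq0.
  + exact: free_product_dist_sheets pq0.
  + exact/esym/free_product_dist_edgeX.
  + exact/esym/free_product_dist_edgeY.
  + exact/esym/free_product_dist_edgeE.
- case: q' iq pq0 qp0 => [w' x'|w' y'|w' x0 t|w' y0 t|t] iq pq0 qp0.
  + exact: free_product_dist_sheets pq0.
  + exact: free_product_dist_sheets pq0.
  + exact/esym/free_product_dist_edgeX.
  + exact/esym/free_product_dist_edgeY.
  + exact/esym/free_product_dist_edgeE.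
- exact: free_product_dist_edgeX.
- exact: free_product_dist_edgeY.
- exact: free_product_dist_edgeE.
Qed.

HB.instance Definition _ := isMetric.Build R free_product
  free_product_distxx free_product_dist_positivity free_product_dist_sym
  free_product_dist_triangle.

End FreeProduct.

(* Main.v *)
From HB Require Import structures.
From mathcomp Require Import all_boot all_order all_algebra.
From mathcomp Require Import sesquilinear interval_inference.
From mathcomp Require Import all_classical all_reals all_analysis.
From mathcomp Require Import ring lra zify.
Require Import Defs.

(** The sheets and edges of a free product - its cells - are the vertices and edges
of a tree, and the free product retracts onto each cell [c]: a point outside [c]
goes to the point where its route enters [c]. Pulled back along this retraction,
the metric of [c] becomes a pseudo-metric [cell_pdist c] on the whole space. On
the unique route between two points every cell is crossed from one projection to
the other, so the metric is the sum of the [cell_pdist c], of which only finitely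
many are nonzero at a given pair of points ([dist_sum_cells]). Each of the three
properties is therefore proved cell by cell and then summed or multiplied up. The
tree enters through two facts.

- Two distinct cells see each other through one point each, so the space is
  the union of a set that projects to one point of the first cell and a set that
  projects to one point of the second ([opposite_cells]).
- The cells that separate two points are counted by the distance of two words in
  the tree of words, and this distance is in turn at most the number of edges
  crossed from end to end, plus 2 ([count_cells], [crossing_edges]).

Hyperbolicity is the four-point inequality, in which one of two alternatives has
to hold. By the first fact two distinct cells cannot violate one alternative
each; so all cells satisfy the same alternative, or all of them but one satisfy
both. Summing over the cells gives the inequality without loss
([decomposition_hyperbolic]).

For coarse embeddings, the maps given on the cells are put together in the
l2 sum of their targets. That this sum is again uniformly convex is a theorem of
Day; it is proved here by rewriting uniform convexity as a linear inequality
between squared norms, which can be added up ([uniformly_convex_gain],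
[l2_sum_gain]). If the images of two points are close, few edges are crossed
between them, hence few cells, and the distance in each of them is controlled
([decomposition_coarse_embedding]).

Property A is equivalent to the existence of kernels of positive type that are
almost 1 at bounded distance and vanish at large distance
([property_A_kernel]). Kernels given on the cells are multiplied: by Schur's
theorem the product is of positive type, and it is close to 1 at bounded
distance because few factors differ from 1. The product does not vanish on long
routes made of short pieces, so it is multiplied by a kernel of this kind on the
tree of words ([decomposition_property_A]). The passage from a kernel back to
vectors in a Hilbert space goes through the reproducing kernel Hilbert space,
whose inner product is found by the theorem of Jordan and von Neumann. *)

Set Implicit Arguments.
Unset Strict Implicit.
Unset Printing Implicit Defensive.

Import Order.TTheory GRing.Theory Num.Def Num.Theory.
Import numFieldNormedType.Exports.

Local Open Scope classical_set_scope.
Local Open Scope ring_scope.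

(** * Vectors bounded for a family of seminorms *)

(** The last two fields relate the seminorms to finitely many coordinates, in both
directions; this makes the space of vectors on which all seminorms are bounded
complete under the supremum of the seminorms. The l2 sum of Banach spaces and the
reproducing kernel Hilbert space of a kernel are both of this form. *)
Record seminorm_family (R : realType) (I : Type)
    (E : I -> completeNormedModType R) (J : Type) := SeminormFamily {
  seminorm :> J -> (forall i, E i) -> R;
  seminormD : forall j x y,
    seminorm j (fun i => x i + y i) <= seminorm j x + seminorm j y;
  seminormZ : forall j a x, seminorm j (fun i => a *: x i) = `|a| * seminorm j x;
  seminorm_cont : forall j, exists (s : seq I) (K : R),
    0 <= K /\ forall x, seminorm j x <= K * \sum_(i <- s) `|x i|;
  seminorm_coord : forall i, exists j (K : R),
    0 <= K /\ forall x, `|x i| <= K * seminorm j x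
}.

Section BoundedSpace.
Context {R : realType} {I : Type} {E : I -> completeNormedModType R} {J : Type}.
Variable n : seminorm_family E J.

Record bounded_space := BoundedVector {
  coord :> forall i, E i;
  coord_bounded : exists M, forall j, n j coord <= M
}.

HB.instance Definition _ := gen_eqMixin bounded_space.
HB.instance Definition _ := gen_choiceMixin bounded_space.

Lemma bounded_space_eq (x y : bounded_space) : (forall i, x i = y i) -> x = y.
Proof.
case: x y => [x Mx] [y My] /= xy.
have xy' : x = y by exact: functional_extensionality_dep.
by subst y; congr BoundedVector; exact: Prop_irrelevance.
Qed.

Fact bounded_zero_subproof : exists M, forall j, n j (fun=> 0) <= M.
Proof.
exists 0 => j.
have -> : (fun i => 0 : E i) = (fun i => 0 *: (0 : E i)).
  by apply: functional_extensionality_dep => i; rewrite scaler0.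
by rewrite seminormZ normr0 mul0r.
Qed.

Fact bounded_add_subproof (x y : bounded_space) :
  exists M, forall j, n j (fun i => x i + y i) <= M.
Proof.
have [[A xA] [B yB]] := (coord_bounded x, coord_bounded y).
by exists (A + B) => j; rewrite (le_trans (seminormD _ _ _ _))// lerD.
Qed.

Fact bounded_scale_subproof a (x : bounded_space) :
  exists M, forall j, n j (fun i => a *: x i) <= M.
Proof.
have [A xA] := coord_bounded x.
by exists (`|a| * A) => j; rewrite seminormZ ler_wpM2l.
Qed.

Definition bounded_zero := BoundedVector bounded_zero_subproof.
Definition bounded_add x y := BoundedVector (bounded_add_subproof x y).
Definition bounded_scale a x := BoundedVector (bounded_scale_subproof a x).

Fact bounded_addA : associative bounded_add.
Proof. by move=> x y z; apply: bounded_space_eq => i /=; rewrite addrA. Qed.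
Fact bounded_addC : commutative bounded_add.
Proof. by move=> x y; apply: bounded_space_eq => i /=; rewrite addrC. Qed.
Fact bounded_add0 : left_id bounded_zero bounded_add.
Proof. by move=> x; apply: bounded_space_eq => i /=; rewrite add0r. Qed.
Fact bounded_addN : left_inverse bounded_zero (bounded_scale (-1)) bounded_add.
Proof.
by move=> x; apply: bounded_space_eq => i /=; rewrite scaleN1r addNr.
Qed.

HB.instance Definition _ := GRing.isZmodule.Build bounded_space
  bounded_addA bounded_addC bounded_add0 bounded_addN.

Fact bounded_scaleA a b x :
  bounded_scale a (bounded_scale b x) = bounded_scale (a * b) x.
Proof. by apply: bounded_space_eq => i /=; rewrite scalerA. Qed.
Fact bounded_scale1 : left_id 1 bounded_scale.
Proof. by move=> x; apply: bounded_space_eq => i /=; rewrite scale1r. Qed.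
Fact bounded_scaleDr : right_distributive bounded_scale +%R.
Proof. by move=> a x y; apply: bounded_space_eq => i /=; rewrite scalerDr. Qed.
Fact bounded_scaleDl x :
  {morph bounded_scale^~ x : a b / a + b >-> a + b}.
Proof. by move=> a b; apply: bounded_space_eq => i /=; rewrite scalerDl. Qed.

HB.instance Definition _ := GRing.Zmodule_isLmodule.Build R bounded_space
  bounded_scaleA bounded_scale1 bounded_scaleDr bounded_scaleDl.

(** With 0 added, the supremum is taken over a nonempty set even if [J] is empty. *)
Definition seminorm_values (x : bounded_space) : set R :=
  [set r | r = 0 \/ exists j, r = n j x].

Lemma has_sup_seminorm_values x : has_sup (seminorm_values x).
Proof.
split; first by exists 0; left.
have [M xM] := coord_bounded x; exists (maxr 0 M) => r [->|[j ->]].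
  by rewrite le_max lexx.
by rewrite le_max xM orbT.
Qed.

Definition sup_norm (x : bounded_space) : R := sup (seminorm_values x).

Lemma sup_norm_ge0 x : 0 <= sup_norm x.
Proof. by apply: sup_upper_bound; [exact: has_sup_seminorm_values|left]. Qed.

Lemma seminorm_le_sup_norm j (x : bounded_space) : n j x <= sup_norm x.
Proof.
by apply: sup_upper_bound; [exact: has_sup_seminorm_values|right; exists j].
Qed.

Lemma sup_norm_le (x : bounded_space) M :
  0 <= M -> (forall j, n j x <= M) -> sup_norm x <= M.
Proof.
move=> M0 xM; apply: ge_sup; first by exists 0; left.
by move=> r [->//|[j ->]].
Qed.

Fact sup_normD x y : sup_norm (x + y) <= sup_norm x + sup_norm y.
Proof.
apply: sup_norm_le => [|j]; first by rewrite addr_ge0 ?sup_norm_ge0.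
by rewrite (le_trans (seminormD _ _ _ _))// lerD ?seminorm_le_sup_norm.
Qed.

Fact sup_normZ_le a x : sup_norm (a *: x) <= `|a| * sup_norm x.
Proof.
apply: sup_norm_le => [|j]; first by rewrite mulr_ge0 ?sup_norm_ge0.
by rewrite seminormZ ler_wpM2l ?seminorm_le_sup_norm.
Qed.

Fact sup_normZ a x : sup_norm (a *: x) = `|a| * sup_norm x.
Proof.
apply/eqP; rewrite eq_le sup_normZ_le /=.
have [->|a0] := eqVneq a 0; first by rewrite normr0 mul0r sup_norm_ge0.
rewrite -ler_pdivlMl ?normr_gt0// -normfV.
by rewrite -{1}[x](scalerK a0) sup_normZ_le.
Qed.

Lemma coord_le_sup_norm i : exists2 K : R, 0 <= K &
  forall x : bounded_space, `|x i| <= K * sup_norm x.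
Proof.
have [j [K [K0 nK]]] := seminorm_coord n i; exists K => // x.
by rewrite (le_trans (nK x))// ler_wpM2l ?seminorm_le_sup_norm.
Qed.

Fact sup_norm0_eq0 x : sup_norm x = 0 -> x = 0.
Proof.
move=> x0; apply: bounded_space_eq => i; apply/eqP.
have [K K0 /(_ x)] := coord_le_sup_norm i.
by rewrite x0 mulr0 normr_le0.
Qed.

HB.instance Definition _ := Lmodule_isNormed.Build R bounded_space
  sup_normD sup_normZ sup_norm0_eq0.

Lemma bounded_space_normE x : `|x| = sup_norm x. Proof. by []. Qed.

Lemma seminorm_le_norm j (x : bounded_space) : n j x <= `|x|.
Proof. exact: seminorm_le_sup_norm. Qed.

Lemma norm_le_seminorm (x : bounded_space) M :
  0 <= M -> (forall j, n j x <= M) -> `|x| <= M.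
Proof. exact: sup_norm_le. Qed.

Lemma coord_cauchy (F : set_system bounded_space) i :
  ProperFilter F -> cauchy F -> cvg ((fun x : bounded_space => x i) @ F).
Proof.
move=> FF Fc; apply: cauchy_cvg; apply/cauchyP => e e0.
have [K K0 nK] := coord_le_sup_norm i.
have K1 : 0 < K + 1 by rewrite ltr_wpDl.
have /cauchyP /(_ (e / (K + 1))) [|x Fx] := Fc; first by rewrite divr_gt0.
exists (x i).
suff : F [set y : bounded_space | ball (x i) e (y i)] by [].
apply: filterS Fx => y; rewrite /= -!ball_normE /= => xy.
have -> : x i - y i = (x - y) i by rewrite /= scaleN1r.
apply: le_lt_trans (nK _) _.
rewrite -bounded_space_normE (@le_lt_trans _ _ ((K + 1) * `|x - y|))//.
  by rewrite ler_wpM2r// lerDl.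
by rewrite -ltr_pdivlMl// mulrC.
Qed.

(** The limit [y] is taken in each coordinate. A single seminorm of [x - y] is then
small for [x] late in the filter, but how late depends on the seminorm; comparing
[x] with an even later [x'], chosen for that seminorm, removes this dependence. *)
Fact bounded_space_complete (F : set_system bounded_space) :
  ProperFilter F -> cauchy F -> cvg F.
Proof.
move=> FF Fc.
pose y i : E i := lim ((fun x : bounded_space => x i) @ F).
have Fy i : (fun x : bounded_space => x i) @ F --> y i by exact: coord_cauchy.
have near_y j (e : R) : 0 < e ->
      \forall x \near F, n j (fun i => (x : bounded_space) i - y i) < e.
  move=> e0; have [s [K [K0 nK]]] := seminorm_cont n j.
  have sum_y (e' : R) : 0 < e' ->
      \forall x \near F, \sum_(i <- s) `|(x : bounded_space) i - y i| < e'.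
    elim: s e' {nK} => [|i s IH] e' e'0.
      by near=> x; rewrite big_nil.
    have e'2 : 0 < e' / 2 by rewrite divr_gt0.
    near=> x; rewrite big_cons [e']splitr ltrD//.
      by rewrite distrC; near: x; move/cvgrPdist_lt : (Fy i) => /(_ _ e'2).
    by near: x; apply: IH.
  have K1 : 0 < K + 1 by rewrite ltr_wpDl.
  have eK : 0 < e / (K + 1) by rewrite divr_gt0.
  near=> x; apply: le_lt_trans (nK _) _.
  apply: (@le_lt_trans _ _ ((K + 1) * \sum_(i <- s) `|x i - y i|)).
    by rewrite ler_wpM2r ?lerDl// sumr_ge0.
  by rewrite -ltr_pdivlMl// mulrC; near: x; exact: sum_y.
have Fnear (e : R) : 0 < e ->
    \forall x \near F, forall j, n j (fun i => (x : bounded_space) i - y i) <= e.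
  move=> e0; have e2 : 0 < e / 2 by rewrite divr_gt0.
  have e4 : 0 < e / 2 / 2 by rewrite divr_gt0.
  have /cauchyP /(_ _ e4) [x0 Fx0] := Fc.
  apply: filterS (Fx0) => x; rewrite -ball_normE /= => x0x j.
  have [x' [x0x' x'y]] := filter_ex (filterI Fx0 (near_y j _ e2)).
  rewrite -ball_normE /= in x0x'.
  have -> : (fun i => x i - y i) = (fun i => (x - x') i + (x' i - y i)).
    apply: functional_extensionality_dep => i /=.
    by rewrite scaleN1r addrA subrK.
  apply: le_trans (seminormD n _ _ _) _.
  rewrite [leRHS]splitr lerD ?(ltW x'y)//.
  apply: le_trans (seminorm_le_norm _ _) _.
  apply: le_trans (ler_distD x0 _ _) _.
  by rewrite [leRHS]splitr lerD ?ltW// distrC.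
have yB : exists M, forall j, n j y <= M.
  have [x xy] := filter_ex (Fnear _ ltr01); exists (`|x| + 1) => j.
  have -> : y = (fun i => x i + -1 *: (x i - y i)).
    apply: functional_extensionality_dep => i.
    by rewrite scaleN1r opprB addrC subrK.
  rewrite (le_trans (seminormD n _ _ _))// lerD ?seminorm_le_norm//.
  by rewrite seminormZ normrN1 mul1r.
apply/cvg_ex; exists (BoundedVector yB); apply/cvgrPdist_le => e e0.
apply: filterS (Fnear _ e0) => x xy; rewrite distrC.
apply: norm_le_seminorm => [|j]; first exact: ltW.
have -> : (x - BoundedVector yB : bounded_space) = (fun i => x i - y i)
    :> (forall i, E i).
  by apply: functional_extensionality_dep => i /=; rewrite scaleN1r.
exact: xy.
Unshelve. all: by end_near. Qed.

HB.instance Definition _ := Uniform_isComplete.Build bounded_space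
  bounded_space_complete.

End BoundedSpace.

(** * Uniform convexity in terms of squared norms *)

Section UniformConvexity.
Context {R : realType}.

(** A strict form of the convexity of the squared norm. It is linear in squared norms,
unlike the condition on unit vectors that defines uniform convexity, so that it
can be summed over the coordinates of an l2 sum. Each [c > 0] has its own gain [g], and
[c] measures how large [`|x - y|] has to be for the gain to show. *)
Definition square_convex_gain (c g : R) (E : normedModType R) : Prop :=
  forall x y : E, `|2^-1 *: (x + y)| ^+ 2 + g * `|x - y| ^+ 2
    <= (2^-1 + g * c) * (`|x| ^+ 2 + `|y| ^+ 2).

Lemma norm_midpoint_le (E : normedModType R) (x y : E) :
  `|2^-1 *: (x + y)| <= 2^-1 * (`|x| + `|y|).
Proof.
by rewrite normrZ ger0_norm ?invr_ge0// ler_wpM2l ?invr_ge0// ler_normD.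
Qed.

Lemma sqr_midpoint_le (m a b : R) : 0 <= m -> m <= 2^-1 * (a + b) ->
  m ^+ 2 <= 2^-1 * (a ^+ 2 + b ^+ 2) - (a - b) ^+ 2 / 4.
Proof.
move=> m0 mab.
have : m ^+ 2 <= (2^-1 * (a + b)) ^+ 2.
  by rewrite lerXn2r ?nnegrE// (le_trans m0).
lra.
Qed.

(** A smaller gain holds by interpolation with plain convexity; this provides one gain
for several spaces. *)
Lemma square_convex_gain_le c g g' (E : normedModType R) :
  0 < g' -> g' <= g -> square_convex_gain c g E -> square_convex_gain c g' E.
Proof.
move=> g'0 g'g gain x y; have := gain x y; have := norm_midpoint_le x y.
have := normr_ge0 (2^-1 *: (x + y)).
set m := `|_ *: _|; set d := `|x - y|; set a := `|x|; set b := `|y|.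
move=> m0 mab gxy.
have g0 : 0 < g by apply: lt_le_trans g'g.
have conv : m ^+ 2 <= 2^-1 * (a ^+ 2 + b ^+ 2).
  by have := sqr_midpoint_le m0 mab; have := sqr_ge0 (a - b); lra.
have : (g' / g) * (m ^+ 2 - 2^-1 * (a ^+ 2 + b ^+ 2) + g * d ^+ 2) <=
       (g' / g) * (g * c * (a ^+ 2 + b ^+ 2)).
  by apply: ler_wpM2l; [rewrite divr_ge0 // ltW|lra].
have -> : (g' / g) * (g * c * (a ^+ 2 + b ^+ 2)) = g' * c * (a ^+ 2 + b ^+ 2).
  by field; rewrite gt_eqF.
have -> : (g' / g) * (m ^+ 2 - 2^-1 * (a ^+ 2 + b ^+ 2) + g * d ^+ 2) =
  (g' / g) * (m ^+ 2 - 2^-1 * (a ^+ 2 + b ^+ 2)) + g' * d ^+ 2.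
  by field; rewrite gt_eqF.
have q1 : g' / g <= 1 by rewrite ler_pdivrMr// mul1r.
have : 0 <= (1 - g' / g) * (2^-1 * (a ^+ 2 + b ^+ 2) - m ^+ 2).
  by rewrite mulr_ge0 ?subr_ge0.
by move: (g' / g) q1 => q q1; lra.
Qed.

(** If [x1] and [y1] are the unit vectors along [x] and [y], then
[x + y = `|y| *: (x1 + y1) + (`|x| - `|y|) *: x1], and the modulus of convexity
applies to [x1 + y1]. *)
Lemma uniformly_convex_midpoint (E : normedModType R) (e delta : R) (x y : E) :
  (forall x y : E, `|x| = 1 -> `|y| = 1 -> e <= `|x - y| ->
      `|2^-1 *: (x + y)| <= 1 - delta) ->
  0 < `|y| -> `|y| <= `|x| -> e * `|x| <= `|x - y| - (`|x| - `|y|) ->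
  `|2^-1 *: (x + y)| <= `|y| * (1 - delta) + 2^-1 * (`|x| - `|y|).
Proof.
move=> uc b0 ba dist; have a0 : 0 < `|x| by apply: lt_le_trans ba.
set a := `|x| in a0 ba dist *; set b := `|y| in b0 ba dist *.
pose x1 := a^-1 *: x; pose y1 := b^-1 *: y.
have x11 : `|x1| = 1.
  by rewrite normrZ ger0_norm ?invr_ge0 ?ltW// mulVf// gt_eqF.
have y11 : `|y1| = 1.
  by rewrite normrZ ger0_norm ?invr_ge0 ?ltW// mulVf// gt_eqF.
have xE : x = a *: x1 by rewrite scalerA mulfV ?scale1r// gt_eqF.
have yE : y = b *: y1 by rewrite scalerA mulfV ?scale1r// gt_eqF.
have xy1 : e <= `|x1 - y1|.
  rewrite -(ler_pM2r a0) (le_trans dist)//.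
  rewrite lerBlDr.
  have -> : x - y = a *: (x1 - y1) + (a - b) *: y1.
    by rewrite scalerBr scalerBl -xE -yE addrA subrK.
  rewrite (le_trans (ler_normD _ _))// lerD//.
    by rewrite normrZ mulrC ger0_norm// ltW.
  by rewrite normrZ y11 mulr1 ger0_norm// subr_ge0.
have -> : 2^-1 *: (x + y) = b *: (2^-1 *: (x1 + y1)) + (2^-1 * (a - b)) *: x1.
  rewrite -scalerA [b *: _]scalerA mulrC -scalerA -scalerDr; congr (_ *: _).
  by rewrite scalerDr -yE scalerBl -xE [RHS]addrC addrA subrK.
rewrite (le_trans (ler_normD _ _))// [`|b *: _|]normrZ [`|_ *: x1|]normrZ x11 mulr1.
rewrite lerD//.
  by rewrite (ger0_norm (ltW b0)) ler_pM2l//; exact: uc.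
by rewrite normrM [`|2^-1|]ger0_norm// [`|a - b|]ger0_norm// subr_ge0.
Qed.

(** Let [`|y| <= `|x|]. If [`|x - y|] is small compared to the norms, the term [g * c]
pays for [g * `|x - y| ^+ 2]. If [`|y|] is smaller than [`|x|] by a definite factor,
there is a gain in the convexity of the square of real numbers. Otherwise the unit
vectors along [x] and [y] are far apart and the modulus of convexity gives the gain. *)
Lemma uniformly_convex_gain (E : normedModType R) (c : R) :
  uniformly_convex E -> 0 < c -> exists2 g, 0 < g & square_convex_gain c g E.
Proof.
move=> ucE c0.
(* Since [2 * e <= c] and [2 * e <= 1], also [(2 * e) ^+ 2 <= c]: the distance of
   vectors that are not close is at least [2 * e * `|x|], half of which is left
   after normalization. *)
pose e : R := minr c 1 / 2.
have e0 : 0 < e by rewrite divr_gt0// lt_min c0 ltr01.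
have e_c : 2 * e <= c by rewrite /e mulrC divfK ?ge_min ?lexx.
have e_1 : 2 * e <= 1 by rewrite /e mulrC divfK ?ge_min ?lexx ?orbT.
clearbody e.
have [|delta0 d00 uc] := ucE e; first by apply/andP; split => //; lra.
pose delta := minr delta0 1.
have d0 : 0 < delta by rewrite lt_min d00 ltr01.
have dd : delta <= delta0 by rewrite ge_min lexx.
have d1 : delta <= 1 by rewrite ge_min lexx orbT.
pose g := minr (e ^+ 2 / 16) (delta / 8).
have g0 : 0 < g by rewrite lt_min !divr_gt0 ?exprn_gt0.
have g1 : 16 * g <= e ^+ 2.
  by rewrite mulrC -ler_pdivlMr// ge_min lexx.
have g2 : 8 * g <= delta by rewrite mulrC -ler_pdivlMr// ge_min lexx orbT.
clearbody g delta.
exists g => // x y.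
wlog ba : x y / `|y| <= `|x|.
  move=> H; have [/H//|/ltW/H] := leP `|y| `|x|.
  by rewrite [y + x]addrC [`|y - x|]distrC [`|y| ^+ 2 + _]addrC.
have mab := norm_midpoint_le x y; have dab := ler_normB x y.
have := @uniformly_convex_midpoint E e delta0 x y uc.
move: (normr_ge0 (2^-1 *: (x + y))) (normr_ge0 (x - y)) (normr_ge0 x) (normr_ge0 y).
move: mab dab ba; move: `|_ *: _| `|x - y| `|x| `|y| => m d a b.
move=> mab dab ba m0 dist0 a0 b0 mid.
have conv : m ^+ 2 <= 2^-1 * (a ^+ 2 + b ^+ 2) - (a - b) ^+ 2 / 4.
  exact: sqr_midpoint_le.
have [dc|dc] := leP (d ^+ 2) (c * (a ^+ 2 + b ^+ 2)); first by nra.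
have gc0 : 0 <= g * c * (a ^+ 2 + b ^+ 2).
  by rewrite !mulr_ge0 ?addr_ge0 ?sqr_ge0 ?(ltW g0) ?(ltW c0).
have d2 : d ^+ 2 <= 4 * a ^+ 2 by nra.
have gd2 : g * d ^+ 2 <= 4 * g * a ^+ 2.
  by rewrite [4 * g]mulrC -mulrA ler_wpM2l// ltW.
have ea : 2 * e * a <= d.
  rewrite leNgt; apply/negP => H.
  have H2 : d ^+ 2 <= (2 * e) ^+ 2 * a ^+ 2.
    by rewrite -exprMn lerXn2r ?nnegrE ?mulr_ge0 ?(ltW e0) ?(ltW H)//.
  have H3 : (2 * e) ^+ 2 <= c by nra.
  have H4 : (2 * e) ^+ 2 * a ^+ 2 <= c * a ^+ 2 by rewrite ler_wpM2r ?sqr_ge0.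
  have H5 : 0 <= c * b ^+ 2 by rewrite mulr_ge0 ?sqr_ge0 ?(ltW c0).
  lra.
have [bea|bea] := leP b ((1 - e) * a).
  have H1 : (e * a) ^+ 2 <= (a - b) ^+ 2.
    by rewrite lerXn2r ?nnegrE ?subr_ge0 ?mulr_ge0 ?(ltW e0)//; lra.
  have H2 : 16 * g * a ^+ 2 <= (e * a) ^+ 2.
    by rewrite exprMn ler_wpM2r ?sqr_ge0.
  lra.
have a_gt0 : 0 < a.
  rewrite lt_neqAle a0 andbT; apply/eqP => aE.
  by move: ba bea; rewrite -aE mulr0; lra.
have b2 : a <= 2 * b by nra.
have b_gt0 : 0 < b by lra.
have {}mid : m <= b * (1 - delta0) + 2^-1 * (a - b) by apply: mid => //; lra.
(* [`|y|] is now at least half of [`|x|] *)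
have mid' : m <= 2^-1 * (a + b) - delta * b by nra.
have mid2 : m <= 2^-1 * (a + b) - delta * a / 2 by nra.
have H1 : m ^+ 2 <= (2^-1 * (a + b) - delta * a / 2) ^+ 2.
  by rewrite lerXn2r ?nnegrE//; lra.
have H2 : (2^-1 * (a + b) - delta * a / 2) ^+ 2 <=
    2^-1 * (a ^+ 2 + b ^+ 2) - delta * a ^+ 2 / 2.
  have : 0 <= delta * a * (b - a / 2) by rewrite !mulr_ge0//; lra.
  have : delta ^+ 2 * a ^+ 2 <= delta * a ^+ 2.
    by rewrite ler_wpM2r ?sqr_ge0// expr2 ger_pMl.
  have : 0 <= (a - b) ^+ 2 by exact: sqr_ge0.
  lra.
have H3 : 8 * g * a ^+ 2 <= delta * a ^+ 2 by rewrite ler_wpM2r ?sqr_ge0.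
lra.
Qed.

(** On unit vectors with [eps <= `|x - y|], the choice [c = eps ^+ 2 / 4] leaves the
gain [g * eps ^+ 2 / 2] in the square of the midpoint. *)
Lemma square_convex_gain_uniformly_convex (E : normedModType R) :
  (forall c, 0 < c -> exists2 g, 0 < g & square_convex_gain c g E) ->
  uniformly_convex E.
Proof.
move=> H eps /andP[e0 _].
have [|g g0 gain] := H (eps ^+ 2 / 4); first by rewrite divr_gt0// exprn_gt0.
exists (g * eps ^+ 2 / 4); first by rewrite divr_gt0// mulr_gt0// exprn_gt0.
move=> x y x1 y1 exy; have := gain x y; rewrite x1 y1 expr1n.
have : eps ^+ 2 <= `|x - y| ^+ 2 by rewrite lerXn2r ?nnegrE ?(ltW e0).
rewrite -(ler_pM2l g0).
have := normr_ge0 (2^-1 *: (x + y)).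
move: `|_ *: _| (`|x - y| ^+ 2) => m d2 m0 d2e mle.
have m2 : m ^+ 2 <= 1 - g * eps ^+ 2 / 2 by lra.
nra.
Qed.

Lemma uniformly_convex_R : uniformly_convex R^o.
Proof.
move=> e /andP[e0 _]; exists 1 => // x y.
move=> /eqP; rewrite eqr_norml => /andP[x1 _].
move=> /eqP; rewrite eqr_norml => /andP[y1 _] exy.
have xy : x != y.
  by apply: contraTneq exy => ->; rewrite subrr normr0 leNgt e0.
suff -> : x + y = 0 by rewrite scaler0 normr0 subrr.
case/orP: x1 xy exy => /eqP ->; case/orP: y1 => /eqP ->; rewrite ?eqxx// => _ _.
  by rewrite subrr.
by rewrite addNr.
Qed.

End UniformConvexity.

(** * The l2 sum of a family of Banach spaces *)

Lemma sum_subset_le (R : realDomainType) (I : eqType) (s s' : seq I) (F : I -> R) :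
  (forall i, 0 <= F i) -> uniq s -> {subset s <= s'} ->
  \sum_(i <- s) F i <= \sum_(i <- s') F i.
Proof.
move=> F0 us ss'; apply: (@le_trans _ _ (\sum_(i <- undup s') F i)).
  have ps : perm_eq s [seq i <- undup s' | i \in s].
    apply: uniq_perm => //; first by rewrite filter_uniq ?undup_uniq.
    move=> i; rewrite mem_filter mem_undup.
    by case: (boolP (i \in s)) => // /ss' ->.
  rewrite (perm_big _ ps) big_filter /= [leRHS](bigID (mem s)) /=.
  by rewrite lerDl sumr_ge0.
elim: s' {ss'} => [|i s' IH] //=; rewrite big_cons.
case: ifP => _; first by rewrite (le_trans IH)// lerDr.
by rewrite big_cons lerD2l.
Qed.

Section L2Sum.
Context {R : realType} {I : choiceType} (E : I -> completeNormedModType R).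

Definition l2_seminorm (s : seq I) (x : forall i, E i) : R :=
  Num.sqrt (\sum_(i <- s) `|x i| ^+ 2).

Let sum_ge0 (s : seq I) (x : forall i, E i) : 0 <= \sum_(i <- s) `|x i| ^+ 2.
Proof. by rewrite sumr_ge0// => i _; rewrite sqr_ge0. Qed.

Lemma l2_seminorm_ge0 s x : 0 <= l2_seminorm s x.
Proof. exact: sqrtr_ge0. Qed.

Lemma l2_seminorm_sqr s x : l2_seminorm s x ^+ 2 = \sum_(i <- s) `|x i| ^+ 2.
Proof. exact: sqr_sqrtr. Qed.

Lemma l2_seminorm_cons i s x :
  l2_seminorm (i :: s) x ^+ 2 = `|x i| ^+ 2 + l2_seminorm s x ^+ 2.
Proof. by rewrite !l2_seminorm_sqr big_cons. Qed.

(** The inductive step of Minkowski's inequality for finite sums of squares. *)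
Lemma minkowski2 (a b a' b' c d : R) : 0 <= c -> 0 <= d ->
  a ^+ 2 + a' ^+ 2 = c ^+ 2 -> b ^+ 2 + b' ^+ 2 = d ^+ 2 ->
  (a + b) ^+ 2 + (a' + b') ^+ 2 <= (c + d) ^+ 2.
Proof.
move=> c0 d0 ac bd.
have cs : a * b + a' * b' <= c * d.
  rewrite (le_trans (ler_norm _))// -(@ler_pXn2r _ 2) ?nnegrE ?mulr_ge0//.
  rewrite real_normK ?num_real// exprMn -ac -bd.
  by have := sqr_ge0 (a * b' - a' * b); lra.
lra.
Qed.

Lemma l2_seminormD s x y :
  l2_seminorm s (fun i => x i + y i) <= l2_seminorm s x + l2_seminorm s y.
Proof.
elim: s => [|i s IH]; first by rewrite /l2_seminorm !big_nil sqrtr0 addr0.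
rewrite -(@ler_pXn2r _ 2) ?nnegrE ?addr_ge0 ?l2_seminorm_ge0//.
rewrite l2_seminorm_cons.
apply: (@le_trans _ _ ((`|x i| + `|y i|) ^+ 2
                       + (l2_seminorm s x + l2_seminorm s y) ^+ 2)).
  by rewrite lerD// lerXn2r ?nnegrE ?addr_ge0 ?l2_seminorm_ge0// ler_normD.
by apply: minkowski2; rewrite ?l2_seminorm_ge0// l2_seminorm_cons.
Qed.

Lemma l2_seminormZ s a x :
  l2_seminorm s (fun i => a *: x i) = `|a| * l2_seminorm s x.
Proof.
rewrite /l2_seminorm -[X in X * _]sqrtr_sqr -sqrtrM ?sqr_ge0//.
rewrite mulr_sumr; congr Num.sqrt; apply: eq_bigr => i _.
by rewrite normrZ exprMn real_normK ?num_real.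
Qed.

Lemma l2_seminorm_le_sum s x : l2_seminorm s x <= \sum_(i <- s) `|x i|.
Proof.
elim: s => [|i s IH]; first by rewrite /l2_seminorm !big_nil sqrtr0.
have S0 : 0 <= \sum_(j <- s) `|x j| by rewrite sumr_ge0.
rewrite big_cons -(@ler_pXn2r _ 2) ?nnegrE ?addr_ge0 ?l2_seminorm_ge0//.
rewrite l2_seminorm_cons sqrrD lerD//.
  by rewrite lerDl mulrn_wge0// mulr_ge0.
by rewrite lerXn2r ?nnegrE ?l2_seminorm_ge0.
Qed.

Fact l2_family_cont s : exists (t : seq I) (K : R),
  0 <= K /\ forall x, l2_seminorm (undup s) x <= K * \sum_(i <- t) `|x i|.
Proof.
exists (undup s), 1; split => // x; rewrite mul1r; exact: l2_seminorm_le_sum.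
Qed.

Fact l2_family_coord i : exists s (K : R),
  0 <= K /\ forall x, `|x i| <= K * l2_seminorm (undup s) x.
Proof.
exists [:: i], 1; split => // x; rewrite mul1r /l2_seminorm big_seq1.
by rewrite sqrtr_sqr normr_id.
Qed.

(** Duplicates are removed from the list of indices so that no coordinate is counted
twice. *)
Definition l2_family : seminorm_family E (seq I) :=
  @SeminormFamily R I E (seq I) (fun s => l2_seminorm (undup s))
    (fun s => @l2_seminormD (undup s)) (fun s => @l2_seminormZ (undup s))
    l2_family_cont l2_family_coord.

Definition l2_sum : completeNormedModType R := bounded_space l2_family.

Lemma l2_sum_le_norm (s : seq I) (x : l2_sum) : uniq s ->
  \sum_(i <- s) `|x i| ^+ 2 <= `|x| ^+ 2.
Proof.
move=> us; rewrite -l2_seminorm_sqr lerXn2r ?nnegrE ?l2_seminorm_ge0//.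
by have := seminorm_le_norm s x; rewrite /= undup_id.
Qed.

Lemma l2_norm_le_sum (x : l2_sum) (M : R) :
  (forall s, uniq s -> \sum_(i <- s) `|x i| ^+ 2 <= M) -> `|x| ^+ 2 <= M.
Proof.
move=> xM; have M0 : 0 <= M by have := xM [::] isT; rewrite big_nil.
rewrite -[M]sqr_sqrtr// lerXn2r ?nnegrE ?sqrtr_ge0//.
apply: norm_le_seminorm; [exact: sqrtr_ge0|move=> s].
by rewrite ler_wsqrtr// xM ?undup_uniq.
Qed.

Lemma l2_norm_support (s : seq I) (x : l2_sum) : uniq s ->
  (forall i, i \notin s -> x i = 0) -> `|x| ^+ 2 = \sum_(i <- s) `|x i| ^+ 2.
Proof.
move=> us xs; apply/eqP; rewrite eq_le l2_sum_le_norm// andbT.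
apply: l2_norm_le_sum => t ut.
rewrite (bigID (mem s)) /= [X in _ + X]big1 ?addr0; last first.
  by move=> i /xs ->; rewrite normr0 expr0n.
rewrite -big_filter sum_subset_le ?filter_uniq// => i.
by rewrite mem_filter => /andP[].
Qed.

Lemma l2_finite_support_bounded (s : seq I) (x : forall i, E i) :
  (forall i, i \notin s -> x i = 0) -> exists M, forall t, l2_family t x <= M.
Proof.
move=> xs; exists (l2_seminorm s x) => t /=; rewrite ler_wsqrtr//.
rewrite (bigID (mem s)) /= [X in _ + X]big1 ?addr0; last first.
  by move=> i /xs ->; rewrite normr0 expr0n.
rewrite -big_filter sum_subset_le ?filter_uniq ?undup_uniq// => i.
by rewrite mem_filter => /andP[].
Qed.

(** The gain holds coordinatewise, hence for sums over any finite set of indices. Since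
partial sums of squares increase with the index set, the two norms on the left may
be approximated over different sets, which makes it possible to pass to the two
suprema one after the other. *)
Lemma l2_sum_gain (c g : R) : 0 < c -> 0 < g ->
  (forall i, square_convex_gain c g (E i)) -> square_convex_gain c g l2_sum.
Proof.
move=> c0 g0 gain x y.
have gc0 : 0 <= 2^-1 + g * c by rewrite addr_ge0 ?mulr_ge0 ?invr_ge0 ?ltW.
set M := _ * (_ + _).
have key s t : uniq s -> uniq t ->
    \sum_(i <- s) `|(2^-1 *: (x + y) : l2_sum) i| ^+ 2
    + g * \sum_(i <- t) `|(x - y) i| ^+ 2 <= M.
  move=> us ut; pose w := undup (s ++ t).
  have uw : uniq w by exact: undup_uniq.
  have sw (i : I) : i \in s -> i \in w by rewrite mem_undup mem_cat => ->.
  have tw (i : I) : i \in t -> i \in w by rewrite mem_undup mem_cat orbC => ->.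
  apply: (@le_trans _ _ (\sum_(i <- w) `|(2^-1 *: (x + y) : l2_sum) i| ^+ 2
                         + g * \sum_(i <- w) `|(x - y) i| ^+ 2)).
    by rewrite lerD ?ler_pM2l// sum_subset_le// => i; rewrite sqr_ge0.
  apply: (@le_trans _ _ ((2^-1 + g * c) * (\sum_(i <- w) `|x i| ^+ 2
                                     + \sum_(i <- w) `|y i| ^+ 2))).
    rewrite mulr_sumr -!big_split /= mulr_sumr ler_sum// => i _.
    by have := gain i (x i) (y i); rewrite scaleN1r.
  by rewrite ler_wpM2l// lerD// l2_sum_le_norm.
rewrite -lerBrDr; apply: l2_norm_le_sum => s us.
rewrite lerBrDl -lerBrDr -ler_pdivlMl//; apply: l2_norm_le_sum => t ut.
by rewrite ler_pdivlMl// lerBrDl key.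
Qed.

Lemma l2_sum_uniformly_convex :
  (forall c, 0 < c -> exists2 g, 0 < g & forall i, square_convex_gain c g (E i)) ->
  uniformly_convex l2_sum.
Proof.
move=> H; apply: square_convex_gain_uniformly_convex => c c0.
by have [g g0 gE] := H c c0; exists g => //; exact: l2_sum_gain.
Qed.

End L2Sum.

(** * Kernels of positive type *)

Section PositiveType.
Context {R : realType}.

(** A list of pairs of a coefficient and a point stands for a formal linear combination
of points, on which functions act by linear extension. *)
Definition lincomb {Z : Type} (v : seq (R * Z)) (f : Z -> R) : R :=
  \sum_(a <- v) a.1 * f a.2.

(** The bilinear extension of [k] to formal linear combinations. *)
Definition kform {Z : Type} (k : Z -> Z -> R) (v w : seq (R * Z)) : R :=
  lincomb v (fun z => lincomb w (k z)).

Definition positive_type {Z : Type} (k : Z -> Z -> R) : Prop :=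
  (forall z w, k z w = k w z) /\ forall v, 0 <= kform k v v.

Definition lscale {Z : Type} (t : R) (v : seq (R * Z)) : seq (R * Z) :=
  [seq (t * a.1, a.2) | a <- v].

Section Lincomb.
Context {Z : Type}.
Implicit Types (v w : seq (R * Z)) (f g : Z -> R) (k : Z -> Z -> R).

Lemma lincomb_cat v w f : lincomb (v ++ w) f = lincomb v f + lincomb w f.
Proof. exact: big_cat. Qed.

Lemma lincomb_scale t v f : lincomb (lscale t v) f = t * lincomb v f.
Proof.
by rewrite /lincomb big_map mulr_sumr; apply: eq_bigr => a _; rewrite mulrA.
Qed.

Lemma lincomb1 a z f : lincomb [:: (a, z)] f = a * f z.
Proof. exact: big_seq1. Qed.

Lemma lincombD v f g : lincomb v (fun z => f z + g z) = lincomb v f + lincomb v g.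
Proof. by rewrite -big_split; apply: eq_bigr => a _; rewrite mulrDr. Qed.

Lemma lincombZ v t f : lincomb v (fun z => t * f z) = t * lincomb v f.
Proof. by rewrite mulr_sumr; apply: eq_bigr => a _; rewrite mulrCA. Qed.

Lemma lincomb_sum (I : Type) (s : seq I) v (f : I -> Z -> R) :
  lincomb v (fun z => \sum_(i <- s) f i z) = \sum_(i <- s) lincomb v (f i).
Proof.
rewrite exchange_big; apply: eq_bigr => a _ /=; exact: mulr_sumr.
Qed.

Lemma eq_lincomb v f g : f =1 g -> lincomb v f = lincomb v g.
Proof. by move=> fg; apply: eq_bigr => a _; rewrite fg. Qed.

Lemma kform_catl k u v w : kform k (u ++ v) w = kform k u w + kform k v w.
Proof. exact: lincomb_cat. Qed.

Lemma kform_catr k u v w : kform k w (u ++ v) = kform k w u + kform k w v.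
Proof. by rewrite -lincombD; apply: eq_lincomb => z; exact: lincomb_cat. Qed.

Lemma kform_scalel k t v w : kform k (lscale t v) w = t * kform k v w.
Proof. exact: lincomb_scale. Qed.

Lemma kform_scaler k t v w : kform k w (lscale t v) = t * kform k w v.
Proof. by rewrite -lincombZ; apply: eq_lincomb => z; exact: lincomb_scale. Qed.

Lemma kform_sum k1 (I : Type) (s : seq I) (k : I -> Z -> Z -> R) v w :
  (forall z z', k1 z z' = \sum_(i <- s) k i z z') ->
  kform k1 v w = \sum_(i <- s) kform (k i) v w.
Proof.
move=> k1E; rewrite -lincomb_sum; apply: eq_lincomb => z.
by rewrite -lincomb_sum; exact: eq_lincomb.
Qed.

Lemma kform_rank1 f v w :
  kform (fun z z' => f z * f z') v w = lincomb v f * lincomb w f.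
Proof.
rewrite mulrC -lincombZ; apply: eq_lincomb => z.
by rewrite lincombZ mulrC.
Qed.

Lemma kformC k v w : (forall z z', k z z' = k z' z) -> kform k v w = kform k w v.
Proof.
move=> kC; rewrite /kform /lincomb.
under eq_bigr => a _ do rewrite mulr_sumr.
under [RHS]eq_bigr => a _ do rewrite mulr_sumr.
rewrite exchange_big /=; apply: eq_bigr => a _; apply: eq_bigr => b _.
by rewrite mulrCA kC.
Qed.

Lemma kform_cauchy_schwarz k v w : positive_type k ->
  kform k v w ^+ 2 <= kform k v v * kform k w w.
Proof.
case=> kC kp; set A := kform k v v; set B := kform k v w; set C := kform k w w.
have q x y : 0 <= x ^+ 2 * A + 2 * x * y * B + y ^+ 2 * C.
  have := kp (lscale x v ++ lscale y w).
  rewrite kform_catl !kform_catr !kform_scalel !kform_scaler.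
  rewrite -/A -/B -/C (@kformC k w v kC) -/B.
  by congr (_ <= _); ring.
have A0 : 0 <= A by exact: kp.
have C0 : 0 <= C by exact: kp.
have [Apos|A_le0] := ltP 0 A.
  have := q (- B) A; have -> : (- B) ^+ 2 * A + 2 * - B * A * B + A ^+ 2 * C
    = A * (A * C - B ^+ 2) by ring.
  by rewrite pmulr_rge0// subr_ge0.
have AE : A = 0 by apply/le_anti; rewrite A0 A_le0.
(* at this point the form is [- (C + 2) * B ^+ 2] *)
have := q (- (C + 1)) B; rewrite AE mulr0 add0r mul0r.
by have := sqr_ge0 B; nra.
Qed.

Lemma positive_type_le0 k a z : positive_type k -> k a a = 0 -> k a z = 0.
Proof.
move=> kp kaa; have := kform_cauchy_schwarz [:: (1, a)] [:: (1, z)] kp.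
rewrite /kform !lincomb1 kaa !mul1r mul0r => k0.
by apply/eqP; rewrite -sqrf_eq0 eq_le k0 sqr_ge0.
Qed.

End Lincomb.

Lemma positive_type_comp (Z T : Type) (f : T -> Z) (k : Z -> Z -> R) :
  positive_type k -> positive_type (fun s t => k (f s) (f t)).
Proof.
case=> kC kp; split=> [s t|v]; first exact: kC.
have := kp [seq (a.1, f a.2) | a <- v].
rewrite /kform /lincomb big_map /=; congr (_ <= _).
by apply: eq_bigr => a _; rewrite big_map.
Qed.

Lemma positive_type1 (Z : Type) : positive_type (fun _ _ : Z => 1 : R).
Proof.
split=> // v; have := kform_rank1 (fun _ : Z => 1 : R) v v.
rewrite (_ : (fun _ _ => _) = fun _ _ => 1); last first.
  by apply/funext => ?; apply/funext => ?; rewrite mulr1.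
by move=> ->; rewrite -expr2 sqr_ge0.
Qed.

Lemma positive_type_sum (Z I : Type) (s : seq I) (k : I -> Z -> Z -> R) :
  (forall i, positive_type (k i)) ->
  positive_type (fun z w => \sum_(i <- s) k i z w).
Proof.
move=> kp; split=> [z w|v].
  by apply: eq_bigr => i _; exact: (kp i).1.
by rewrite (kform_sum _ _ (fun _ _ => erefl)) sumr_ge0// => i _; exact: (kp i).2.
Qed.

Lemma positive_type_scale (Z : Type) (c : R) (k : Z -> Z -> R) :
  0 <= c -> positive_type k -> positive_type (fun z w => c * k z w).
Proof.
move=> c0 [kC kp]; split=> [z w|v]; first by rewrite kC.
rewrite /kform (eq_lincomb _ (fun z => lincombZ v c (k z))) lincombZ.
by rewrite mulr_ge0// kp.
Qed.

(** Positivity is tested on finitely many points at a time, so a kernel may be replaced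
by another one that agrees with it there. *)
Lemma positive_type_local (Z : eqType) (k : Z -> Z -> R) :
  (forall s : seq Z, exists k', positive_type k' /\
     {in s &, forall z w, k z w = k' z w}) ->
  positive_type k.
Proof.
move=> H; split=> [z w|v].
  have [k' [[kC _] kE]] := H [:: z; w].
  by rewrite !kE ?inE ?eqxx ?orbT// kC.
have [k' [[_ kp] kE]] := H (map snd v); have := kp v.
congr (_ <= _); rewrite /kform /lincomb.
apply: eq_big_seq => a av; congr (_ * _); apply: eq_big_seq => b bv.
by rewrite kE//; apply: map_f.
Qed.

Lemma positive_type_eq (Z T : eqType) (f : Z -> T) :
  positive_type (fun z w => (f z == f w)%:R : R).
Proof.
apply: positive_type_local => s.
exists (fun z w => \sum_(c <- undup (map f s)) (f z == c)%:R * (f w == c)%:R).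
split; last first.
  move=> z w zs ws; have fz : f z \in undup (map f s).
    by rewrite mem_undup map_f.
  rewrite (bigD1_seq (f z)) ?undup_uniq//= eqxx mul1r eq_sym big1 ?addr0//.
  by move=> c; rewrite eq_sym => /negbTE ->; rewrite mul0r.
apply: positive_type_sum => c; split=> [z w|v]; first by rewrite mulrC.
by rewrite (kform_rank1 (fun z => (f z == c)%:R)) -expr2 sqr_ge0.
Qed.

(** Cholesky factorization. If [r] is of positive type and [r a a] is nonzero,
subtracting [r a z * r a w / r a a] leaves a kernel of positive type by the
Cauchy-Schwarz inequality, and this kernel vanishes as soon as one argument is [a]
or a point treated before. If [r a a = 0], then [r a] is already zero. *)
Lemma kernel_decomposition (Z : eqType) (k : Z -> Z -> R) (s : seq Z) :
  positive_type k -> exists us : seq (Z -> R),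
    {in s, forall z w, k z w = \sum_(u <- us) u z * u w}.
Proof.
move=> kp; suff [us [_ kE]] : exists us : seq (Z -> R),
    positive_type (fun z w => k z w - \sum_(u <- us) u z * u w) /\
    {in s, forall z w, k z w - \sum_(u <- us) u z * u w = 0}.
  by exists us => z zs w; apply/eqP; rewrite -subr_eq0; apply/eqP/kE.
elim: s => [|a s [us [rp r0]]].
  exists [::]; split=> //; have [kC kk] := kp; split=> [z w|v].
    by rewrite !big_nil !subr0.
  have := kk v; congr (_ <= _); apply: eq_lincomb => z; apply: eq_lincomb => w.
  by rewrite big_nil subr0.
pose r z w := k z w - \sum_(u <- us) u z * u w.
rewrite -/r in rp r0.
have [raa|raa] := eqVneq (r a a) 0.
  exists us; split=> // z; rewrite inE => /predU1P[->|zs] w; last exact: r0.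
  exact: (positive_type_le0 w rp raa).
have raa0 : 0 < r a a.
  rewrite lt_neqAle eq_sym raa /=.
  have := rp.2 [:: (1, a)]; by rewrite /kform !lincomb1 !mul1r.
exists ((fun z => r a z / Num.sqrt (r a a)) :: us).
pose r' z w := k z w
  - \sum_(u <- (fun z => r a z / Num.sqrt (r a a)) :: us) u z * u w.
have r'E z w : r' z w
   = r z w + - (r a a)^-1 * (r a z * r a w).
  rewrite /r' big_cons opprD addrCA addrC; congr (_ + _).
  rewrite mulNr; congr (- _); rewrite mulrACA mulrC; congr (_ * _).
  by rewrite -invfM -expr2 sqr_sqrtr// ltW.
rewrite -/r'; have -> : r' = (fun z w => r z w + - (r a a)^-1 * (r a z * r a w)).
  by apply/funext => z; apply/funext => w; exact: r'E.
split.
  split=> [z w|v]; first by rewrite rp.1 [r a z * _]mulrC.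
  have -> : kform (fun z w => r z w + - (r a a)^-1 * (r a z * r a w)) v v
     = kform r v v + - (r a a)^-1 * (lincomb v (r a) * lincomb v (r a)).
    rewrite -kform_rank1 -lincombZ -lincombD; apply: eq_lincomb => z.
    by rewrite -lincombZ -lincombD.
  have := kform_cauchy_schwarz [:: (1, a)] v rp.
  rewrite /kform !lincomb1 !mul1r -/(kform r v v) => cs.
  by rewrite mulNr subr_ge0 ler_pdivrMl// -expr2.
move=> z; rewrite inE => /predU1P[->|zs] w; rewrite -/(r' _ w) r'E.
  by rewrite mulNr mulKf// subrr.
by rewrite [r a z]rp.1 ![r z _]r0// mul0r mulr0 addr0.
Qed.

(** Schur's product theorem. On finitely many points [k] is a sum of kernels
[u z * u w], and multiplying [l] by such a kernel amounts to multiplying the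
coefficients of a linear combination by the values of [u]. *)
Lemma positive_type_mul (Z : eqType) (k l : Z -> Z -> R) :
  positive_type k -> positive_type l -> positive_type (fun z w => k z w * l z w).
Proof.
move=> kp lp; apply: positive_type_local => s.
have [us kE] := kernel_decomposition s kp.
exists (fun z w => \sum_(u <- us) u z * u w * l z w); split; last first.
  by move=> z w zs _; rewrite kE// mulr_suml.
apply: positive_type_sum => u; split=> [z w|v].
  by rewrite lp.1 [u z * _]mulrC.
have := lp.2 [seq (a.1 * u a.2, a.2) | a <- v].
rewrite /kform /lincomb big_map; congr (_ <= _).
apply: eq_bigr => a _; rewrite big_map /= !mulr_sumr; apply: eq_bigr => b _ /=.
ring.
Qed.

Lemma positive_type_prod (Z : eqType) (I : Type) (s : seq I) (k : I -> Z -> Z -> R) :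
  (forall i, positive_type (k i)) ->
  positive_type (fun z w => \prod_(i <- s) k i z w).
Proof.
move=> kp; elim: s => [|i s IH].
  rewrite (_ : (fun _ _ => _) = fun _ _ => 1); first exact: positive_type1.
  by apply/funext => ?; apply/funext => ?; rewrite big_nil.
rewrite (_ : (fun _ _ => _) = fun z w => k i z w * \prod_(i <- s) k i z w).
  exact: positive_type_mul.
by apply/funext => ?; apply/funext => ?; rewrite big_cons.
Qed.

End PositiveType.

(** * The theorem of Jordan and von Neumann *)

(** The function [f a - a * f 1] is additive, vanishes on integers and is bounded by
[K + `|f 1|] on the unit interval. Its value at [n * a] is thus bounded by this
constant for all [n], while it is [n] times its value at [a]. *)
Lemma additive_bounded_linear (R : realType) (f : R -> R) (K : R) :
  (forall a b, f (a + b) = f a + f b) -> (forall a, `|f a| <= K * `|a|) ->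
  forall a, f a = a * f 1.
Proof.
move=> fD fK.
have f0 : f 0 = 0 by apply: (addIr (f 0)); rewrite -fD !add0r.
have fN a : f (- a) = - f a.
  by apply: (addIr (f a)); rewrite -fD !addNr f0.
have fMn n a : f (n%:R * a) = n%:R * f a.
  elim: n => [|n IH]; first by rewrite !mul0r f0.
  by rewrite -natr1 !mulrDl !mul1r fD IH.
have fZ (m : int) : f m%:~R = m%:~R * f 1.
  have fn n : f n%:R = n%:R * f 1 by rewrite -[n%:R in LHS]mulr1 fMn.
  by case: m => n; [exact: fn|rewrite NegzE mulrNz fN mulNr fn].
move=> a; apply/eqP; rewrite -subr_eq0 -normr_le0.
apply/ler_addgt0Pl => e e0; rewrite addr0.
have K0 : 0 <= K by have := fK 1; rewrite normr1 mulr1; apply: le_trans.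
have [n nM] : exists n : nat, (K + `|f 1|) / e < n.+1%:R.
  exists (truncn ((K + `|f 1|) / e)).
  by apply: truncnS_gt.
have n0 : (0 : R) < n.+1%:R by rewrite ltr0n.
rewrite -(ler_pM2l n0) -{1}(ger0_norm (ltW n0)) -normrM mulrBr -fMn mulrA.
set b := n.+1%:R * a; set m := Num.floor b.
have bm : `|b - m%:~R| <= 1.
  have /andP[mb bm] := floor_itv b.
  rewrite ger0_norm ?subr_ge0// lerBlDl ltW//.
  by move: bm; rewrite intrD.
have -> : f b - b * f 1 = f (b - m%:~R) - (b - m%:~R) * f 1.
  by rewrite fD fN fZ; ring.
apply: (@le_trans _ _ (K + `|f 1|)).
  rewrite (le_trans (ler_normB _ _))// lerD//.
    rewrite (le_trans (fK _))// -[leRHS]mulr1 ler_wpM2l//.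
  by rewrite normrM ler_piMl.
by rewrite -ler_pdivrMr// ltW.
Qed.

Section Polarization.
Context {R : realType} {E : normedModType R}.

(** The opposite inequality is this one applied to [x + y] and [x - y]. *)
Definition parallelogram_le := forall x y : E,
  `|x + y| ^+ 2 + `|x - y| ^+ 2 <= 2 * (`|x| ^+ 2 + `|y| ^+ 2).

(** The proof of the parallelogram law is an argument so that the structure of an inner
product can be attached to this function. *)
Definition polar_form (_ : parallelogram_le) (x y : E) : R :=
  4^-1 * (`|x + y| ^+ 2 - `|x - y| ^+ 2).

Implicit Types x y z : E.

Hypothesis pl : parallelogram_le.
Local Notation dot := (polar_form pl).

Lemma parallelogram (x y : E) :
  `|x + y| ^+ 2 + `|x - y| ^+ 2 = 2 * (`|x| ^+ 2 + `|y| ^+ 2).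
Proof.
apply/le_anti; rewrite pl /=.
have := pl (x + y) (x - y).
have -> : x + y + (x - y) = 2 *: x by rewrite addrACA subrr addr0 scaler_nat.
have -> : x + y - (x - y) = 2 *: y.
  by rewrite opprB addrC addrA subrK scaler_nat.
rewrite !normrZ !exprMn ger0_norm//; lra.
Qed.

Lemma polar_formC x y : dot x y = dot y x.
Proof. by rewrite /polar_form [x + y]addrC [`|x - y|]distrC. Qed.

Lemma polar_formxx x : dot x x = `|x| ^+ 2.
Proof.
rewrite /polar_form subrr normr0 expr0n /= subr0 -mulr2n -(scaler_nat 2 x) normrZ.
by rewrite exprMn ger0_norm// mulrA (_ : 4^-1 * 2 ^+ 2 = 1) ?mul1r//; lra.
Qed.

(** The parallelogram laws at [(x + z, y)], [(y + z, x)], [(x - z, y)] and [(y - z, x)]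
add up to this identity with signs +, +, -, -. *)
Lemma polar_formDl x y z : dot (x + y) z = dot x z + dot y z.
Proof.
rewrite /polar_form.
have A := parallelogram (x + z) y; have B := parallelogram (y + z) x.
have A' := parallelogram (x - z) y; have B' := parallelogram (y - z) x.
have e1 : x + z + y = x + y + z by rewrite addrAC.
have e2 : y + z + x = x + y + z by rewrite addrC addrA.
have e3 : x - z + y = x + y - z by rewrite addrAC.
have e4 : y - z + x = x + y - z by rewrite addrC addrA.
have e5 : `|x - z - y| = `|y + z - x| by rewrite distrC opprB addrA.
have e6 : `|y - z - x| = `|x + z - y| by rewrite distrC opprB addrA.
rewrite e1 in A; rewrite e2 in B; rewrite e3 e5 in A'; rewrite e4 e6 in B'.
lra.
Qed.

Lemma polar_form_bound x y : `|dot x y| <= `|x| * `|y|.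
Proof.
have sqle a b : 0 <= a -> a <= b -> a ^+ 2 <= b ^+ 2 :> R.
  by move=> a0 ab; rewrite lerXn2r ?nnegrE// (le_trans a0).
have lesq a b : `|a| <= b -> a ^+ 2 <= b ^+ 2 :> R.
  by move=> ab; rewrite -real_normK ?num_real//; apply: sqle.
have := sqle _ _ (normr_ge0 _) (ler_normD x y).
have := sqle _ _ (normr_ge0 _) (ler_normB x y).
have := lesq _ _ (ler_dist_dist x y).
have := lesq _ _ (ler_dist_dist x (- y)); rewrite normrN opprK.
rewrite /polar_form ler_norml => *; apply/andP; split; lra.
Qed.

Lemma polar_formZl a x y : dot (a *: x) y = a * dot x y.
Proof.
have := @additive_bounded_linear R (fun a => dot (a *: x) y) (`|x| * `|y|).
move=> ->; first by rewrite scale1r.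
  by move=> b c; rewrite scalerDl polar_formDl.
by move=> b; rewrite (le_trans (polar_form_bound _ _))// normrZ -mulrA mulrC.
Qed.

Fact polar_form_bilinear :
  bilinear_for (GRing.Scale.Law.clone _ _ *%R _)
    (GRing.Scale.Law.clone _ _ (idfun \; *%R) _) dot.
Proof.
by split=> z a x y /=; rewrite ?[dot z _]polar_formC polar_formDl polar_formZl
   // ![dot _ z]polar_formC.
Qed.

HB.instance Definition _ := bilinear_isBilinear.Build R E E R _ _ dot
  polar_form_bilinear.

Fact polar_form_hermitian x y : dot x y = (-1) ^+ false * idfun (dot y x).
Proof. by rewrite expr0 mul1r polar_formC. Qed.

HB.instance Definition _ := isHermitianSesquilinear.Build R E false idfun dot
  polar_form_hermitian.

Fact polar_form_gt0 x : x != 0 -> 0 < dot x x.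
Proof. by move=> x0; rewrite polar_formxx exprn_gt0// normr_gt0. Qed.

HB.instance Definition _ := isDotProduct.Build R E dot polar_form_gt0.

Definition polar_dot : {dot E for idfun} := dot.

End Polarization.

(** * Reproducing kernel Hilbert spaces and Property A *)

Section ReproducingKernel.
Context {R : realType} {Z : Type} (k : Z -> Z -> R).
Hypothesis kp : positive_type k.

Definition unit_lincomb : Type := {v : seq (R * Z) | kform k v v <= 1}.

Definition UnitLincomb v (v1 : kform k v v <= 1) : unit_lincomb := exist _ v v1.

(** The space of functions on which these seminorms are bounded is the dual of the
pre-Hilbert space of formal linear combinations under [kform k]. A dual is complete,
and so neither a quotient nor a completion has to be formed. *)
Definition rk_seminorm (v : unit_lincomb) (f : Z -> R) : R := `|lincomb (sval v) f|.

Fact rk_seminormD v f g :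
  rk_seminorm v (fun z => f z + g z) <= rk_seminorm v f + rk_seminorm v g.
Proof. by rewrite /rk_seminorm lincombD ler_normD. Qed.

Fact rk_seminormZ v a f :
  rk_seminorm v (fun z => a *: (f z : R^o)) = `|a| * rk_seminorm v f.
Proof. by rewrite /rk_seminorm lincombZ normrM. Qed.

Fact rk_seminorm_cont v : exists (s : seq Z) (K : R),
  0 <= K /\ forall f, rk_seminorm v f <= K * \sum_(z <- s) `|f z|.
Proof.
rewrite /rk_seminorm; move: (sval v) => {}v.
exists (map snd v), (\sum_(a <- v) `|a.1|); split; first exact: sumr_ge0.
move=> f; elim: v => [|a v IH]; first by rewrite /lincomb !big_nil normr0 mul0r.
rewrite /lincomb /= !big_cons (le_trans (ler_normD _ _))// mulrDl.
apply: (@le_trans _ _ (`|a.1 * f a.2|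
    + (\sum_(a <- v) `|a.1|) * \sum_(z <- map snd v) `|f z|)).
  by rewrite lerD2l.
apply: lerD; first by rewrite normrM ler_wpM2l// lerDl sumr_ge0.
by rewrite ler_wpM2l ?sumr_ge0// lerDr.
Qed.

Fact rk_seminorm_coord z : exists v (K : R),
  0 <= K /\ forall f, `|f z| <= K * rk_seminorm v f.
Proof.
have kzz : 0 <= k z z by have := kp.2 [:: (1, z)]; rewrite /kform !lincomb1 !mul1r.
have s0 : 0 < k z z + 1 by rewrite ltr_wpDl.
have v1 : kform k [:: ((k z z + 1)^-1, z)] [:: ((k z z + 1)^-1, z)] <= 1.
  rewrite /kform !lincomb1 mulrCA mulrC ler_pdivrMr// mul1r.
  by rewrite ler_pdivrMl//; nra.
exists (UnitLincomb v1), (k z z + 1); split=> [|f]; first exact: ltW.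
rewrite /rk_seminorm lincomb1 normrM mulrA gtr0_norm ?invr_gt0// mulfV ?mul1r//.
by rewrite gt_eqF.
Qed.

Definition rk_family : @seminorm_family R Z (fun=> R^o) unit_lincomb :=
  @SeminormFamily R Z (fun=> R^o) _ rk_seminorm rk_seminormD rk_seminormZ
    rk_seminorm_cont rk_seminorm_coord.

Definition rk_space : completeNormedModType R := bounded_space rk_family.

Lemma rk_bound (f : rk_space) v : lincomb v f ^+ 2 <= `|f| ^+ 2 * kform k v v.
Proof.
have H s : 0 < s -> kform k v v <= s ^+ 2 -> `|lincomb v f| <= s * `|f|.
  move=> s0 vs; have v1 : kform k (lscale s^-1 v) (lscale s^-1 v) <= 1.
    by rewrite kform_scalel kform_scaler mulrA -invfM ler_pdivrMl ?mulr1 ?mulr_gt0.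
  have := seminorm_le_norm (UnitLincomb v1) f.
  rewrite /= /rk_seminorm lincomb_scale normrM gtr0_norm ?invr_gt0//.
  by rewrite ler_pdivrMl.
have q0 : 0 <= kform k v v by exact: kp.2.
rewrite -real_normK ?num_real//.
have [qpos|q_le0] := ltP 0 (kform k v v).
  rewrite -[X in _ * X](sqr_sqrtr q0) -exprMn mulrC.
  rewrite lerXn2r ?nnegrE ?mulr_ge0 ?sqrtr_ge0//.
  by apply: H; rewrite ?sqrtr_gt0// sqr_sqrtr.
have -> : kform k v v = 0 by apply/le_anti; rewrite q0 q_le0.
rewrite mulr0; suff -> : `|lincomb v f| = 0 by rewrite expr0n.
apply/le_anti; rewrite normr_ge0 andbT; apply/ler_addgt0Pl => e e0; rewrite addr0.
have f1 : 0 < `|f| + 1 by rewrite ltr_wpDl.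
apply: (@le_trans _ _ (e / (`|f| + 1) * `|f|)).
  by apply: H; rewrite ?divr_gt0// (le_trans q_le0)// sqr_ge0.
by rewrite mulrAC ler_pdivrMr// ler_pM2l// lerDl.
Qed.

Lemma rk_norm_le (f : rk_space) M : 0 <= M ->
  (forall v, kform k v v <= 1 -> lincomb v f ^+ 2 <= M) -> `|f| ^+ 2 <= M.
Proof.
move=> M0 fM; rewrite -[M]sqr_sqrtr// lerXn2r ?nnegrE ?sqrtr_ge0//.
apply: norm_le_seminorm; [exact: sqrtr_ge0|move=> [v v1]].
rewrite /= /rk_seminorm /= -sqrtr_sqr ler_wsqrtr//; exact: fM.
Qed.

(** Let [a] and [b] be the values of [f + g] at [v] and of [f - g] at [w]. Then
[a ^+ 2 + b ^+ 2] is the value of [f] at [a v + b w] plus that of [g] at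
[a v - b w]. Bounding these values by the norms of [f] and [g] and applying the
parallelogram law of the quadratic form to [a v] and [b w] gives the claim. *)
Lemma rk_parallelogram : parallelogram_le (E := rk_space).
Proof.
move=> f g; set M := 2 * _.
have key v w : kform k v v <= 1 -> kform k w w <= 1 ->
    lincomb v (f + g) ^+ 2 + lincomb w (f - g) ^+ 2 <= M.
  move=> v1 w1.
  set a := lincomb v (f + g); set b := lincomb w (f - g).
  pose u1 := lscale a v ++ lscale b w; pose u2 := lscale a v ++ lscale (- b) w.
  have e : a ^+ 2 + b ^+ 2 = lincomb u1 f + lincomb u2 g.
    rewrite !lincomb_cat !lincomb_scale.
    have aE : a = lincomb v f + lincomb v g by exact: lincombD.
    have bE : b = lincomb w f - lincomb w g.
      by rewrite -mulN1r -lincombZ -lincombD.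
    by rewrite [a ^+ 2]expr2 [b ^+ 2]expr2 {2}aE {2}bE; ring.
  have q : kform k u1 u1 + kform k u2 u2 =
      2 * (a ^+ 2 * kform k v v + b ^+ 2 * kform k w w).
    by rewrite !kform_catl !kform_catr !kform_scalel !kform_scaler; ring.
  have qa : a ^+ 2 * kform k v v <= a ^+ 2 by rewrite ler_piMr ?sqr_ge0.
  have qb : b ^+ 2 * kform k w w <= b ^+ 2 by rewrite ler_piMr ?sqr_ge0.
  have amgm (h : rk_space) u : 2 * lincomb u h <= 2 * `|h| ^+ 2 + 2^-1 * kform k u u.
    have q0 : 0 <= kform k u u by exact: kp.2.
    have := rk_bound h u; move: (lincomb u h) (`|h| ^+ 2) (sqr_ge0 `|h|) => x y y0 xy.
    have := sqr_ge0 (4 * y - kform k u u); nra.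
  have := amgm f u1; have := amgm g u2; rewrite /M; lra.
have M0 : 0 <= M by rewrite mulr_ge0// addr_ge0 ?sqr_ge0.
have z1 : kform k [::] [::] <= 1 by rewrite /kform /lincomb big_nil.
have z0 (h : Z -> R) : lincomb [::] h = 0 by exact: big_nil.
rewrite -lerBrDr; apply: rk_norm_le => [|v v1].
  rewrite subr_ge0; apply: rk_norm_le => // w w1.
  by have := key [::] w z1 w1; rewrite z0 expr0n add0r.
rewrite lerBrDl -lerBrDr; apply: rk_norm_le => [|w w1].
  by rewrite subr_ge0; have := key v [::] v1 z1; rewrite z0 expr0n addr0.
by rewrite lerBrDl key.
Qed.

Definition rk_dot : {dot rk_space for idfun} := polar_dot rk_parallelogram.

Lemma rk_dotE (f g : rk_space) : rk_dot f g = polar_form rk_parallelogram f g.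
Proof. by []. Qed.

Fact feature_bounded u :
  exists M, forall v, rk_family v (fun z => lincomb u (k z)) <= M.
Proof.
exists (Num.sqrt (kform k u u)) => -[v v1] /=; rewrite /rk_seminorm /= -sqrtr_sqr.
apply: ler_wsqrtr; apply: (le_trans (kform_cauchy_schwarz v u kp)).
by rewrite ler_piMl// kp.2.
Qed.

(** The function [k z], or more generally a linear combination of such functions, as a
vector; its norm is that of the linear combination for [kform k]. *)
Definition feature u : rk_space := BoundedVector (feature_bounded u).

Lemma feature_norm u : `|feature u| ^+ 2 = kform k u u.
Proof.
have q0 : 0 <= kform k u u by exact: kp.2.
apply/le_anti/andP; split.
  apply: rk_norm_le => // v v1.
  by apply: (le_trans (kform_cauchy_schwarz v u kp)); rewrite ler_piMl.
have := rk_bound (feature u) u.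
have [->|qn0] := eqVneq (kform k u u) 0; first by rewrite sqr_ge0.
by rewrite expr2 -/(kform k u u) ler_pM2r// lt_neqAle eq_sym qn0.
Qed.

Lemma feature_dot z w : rk_dot (feature [:: (1, z)]) (feature [:: (1, w)]) = k z w.
Proof.
rewrite rk_dotE /polar_form.
have -> : feature [:: (1, z)] + feature [:: (1, w)] = feature [:: (1, z); (1, w)].
  apply: bounded_space_eq => t /=.
  by rewrite /lincomb !big_cons !big_nil !addr0.
have -> : feature [:: (1, z)] - feature [:: (1, w)] = feature [:: (1, z); (-1, w)].
  apply: bounded_space_eq => t /=.
  by rewrite /lincomb !big_cons !big_nil /= !addr0 !mul1r mulN1r scaleN1r.
rewrite !feature_norm /kform /lincomb !big_cons !big_nil /= [k w z]kp.1.
by field.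
Qed.

End ReproducingKernel.

Section KernelPropertyA.
Context {R : realType}.

Definition kernel_property_A (Z : metricType R) : Prop :=
  forall eta C : R, 0 < eta -> 0 < C -> exists k : Z -> Z -> R,
    [/\ positive_type k, forall z, k z z = 1,
        forall z w, mdist z w <= C -> 1 - eta <= k z w
      & exists2 r : R, 0 < r & forall z w, r <= mdist z w -> k z w = 0].

Lemma hilbert_norm_sub (H : completeNormedModType R) (dot : {dot H for idfun})
  (x y : H) : hilbert_inner_product dot ->
  `|x - y| ^+ 2 = `|x| ^+ 2 + `|y| ^+ 2 - 2 * dot x y.
Proof.
move=> hd; rewrite !hd linearBl !linearBr /=.
have -> : dot y x = dot x y by rewrite hermC expr0 mul1r.
by ring.
Qed.

(** The kernel of a family of unit vectors consists of their inner products;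
conversely a kernel of positive type with values 1 on the diagonal consists of the
inner products of the unit vectors [feature]. The distance of two unit vectors is a
function of their inner product. *)
Lemma property_A_kernel (Z : metricType R) : property_A Z <-> kernel_property_A Z.
Proof.
split=> A.
  move=> eta C eta0 C0; have m0 : 0 < minr eta 1 by rewrite lt_min eta0 ltr01.
  have [H [dot [xi [hd [xi1 [close [r r0 far]]]]]]] := A _ C m0 C0.
  exists (fun z w => dot (xi z) (xi w)); split.
  - split=> [z w|v]; first by rewrite hermC expr0 mul1r.
    have -> : kform (fun z w => dot (xi z) (xi w)) v v =
        `|\sum_(a <- v) a.1 *: xi a.2| ^+ 2.
      rewrite hd linear_sumlz; apply: eq_bigr => a _.
      rewrite linearZl_LR /= (linear_sumr dot (xi a.2)); congr (_ * _).
      by apply: eq_bigr => b _; rewrite (linearZr_LR dot (xi a.2)).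
    exact: sqr_ge0.
  - by move=> z; rewrite -hd xi1 expr1n.
  - move=> z w /close zw; have := hilbert_norm_sub (xi z) (xi w) hd.
    rewrite !xi1 expr1n => /esym E.
    have n0 := normr_ge0 (xi z - xi w).
    have [zw1 zw2] : `|xi z - xi w| < eta /\ `|xi z - xi w| < 1.
      by move: zw; rewrite lt_min => /andP[].
    nra.
  - by exists r.
move=> eps C eps0 C0.
have [|k [kp k1 close [r r0 far]]] := A (eps ^+ 2 / 4) C _ C0.
  by rewrite divr_gt0// exprn_gt0.
have hd : hilbert_inner_product (rk_dot kp).
  by move=> u; rewrite rk_dotE polar_formxx.
have n1 x : `|feature kp [:: (1, x)]| = 1.
  apply/eqP; rewrite -(@eqrXn2 _ 2)// expr1n hd feature_dot k1; exact/eqP.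
exists (rk_space kp), (rk_dot kp), (fun z => feature kp [:: (1, z)]).
split=> //; split=> //; split; last first.
  by exists r => // z w /far; rewrite feature_dot.
move=> z w /close zw; rewrite -(@ltr_pXn2r _ 2) ?nnegrE ?(ltW eps0)//.
rewrite (hilbert_norm_sub _ _ hd) !n1 feature_dot expr1n.
have := exprn_gt0 2 eps0; lra.
Qed.

End KernelPropertyA.

(** * Words as vertices of a tree *)

Lemma prefix_anti (T : eqType) (u w : seq T) : prefix u w -> prefix w u -> u = w.
Proof.
move=> /prefixP[s ->] /prefixP[s']; rewrite -catA => /(congr1 size).
rewrite !size_cat => /eqP; rewrite -{1}[size u]addn0 eqn_add2l eq_sym addn_eq0.
by case/andP=> /nilP -> _; rewrite cats0.
Qed.

Section Words.
Context {T : eqType}.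
Implicit Types u v w : seq T.

Fixpoint lcp u w : seq T :=
  match u, w with
  | a :: u', b :: w' => if a == b then a :: lcp u' w' else [::]
  | _, _ => [::]
  end.

Lemma prefix_lcp v u w : prefix v (lcp u w) = prefix v u && prefix v w.
Proof.
elim: u v w => [|a u IH] [|d v] [|b w] //=; rewrite ?andbF ?prefix0s //.
case: (eqVneq a b) => [<-|ab] /=; first by rewrite IH; case: (d == a).
by case: (eqVneq d a) => [->|//]; rewrite (negbTE ab) andbF.
Qed.

Lemma lcp_prefixl u w : prefix (lcp u w) u.
Proof. by have := prefix_refl (lcp u w); rewrite prefix_lcp => /andP[]. Qed.

Lemma lcp_prefixr u w : prefix (lcp u w) w.
Proof. by have := prefix_refl (lcp u w); rewrite prefix_lcp => /andP[]. Qed.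

Lemma lcpC u w : size (lcp u w) = size (lcp w u).
Proof.
by congr size; apply: prefix_anti;
  rewrite prefix_lcp lcp_prefixl lcp_prefixr.
Qed.

(** The distance of two words in the tree in which a word is joined to its extensions
by one letter. *)
Definition tree_dist u w : nat :=
  (size u - size (lcp u w)) + (size w - size (lcp u w)).

Lemma prefix_comparable u v w : prefix u w -> prefix v w ->
  (size u <= size v)%N -> prefix u v.
Proof.
rewrite !prefixE => /eqP uw /eqP vw uv.
by rewrite -vw take_takel// uw.
Qed.

Lemma prefix_size_lcp v u w : prefix v u -> (size v <= size (lcp u w))%N ->
  prefix v w.
Proof.
move=> vu vm; apply: prefix_trans (lcp_prefixr u w).
exact: prefix_comparable vu (lcp_prefixl u w) vm.
Qed.

(** The tree of words is cut at the depths congruent to [- s] modulo [n]; a word is sent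
to the vertex at which its route from the root last passes such a depth. The depth
is recorded through the quotient, and is rounded up to 0 for the words above the
first cut. *)
Definition ancestor (n s : nat) w : nat * seq T :=
  ((size w + s) %/ n, take ((size w + s) %/ n * n - s) w)%N.

(** Hermite's identity. *)
Lemma sum_divn_shift (n a : nat) : (0 < n)%N -> (\sum_(s < n) (a + s) %/ n)%N = a.
Proof.
move=> n0; elim: a => [|a IH].
  by rewrite big1// => s _; rewrite add0n divn_small.
have : (\sum_(s < n.+1) (a + s) %/ n = a %/ n + \sum_(s < n) (a.+1 + s) %/ n)%N.
  by rewrite big_ord_recl addn0; congr addn; apply: eq_bigr => s _; rewrite addnS.
rewrite big_ord_recr /= IH divnDr ?dvdnn// divnn n0; lia.
Qed.

(** If there is no cut strictly below the depth where two words branch off and down to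
the deeper one of them, then both have the same ancestor. The number of the cuts in
this range appears on the right as a difference of quotients, which can be summed
over [s]. *)
Lemma ancestor_neq n s u w : (0 < n)%N ->
  ((ancestor n s u != ancestor n s w)
   <= (maxn (size u) (size w) + s) %/ n - (size (lcp u w) + s) %/ n)%N.
Proof.
move=> n0; set M := maxn _ _; set m := size (lcp u w).
have mu : (m <= size u)%N by exact/size_prefix/lcp_prefixl.
have mw : (m <= size w)%N by exact/size_prefix/lcp_prefixr.
have uM : (size u <= M)%N by exact: leq_maxl.
have wM : (size w <= M)%N by exact: leq_maxr.
have [lt|ge] := ltnP ((m + s) %/ n) ((M + s) %/ n).
  by apply: leq_trans (leq_b1 _) _; rewrite subn_gt0.
have same x : (m <= x)%N -> (x <= M)%N -> ((x + s) %/ n = (m + s) %/ n)%N.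
  move=> mx xM; apply/eqP; rewrite eqn_leq (leq_trans _ ge) ?leq_div2r ?leq_add2r//.
rewrite /ancestor (same (size u))// (same (size w))//; set l := (_ - s)%N.
have lm : (l <= m)%N by rewrite leq_subLR addnC leq_trunc_div.
have takel x : prefix (lcp u w) x -> take l x = take l (lcp u w).
  by rewrite prefixE => /eqP; rewrite -/m => <-; rewrite take_takel.
by rewrite !takel ?lcp_prefixl ?lcp_prefixr// eqxx.
Qed.

Lemma ancestor_eq n s u w : (0 < n)%N -> ancestor n s u = ancestor n s w ->
  (tree_dist u w < 2 * n)%N.
Proof.
move=> n0 []; set b := ((size u + s) %/ n)%N => bE; rewrite -bE; set l := (_ - s)%N.
move=> uw; have lu : (l <= size u)%N by rewrite leq_subLR addnC leq_trunc_div.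
have lw : (l <= size w)%N by rewrite leq_subLR addnC /l bE leq_trunc_div.
have lm : (l <= size (lcp u w))%N.
  have : prefix (take l u) (lcp u w).
    by rewrite prefix_lcp prefix_take uw prefix_take.
  by move/size_prefix; rewrite size_takel.
have ub : (size u < l + n)%N.
  by have := ltn_pmod (size u + s) n0; have := divn_eq (size u + s) n; rewrite -/b /l; lia.
have wb : (size w < l + n)%N.
  by have := ltn_pmod (size w + s) n0; have := divn_eq (size w + s) n; rewrite -bE /l; lia.
rewrite /tree_dist; lia.
Qed.

Context {R : realType}.

(** For fixed [s] the kernel tests whether two words have the same ancestor, so it is
trivially of positive type and vanishes at distance [2 * n]. Averaging over the
shift [s] makes it vary slowly. *)
Definition tree_kernel n u w : R :=
  n%:R^-1 * \sum_(s < n) (ancestor n s u == ancestor n s w)%:R.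

Lemma tree_kernel_positive n : positive_type (tree_kernel n).
Proof.
apply: positive_type_scale; first by rewrite invr_ge0.
apply: positive_type_sum => s; exact: positive_type_eq.
Qed.

Lemma tree_kernel_ge n u w : (0 < n)%N ->
  1 - (tree_dist u w)%:R / n%:R <= tree_kernel n u w.
Proof.
move=> n0; have n0' : (0 : R) < n%:R by rewrite ltr0n.
rewrite /tree_kernel ler_pdivlMl// mulrBr mulr1 mulrCA mulfV ?gt_eqF// mulr1.
rewrite lerBlDr -natr_sum -natrD ler_nat.
have -> : (\sum_(s < n) (ancestor n s u == ancestor n s w)
         = n - \sum_(s < n) (ancestor n s u != ancestor n s w))%N.
  rewrite -[X in (X - _)%N](card_ord n) -sum1_card -sumnB => [|s _]; last exact: leq_b1.
  by apply: eq_bigr => s _; case: eqP.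
set N := (\sum_(s < n) _)%N.
suff : (N <= tree_dist u w)%N by lia.
have : (N <= \sum_(s < n) ((maxn (size u) (size w) + s) %/ n
                           - (size (lcp u w) + s) %/ n))%N.
  by apply: leq_sum => s _; exact: ancestor_neq.
have mu : (size (lcp u w) <= size u)%N by exact/size_prefix/lcp_prefixl.
rewrite sumnB => [|s _]; last by rewrite leq_div2r// leq_add2r (leq_trans mu)// leq_maxl.
rewrite !sum_divn_shift// /tree_dist; lia.
Qed.

Lemma tree_kernel_far n u w : (0 < n)%N -> (2 * n <= tree_dist u w)%N ->
  tree_kernel n u w = 0.
Proof.
move=> n0 far; rewrite /tree_kernel big1 ?mulr0// => s _.
by case: eqP => // /(ancestor_eq n0); rewrite ltnNge far.
Qed.

Lemma tree_kernel1 n u : (0 < n)%N -> tree_kernel n u u = 1.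
Proof.
move=> n0; rewrite /tree_kernel; under eq_bigr do rewrite eqxx.
by rewrite sumr_const card_ord mulVf// pnatr_eq0 -lt0n.
Qed.

End Words.

(** * The cells of a free product *)

Section Cells.
Context {R : realType} {X Y : metricType R} {NX : net X} {NY : net Y}.
Context {epsX : NX} {epsY : NY}.

Local Notation letter := ({x0 : NX | x0 != epsX} + {y0 : NY | y0 != epsY})%type.
Local Notation word := (seq letter).
Local Notation pre := (pre_free_product epsX epsY).
Local Notation FP := (free_product epsX epsY).
Local Notation I01 := {i01 R}.
Local Notation "p %:fp" := (to_free_product p) (at level 2, format "p %:fp").
Implicit Types (p q : pre) (u : word).

(** The tree is rooted at the sheet of [X] with the empty word. An edge is indexed by the
word of the sheet to which it leads away from the root; for the edge between the two
sheets with the empty word, this is the empty word. *)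
Inductive cell := CellX of WX epsX epsY | CellY of WY epsX epsY | CellE of word.

HB.instance Definition _ := gen_eqMixin cell.
HB.instance Definition _ := gen_choiceMixin cell.
Implicit Types c : cell.

(** The position along an edge, equal to 0 on the side of the root and to 1 beyond the
edge. *)
Definition edge_pos u p : R :=
  if u is a :: u' then edge_coord (belast a u') (last a u') p else edge_coordE p.

Definition cell_pdist c p q : R :=
  match c with
  | CellX v => mdist (retractX v p) (retractX v q)
  | CellY v => mdist (retractY v p) (retractY v q)
  | CellE u => `|edge_pos u p - edge_pos u q|
  end.

Definition cell_word c : word :=
  match c with CellX v => val v | CellY v => val v | CellE u => u end.

Lemma cell_pdistxx c p : cell_pdist c p p = 0.
Proof. by case: c => *; rewrite /= ?mdistxx// subrr normr0. Qed.

Lemma cell_pdist_ge0 c p q : 0 <= cell_pdist c p q.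
Proof. by case: c => *; rewrite /= ?mdist_ge0. Qed.

Lemma cell_pdist_sym c p q : cell_pdist c p q = cell_pdist c q p.
Proof. by case: c => *; rewrite /= 1?metric_sym// distrC. Qed.

Lemma cell_pdist_triangle c p q s :
  cell_pdist c p s <= cell_pdist c p q + cell_pdist c q s.
Proof. by case: c => *; rewrite /= ?metric_triangle ?ler_distD. Qed.

Lemma edge_pos_rcons u a p : edge_pos (rcons u a) p = edge_coord u a p.
Proof.
by rewrite /edge_pos; case E : (rcons u a) => [|b s];
  [case: u E|move: E; rewrite lastI => /rcons_inj[-> ->]].
Qed.

Lemma edge_pos_lipschitz u : cell_lipschitz (edge_pos u).
Proof.
case: u => [|a u]; first exact: edge_coordE_lipschitz.
exact: edge_coord_lipschitz.
Qed.

Lemma cell_pdist_glue c p p' q : glue p p' -> cell_pdist c p q = cell_pdist c p' q.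
Proof.
move=> pp'; case: c => [v|v|u] /=; rewrite ?(retractX_glue v pp') ?(retractY_glue v pp')//.
by rewrite ((edge_pos_lipschitz u).1 _ _ pp').
Qed.

(** All pseudo-metrics are invariant under gluing, so they may be computed on any
representatives. *)
Lemma cell_pdist_fp c p p' q q' : p%:fp = p'%:fp -> q%:fp = q'%:fp ->
  cell_pdist c p q = cell_pdist c p' q'.
Proof.
have H p1 p2 q1 : p1%:fp = p2%:fp -> cell_pdist c p1 q1 = cell_pdist c p2 q1.
  move/eqmodP/asboolP; elim=> // [a b ab|a b d _ -> _ ->//].
  exact: cell_pdist_glue.
by move=> pp' qq'; rewrite (H _ _ _ pp') cell_pdist_sym (H _ _ _ qq') cell_pdist_sym.
Qed.

Lemma repr_fp p : (repr p%:fp)%:fp = p%:fp.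
Proof. by rewrite /to_free_product reprK. Qed.

Lemma retractX_noprefix v p : ~~ prefix (val v) (pre_word p) ->
  retractX v p = net_base NX.
Proof.
case: p => [w x|w y|w x0 t|w y0 t|t] //=; rewrite /word_dirX; try by move/negbTE ->.
by case: eqP => [->|_]; [rewrite prefix_refl|move/negbTE ->].
Qed.

Lemma retractY_noprefix v p : ~~ prefix (val v) (pre_word p) ->
  retractY v p = net_base NY.
Proof.
case: p => [w x|w y|w x0 t|w y0 t|t] //=; rewrite /word_dirY; try by move/negbTE ->.
by case: eqP => [->|_]; [rewrite prefix_refl|move/negbTE ->].
Qed.

Lemma edge_pos_noprefix u p : ~~ prefix u (pre_word p) -> edge_pos u p = 0.
Proof.
case/lastP: u => [|u a]; first by case: (pre_word p).
rewrite edge_pos_rcons; case: p => [w x|w y|w x0 t|w y0 t|t] //= /negbTE pw;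
  by rewrite ?pw//; case: eqP pw => // ->; rewrite prefix_refl.
Qed.

(** A point whose word does not extend the word of a cell projects to the base point of
that cell. *)
Lemma cell_pdist_noprefix c p q : ~~ prefix (cell_word c) (pre_word p) ->
  ~~ prefix (cell_word c) (pre_word q) -> cell_pdist c p q = 0.
Proof.
case: c => [v|v|u] /= pN qN.
- by rewrite !retractX_noprefix// mdistxx.
- by rewrite !retractY_noprefix// mdistxx.
- by rewrite !edge_pos_noprefix// subrr normr0.
Qed.

Lemma word_dirX_prefix (v u w : word) : v != u -> prefix v u -> prefix u w ->
  word_dirX v w = word_dirX v u.
Proof.
move=> vu vpu /prefixP[s ->]; move: vu vpu => /[swap] /prefixP[[|b u'] ->].
  by rewrite cats0 eqxx.
by rewrite /word_dirX -catA !prefix_prefix !drop_size_cat.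
Qed.

Lemma word_dirY_prefix (v u w : word) : v != u -> prefix v u -> prefix u w ->
  word_dirY v w = word_dirY v u.
Proof.
move=> vu vpu /prefixP[s ->]; move: vu vpu => /[swap] /prefixP[[|b u'] ->].
  by rewrite cats0 eqxx.
by rewrite /word_dirY -catA !prefix_prefix !drop_size_cat.
Qed.

Lemma retractX_beyond v u p : val v != u -> prefix (val v) u ->
  prefix u (pre_word p) -> retractX v p = word_dirX (val v) u.
Proof.
move=> vu vpu; case: p => [w x|w y|w x0 t|w y0 t|t] /= up;
  rewrite ?(word_dirX_prefix vu vpu up)//.
  by case: eqP up => // -> uv; rewrite (prefix_anti vpu uv) eqxx in vu.
by move: up vpu vu; case: u => //; case: (val v).
Qed.

Lemma retractY_beyond v u p : val v != u -> prefix (val v) u ->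
  prefix u (pre_word p) -> retractY v p = word_dirY (val v) u.
Proof.
move=> vu vpu; case: p => [w x|w y|w x0 t|w y0 t|t] /= up;
  rewrite ?(word_dirY_prefix vu vpu up)//.
  by case: eqP up => // -> uv; rewrite (prefix_anti vpu uv) eqxx in vu.
by move: up vpu vu; case: u => //; case: (val v).
Qed.

Definition word_side (w : word) : R := if w is inr _ :: _ then 1 else 0.

Lemma edge_pos_beyond v u p : v != u -> prefix v u -> prefix u (pre_word p) ->
  edge_pos v p = if v is [::] then word_side u else 1.
Proof.
case/lastP: v => [|v a] vu vpu up.
  case: u vu vpu up => // b u _ _ /=; rewrite /edge_pos /word_side.
  by case: p => [w x|w y|w x0 t|w y0 t|t] //= /prefixP[s ->]; case: b.
rewrite edge_pos_rcons (_ : (if rcons v a is [::] then _ else _) = 1); last first.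
  by case: (v).
have vp := prefix_trans vpu up.
have E : (pre_word p == rcons v a) = false.
  apply/negbTE; apply: contra vu => /eqP E.
  by rewrite E in up; rewrite (prefix_anti vpu up).
by case: p up vp E => [w x|w y|w x0 t|w y0 t|t] /= up vp E;
  rewrite ?E ?vp//; case: (v) vp.
Qed.

(** A point beyond the letter that follows the word of a cell projects to a point of the
cell that is determined by this letter. *)
Lemma cell_pdist_beyond c u p q : cell_word c != u -> prefix (cell_word c) u ->
  prefix u (pre_word p) -> prefix u (pre_word q) -> cell_pdist c p q = 0.
Proof.
case: c => [v|v|v] /= vu vpu up uq.
- by rewrite !(retractX_beyond vu vpu)// mdistxx.
- by rewrite !(retractY_beyond vu vpu)// mdistxx.
- by rewrite !(edge_pos_beyond vu vpu)// subrr normr0.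
Qed.

Lemma cell_pdist_sheetX w x x' c : cell_pdist c (SheetX w x) (SheetX w x') =
  if c == CellX w then mdist x x' else 0.
Proof.
case: c => [v|v|u] /=.
- case: (eqVneq w v) => [->|wv]; first by rewrite eqxx.
  rewrite mdistxx; case: eqP => // -[E].
  by rewrite E eqxx in wv.
- by rewrite mdistxx; case: eqP.
- case: eqP => // _; case/lastP: u => [|u a]; last rewrite !edge_pos_rcons /=.
    by rewrite /= subrr normr0.
  by rewrite subrr normr0.
Qed.

Lemma cell_pdist_sheetY w y y' c : cell_pdist c (SheetY w y) (SheetY w y') =
  if c == CellY w then mdist y y' else 0.
Proof.
case: c => [v|v|u] /=.
- by rewrite mdistxx; case: eqP.
- case: (eqVneq w v) => [->|wv]; first by rewrite eqxx.
  rewrite mdistxx; case: eqP => // -[E].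
  by rewrite E eqxx in wv.
- case: eqP => // _; case/lastP: u => [|u a]; last rewrite !edge_pos_rcons /=.
    by rewrite /= subrr normr0.
  by rewrite subrr normr0.
Qed.

Lemma CellE_eq u w : (CellE u == CellE w) = (u == w).
Proof. by apply/eqP/eqP => [[]|->]. Qed.

Lemma cell_pdist_edgeX w x0 (t t' : I01) c :
  cell_pdist c (EdgeX w x0 t) (EdgeX w x0 t') =
  if c == CellE (rcons (val w) (inl x0)) then `|t%:num - t'%:num| else 0.
Proof.
case: c => [v|v|u] /=; do 1?[by rewrite mdistxx; case: eqP].
rewrite CellE_eq; case/lastP: u => [|u a]; last rewrite !edge_pos_rcons /=.
  by rewrite /= subrr normr0; case: (val w).
by rewrite eq_sym; case: eqP => _; rewrite ?subrr ?normr0.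
Qed.

Lemma cell_pdist_edgeY w y0 (t t' : I01) c :
  cell_pdist c (EdgeY w y0 t) (EdgeY w y0 t') =
  if c == CellE (rcons (val w) (inr y0)) then `|t%:num - t'%:num| else 0.
Proof.
case: c => [v|v|u] /=; do 1?[by rewrite mdistxx; case: eqP].
rewrite CellE_eq; case/lastP: u => [|u a]; last rewrite !edge_pos_rcons /=.
  by rewrite /= subrr normr0; case: (val w).
by rewrite eq_sym; case: eqP => _; rewrite ?subrr ?normr0.
Qed.

Lemma cell_pdist_edgeE (t t' : I01) c :
  cell_pdist c (EdgeE epsX epsY t) (EdgeE epsX epsY t') =
  if c == CellE [::] then `|t%:num - t'%:num| else 0.
Proof.
case: c => [v|v|u] /=; do 1?[by rewrite mdistxx; case: eqP].
rewrite CellE_eq; case/lastP: u => [|u a]; last rewrite !edge_pos_rcons /=.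
  by [].
by rewrite subrr normr0; case: (u).
Qed.

Lemma cell_pdist_step (P Q : FP) r : cell_dist P Q r ->
  0 <= r /\ exists c, forall c', cell_pdist c' (repr P) (repr Q) = if c' == c then r else 0.
Proof.
have E c p q : cell_pdist c (repr p%:fp) (repr q%:fp) = cell_pdist c p q.
  by apply: cell_pdist_fp; exact: repr_fp.
move=> PQ; split; first exact: cell_dist_ge0 PQ.
case: PQ => [w x x'|w y y'|w x0 t t'|w y0 t t'|t t']; eexists => c; rewrite E.
- exact: cell_pdist_sheetX.
- exact: cell_pdist_sheetY.
- exact: cell_pdist_edgeX.
- exact: cell_pdist_edgeY.
- exact: cell_pdist_edgeE.
Qed.

Lemma cell_pdist_finite (P Q : FP) :
  exists L : seq cell, forall c, c \notin L -> cell_pdist c (repr P) (repr Q) = 0.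
Proof.
have [l] := chain_length_exists P Q; elim=> [{}P|{}P Q' {}Q r {}l PQ' _ [L LE]].
  by exists [::] => c _; exact: cell_pdistxx.
have [r0 [c0 c0E]] := cell_pdist_step PQ'; exists (c0 :: L) => c.
rewrite inE negb_or => /andP[cc0 cL].
apply/le_anti; rewrite cell_pdist_ge0 andbT.
apply: le_trans (cell_pdist_triangle _ _ (repr Q') _) _.
by rewrite c0E (negbTE cc0) LE// addr0.
Qed.

(** A step of a chain takes place in one cell and changes no other projection, so that
the sum grows by at most the length of the step. *)
Lemma sum_cell_pdist_le (P Q : FP) (L : seq cell) : uniq L ->
  \sum_(c <- L) cell_pdist c (repr P) (repr Q) <= mdist P Q.
Proof.
move=> uL; apply: lb_le_inf; first by case: (has_inf_chain_length P Q).
move=> l /=; elim=> [{}P|{}P Q' {}Q r {}l PQ' _ IH].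
  by rewrite big1// => c _; exact: cell_pdistxx.
have [r0 [c0 c0E]] := cell_pdist_step PQ'.
apply: (@le_trans _ _ (\sum_(c <- L) (cell_pdist c (repr P) (repr Q')
                                     + cell_pdist c (repr Q') (repr Q)))).
  by apply: ler_sum => c _; exact: cell_pdist_triangle.
rewrite big_split /= lerD//; under eq_bigr do rewrite c0E.
case: (boolP (c0 \in L)) => c0L.
  by rewrite (bigD1_seq c0)//= eqxx big1 ?addr0// => c /negbTE ->.
by rewrite big1_seq// => c /andP[_ cL]; case: eqP => // E; rewrite -E cL in c0L.
Qed.

End Cells.

(** * The metric of a free product as a sum over cells *)

Section Geodesics.
Context {R : realType} {X Y : metricType R} {NX : net X} {NY : net Y}.
Context {epsX : NX} {epsY : NY}.

Local Notation letter := ({x0 : NX | x0 != epsX} + {y0 : NY | y0 != epsY})%type.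
Local Notation word := (seq letter).
Local Notation pre := (pre_free_product epsX epsY).
Local Notation FP := (free_product epsX epsY).
Local Notation I01 := {i01 R}.
Local Notation "p %:fp" := (to_free_product p) (at level 2, format "p %:fp").
Local Notation cell := (@cell R X Y NX NY epsX epsY).
Implicit Types (p q g : pre) (c : cell).

(** Half of the formula for the metric, on representatives. The list [L] is only
required to contain the cells that separate the points, which makes it possible to
compare the sums of three points over one list. *)
Definition cells_bound p q : Prop := forall L : seq cell, uniq L ->
  (forall c, c \notin L -> cell_pdist c p q = 0) ->
  mdist (p%:fp : FP) q%:fp <= \sum_(c <- L) cell_pdist c p q.

Lemma cells_bound_fp p p' q q' : p%:fp = p'%:fp -> q%:fp = q'%:fp ->
  cells_bound p q -> cells_bound p' q'.
Proof.
move=> pp' qq' pq L uL Lc; rewrite -pp' -qq'.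
under eq_bigr => c _ do rewrite -(cell_pdist_fp c pp' qq').
by apply: pq => // c cL; rewrite (cell_pdist_fp c pp' qq') Lc.
Qed.

Lemma cells_bound_sym p q : cells_bound p q -> cells_bound q p.
Proof.
move=> pq L uL Lc; rewrite metric_sym; under eq_bigr do rewrite cell_pdist_sym.
by apply: pq => // c cL; rewrite cell_pdist_sym Lc.
Qed.

(** Under this disjointness the point [g] lies on the way from [p] to [q] in every cell,
so that the sums over cells add up. *)
Lemma cells_bound_trans g p q :
  (forall c, cell_pdist c p g = 0 \/ cell_pdist c g q = 0) ->
  cells_bound p g -> cells_bound g q -> cells_bound p q.
Proof.
move=> disj pg gq L uL Lc.
have E c : cell_pdist c p q = cell_pdist c p g + cell_pdist c g q.
  apply/le_anti; rewrite cell_pdist_triangle /=; have [z|z] := disj c; rewrite z.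
    by rewrite add0r (le_trans (cell_pdist_triangle c g p q))// cell_pdist_sym z add0r.
  rewrite addr0 (le_trans (cell_pdist_triangle c p q g))// [cell_pdist c q g]cell_pdist_sym.
  by rewrite z addr0.
have Lpg c : c \notin L -> cell_pdist c p g = 0 /\ cell_pdist c g q = 0.
  move=> /Lc; rewrite E => /eqP; rewrite paddr_eq0 ?cell_pdist_ge0//.
  by case/andP=> /eqP -> /eqP ->.
under eq_bigr do rewrite E.
rewrite big_split (le_trans (metric_triangle _ (g%:fp : FP) _))// lerD//.
  by apply: pg => // c /Lpg[].
by apply: gq => // c /Lpg[].
Qed.

Lemma cells_bound_cell p q r c0 : cell_dist p%:fp q%:fp r ->
  (forall c, cell_pdist c p q = if c == c0 then r else 0) -> cells_bound p q.
Proof.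
move=> pq pqE L uL Lc; under eq_bigr do rewrite pqE.
apply: le_trans (free_product_dist_le (chain_length1 pq)) _.
have [c0L|c0L] := boolP (c0 \in L).
  by rewrite (bigD1_seq c0)//= eqxx big1 ?addr0// => c /negbTE ->.
by rewrite big1 => [|c _]; have := Lc _ c0L; rewrite pqE eqxx => -> //; case: ifP.
Qed.

Lemma cells_bound_sheetX w x x' : cells_bound (SheetX w x) (SheetX w x').
Proof. exact: cells_bound_cell (cell_SheetX w x x') (cell_pdist_sheetX w x x'). Qed.

Lemma cells_bound_sheetY w y y' : cells_bound (SheetY w y) (SheetY w y').
Proof. exact: cells_bound_cell (cell_SheetY w y y') (cell_pdist_sheetY w y y'). Qed.

Lemma cells_bound_edgeX w x0 (t t' : I01) : cells_bound (EdgeX w x0 t) (EdgeX w x0 t').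
Proof. exact: cells_bound_cell (cell_EdgeX w x0 t t') (cell_pdist_edgeX w x0 t t'). Qed.

Lemma cells_bound_edgeY w y0 (t t' : I01) : cells_bound (EdgeY w y0 t) (EdgeY w y0 t').
Proof. exact: cells_bound_cell (cell_EdgeY w y0 t t') (cell_pdist_edgeY w y0 t t'). Qed.

Lemma cells_bound_edgeE (t t' : I01) : cells_bound (EdgeE epsX epsY t) (EdgeE epsX epsY t').
Proof. exact: cells_bound_cell (cell_EdgeE _ _ t t') (cell_pdist_edgeE t t'). Qed.

Lemma cells_bound_rconsY w y0 x t : cells_bound (SheetX (rconsY w y0) x) (EdgeY w y0 t).
Proof.
apply: (@cells_bound_trans (EdgeY w y0 1%:i01)); last exact: cells_bound_edgeY.
  move=> c; rewrite (cell_pdist_fp c erefl (esym (glueP (glueY1 w y0)))).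
  rewrite cell_pdist_sheetX cell_pdist_edgeY; case: eqP => [->|]; [right|by left].
  by case: eqP.
exact: (cells_bound_fp erefl (glueP (glueY1 w y0))
  (@cells_bound_sheetX (rconsY w y0) x (net_base NX))).
Qed.

Lemma cells_bound_rconsX w x0 y t : cells_bound (SheetY (rconsX w x0) y) (EdgeX w x0 t).
Proof.
apply: (@cells_bound_trans (EdgeX w x0 1%:i01)); last exact: cells_bound_edgeX.
  move=> c; rewrite (cell_pdist_fp c erefl (esym (glueP (glueX1 w x0)))).
  rewrite cell_pdist_sheetY cell_pdist_edgeX; case: eqP => [->|]; [right|by left].
  by case: eqP.
exact: (cells_bound_fp erefl (glueP (glueX1 w x0))
  (@cells_bound_sheetY (rconsX w x0) y (net_base NY))).
Qed.

Lemma cells_bound_rootX x t : cells_bound (SheetX (WX0 epsX epsY) x) (EdgeE epsX epsY t).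
Proof.
apply: (@cells_bound_trans (EdgeE epsX epsY 0%:i01)); last exact: cells_bound_edgeE.
  move=> c; rewrite (cell_pdist_fp c erefl (esym (glueP (glueE0 _ _)))).
  rewrite cell_pdist_sheetX cell_pdist_edgeE; case: eqP => [->|]; [right|by left].
  by case: eqP.
exact: (cells_bound_fp erefl (glueP (glueE0 _ _))
  (@cells_bound_sheetX (WX0 epsX epsY) x (net_base NX))).
Qed.

Lemma cells_bound_rootY y t : cells_bound (SheetY (WY0 epsX epsY) y) (EdgeE epsX epsY t).
Proof.
apply: (@cells_bound_trans (EdgeE epsX epsY 1%:i01)); last exact: cells_bound_edgeE.
  move=> c; rewrite (cell_pdist_fp c erefl (esym (glueP (glueE1 _ _)))).
  rewrite cell_pdist_sheetY cell_pdist_edgeE; case: eqP => [->|]; [right|by left].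
  by case: eqP.
exact: (cells_bound_fp erefl (glueP (glueE1 _ _))
  (@cells_bound_sheetY (WY0 epsX epsY) y (net_base NY))).
Qed.

Lemma cells_bound_rootXY x y :
  cells_bound (SheetX (WX0 epsX epsY) x) (SheetY (WY0 epsX epsY) y).
Proof.
apply: (@cells_bound_trans (EdgeE epsX epsY 0%:i01)); last 2 first.
- exact: cells_bound_rootX.
- exact/cells_bound_sym/cells_bound_rootY.
move=> c; rewrite (cell_pdist_fp c erefl (esym (glueP (glueE0 _ _)))).
rewrite cell_pdist_sheetX; case: eqP => [->|]; [right|by left].
by rewrite /= /word_dirX /= mdistxx.
Qed.

Lemma WX_rcons (w : WX epsX epsY) v x0 : val w <> rcons v (inl x0).
Proof.
by case: w => w /= H E; move: H; rewrite E /last_in_X0 map_rcons last_rcons andbF.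
Qed.

Lemma WY_rcons (w : WY epsX epsY) v y0 : val w <> rcons v (inr y0).
Proof.
by case: w => w /= H E; move: H; rewrite E /last_in_Y0 map_rcons last_rcons andbF.
Qed.

Lemma cells_bound_same_word p q : pre_word p = pre_word q -> cells_bound p q.
Proof.
have XY w x w' y : val w = val w' -> cells_bound (SheetX w x) (SheetY w' y).
  move=> ww'; have w0 := WX_WY_nil ww'; have w'0 := w0; rewrite ww' in w'0.
  have -> : w = WX0 epsX epsY by exact: val_inj.
  have -> : w' = WY0 epsX epsY by exact: val_inj.
  exact: cells_bound_rootXY.
have XE w x p' : ~~ is_sheet p' -> val w = pre_word p' ->
      cells_bound (SheetX w x) p'.
  case: p' => [//|//|v x0 t|v y0 t|t] _ /= E.
  - by case: (WX_rcons E).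
  - by have -> : w = rconsY v y0 by [exact: val_inj]; exact: cells_bound_rconsY.
  - by have -> : w = WX0 epsX epsY by [exact: val_inj]; exact: cells_bound_rootX.
have YE w y p' : ~~ is_sheet p' -> val w = pre_word p' ->
      cells_bound (SheetY w y) p'.
  case: p' => [//|//|v x0 t|v y0 t|t] _ /= E.
  - by have -> : w = rconsX v x0 by [exact: val_inj]; exact: cells_bound_rconsX.
  - by case: (WY_rcons E).
  - by have -> : w = WY0 epsX epsY by [exact: val_inj]; exact: cells_bound_rootY.
have [|] := boolP (is_sheet p); have [|] := boolP (is_sheet q).
- case: p q => [w x|w y|||] // [w' x'|w' y'|||] //= _ _ E.
  + by rewrite (val_inj E); exact: cells_bound_sheetX.
  + exact: XY.
  + exact/cells_bound_sym/XY.
  + by rewrite (val_inj E); exact: cells_bound_sheetY.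
- by case: p => [w x|w y|||]// sq _ /=; [exact: XE|exact: YE].
- by case: q => [w x|w y|||]// _ sp /= E; apply: cells_bound_sym; [exact: XE|exact: YE].
- case: p q => [//|//|v x0 t|v y0 t|t] [//|//|v' x0' t'|v' y0' t'|t'] _ _ /=.
  + by move=> /rcons_inj[/val_inj -> ->]; exact: cells_bound_edgeX.
  + by move=> /rcons_inj[].
  + by case: (val v).
  + by move=> /rcons_inj[].
  + by move=> /rcons_inj[/val_inj -> ->]; exact: cells_bound_edgeY.
  + by case: (val v).
  + by case: (val v').
  + by case: (val v').
  + by move=> _; exact: cells_bound_edgeE.
Qed.

(** The point at which a route from [p] to the root leaves the sheet or edge of [p] and
the edge above it. The cells it crosses all have the same word as [p]. *)
Lemma gate p : pre_word p <> [::] -> exists g,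
  [/\ (size (pre_word g) < size (pre_word p))%N, cells_bound p g &
      forall c, cell_word c != pre_word p -> cell_pdist c p g = 0].
Proof.
have gX w x0 t : exists g, [/\ (size (pre_word g) < size (pre_word (EdgeX w x0 t)))%N,
    cells_bound (EdgeX w x0 t) g &
    forall c, cell_word c != pre_word (EdgeX w x0 t) -> cell_pdist c (EdgeX w x0 t) g = 0].
  have e := glueP (glueX0 w x0).
  exists (SheetX w (net_map (val x0))); split=> [||c cw] /=.
  - by rewrite size_rcons.
  - exact: (cells_bound_fp erefl (esym e) (@cells_bound_edgeX w x0 t 0%:i01)).
  - rewrite (cell_pdist_fp c erefl e) cell_pdist_edgeX; case: eqP => // cE.
    by rewrite cE eqxx in cw.
have gY w y0 t : exists g, [/\ (size (pre_word g) < size (pre_word (EdgeY w y0 t)))%N,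
    cells_bound (EdgeY w y0 t) g &
    forall c, cell_word c != pre_word (EdgeY w y0 t) -> cell_pdist c (EdgeY w y0 t) g = 0].
  have e := glueP (glueY0 w y0).
  exists (SheetY w (net_map (val y0))); split=> [||c cw] /=.
  - by rewrite size_rcons.
  - exact: (cells_bound_fp erefl (esym e) (@cells_bound_edgeY w y0 t 0%:i01)).
  - rewrite (cell_pdist_fp c erefl e) cell_pdist_edgeY; case: eqP => // cE.
    by rewrite cE eqxx in cw.
case: p => [w x|w y|w x0 t|w y0 t|t] //= w0.
- case: (WXP w) => [E|[v [y0 E]]]; first by rewrite E in w0.
  have e1 := glueP (glueY1 v y0); have e0 := glueP (glueY0 v y0).
  have far c : cell_word c != val w ->
      cell_pdist c (EdgeY v y0 1%:i01) (SheetY v (net_map (val y0))) = 0.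
    move=> cw; rewrite (cell_pdist_fp c erefl e0) cell_pdist_edgeY.
    by case: eqP => // cE; rewrite cE E eqxx in cw.
  have near c : cell_pdist c (SheetX w x) (EdgeY v y0 1%:i01) =
      if c == CellX w then mdist x (net_base NX) else 0.
    by rewrite -(cell_pdist_fp c erefl e1) E cell_pdist_sheetX.
  exists (SheetY v (net_map (val y0))); split=> [||c cw] /=.
  - by rewrite E size_rcons.
  - apply: (@cells_bound_trans (EdgeY v y0 1%:i01)).
    + move=> c; rewrite near; case: eqP => [->|]; [right|by left].
      by rewrite (cell_pdist_fp _ erefl e0) cell_pdist_edgeY; case: eqP.
    + by rewrite E; exact: cells_bound_rconsY.
    + exact: (cells_bound_fp erefl (esym e0) (@cells_bound_edgeY v y0 1%:i01 0%:i01)).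
  - apply/le_anti; rewrite cell_pdist_ge0 andbT.
    rewrite (le_trans (cell_pdist_triangle c _ (EdgeY v y0 1%:i01) _))// far// near.
    by case: eqP => [cE|]; [rewrite cE eqxx in cw|rewrite addr0].
- case: (WYP w) => [E|[v [x0 E]]]; first by rewrite E in w0.
  have e1 := glueP (glueX1 v x0); have e0 := glueP (glueX0 v x0).
  have far c : cell_word c != val w ->
      cell_pdist c (EdgeX v x0 1%:i01) (SheetX v (net_map (val x0))) = 0.
    move=> cw; rewrite (cell_pdist_fp c erefl e0) cell_pdist_edgeX.
    by case: eqP => // cE; rewrite cE E eqxx in cw.
  have near c : cell_pdist c (SheetY w y) (EdgeX v x0 1%:i01) =
      if c == CellY w then mdist y (net_base NY) else 0.
    by rewrite -(cell_pdist_fp c erefl e1) E cell_pdist_sheetY.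
  exists (SheetX v (net_map (val x0))); split=> [||c cw] /=.
  - by rewrite E size_rcons.
  - apply: (@cells_bound_trans (EdgeX v x0 1%:i01)).
    + move=> c; rewrite near; case: eqP => [->|]; [right|by left].
      by rewrite (cell_pdist_fp _ erefl e0) cell_pdist_edgeX; case: eqP.
    + by rewrite E; exact: cells_bound_rconsX.
    + exact: (cells_bound_fp erefl (esym e0) (@cells_bound_edgeX v x0 1%:i01 0%:i01)).
  - apply/le_anti; rewrite cell_pdist_ge0 andbT.
    rewrite (le_trans (cell_pdist_triangle c _ (EdgeX v x0 1%:i01) _))// far// near.
    by case: eqP => [cE|]; [rewrite cE eqxx in cw|rewrite addr0].
- exact: gX.
- exact: gY.
Qed.

(** Let [p] be the point with the longer word. If the two words are equal, a route
through at most three cells joins the points. Otherwise the route from [p] to [q] passes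
through the gate of [p], whose word is shorter. *)
Lemma cells_bound_all p q : cells_bound p q.
Proof.
have [n] := ubnP (size (pre_word p) + size (pre_word q)).
elim: n p q => // n IH p q; rewrite ltnS => pqn.
wlog qp : p q pqn / (size (pre_word q) <= size (pre_word p))%N.
  move=> H; have [/H|/ltnW/H] := leqP (size (pre_word q)) (size (pre_word p)).
    exact.
  by rewrite addnC => /(_ pqn)/cells_bound_sym.
have [/eqP|pq] := eqVneq (pre_word p) (pre_word q).
  by move=> /eqP/cells_bound_same_word.
have npre : ~~ prefix (pre_word p) (pre_word q).
  apply: contra pq => /[dup] /size_prefix s /prefixP[[|a s'] E].
    by rewrite E cats0.
  by move: qp; rewrite E size_cat /= addnS ltnNge leq_addr.
have p0 : pre_word p <> [::] by move=> E; rewrite E in npre; case: (pre_word q) npre.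
have [g [gp pg gc]] := gate p0.
apply: (cells_bound_trans _ pg).
  move=> c; have [cE|cN] := eqVneq (cell_word c) (pre_word p); [right|left].
    apply: cell_pdist_noprefix; rewrite cE//.
    by apply/negP => /size_prefix; rewrite leqNgt gp.
  exact: gc.
by apply: IH; rewrite (leq_trans _ pqn)// ltn_add2r.
Qed.

Lemma dist_sum_cells (P Q : FP) (L : seq cell) : uniq L ->
  (forall c, c \notin L -> cell_pdist c (repr P) (repr Q) = 0) ->
  mdist P Q = \sum_(c <- L) cell_pdist c (repr P) (repr Q).
Proof.
move=> uL Lc; apply/le_anti; rewrite sum_cell_pdist_le// andbT.
have := @cells_bound_all (repr P) (repr Q) L uL Lc.
by rewrite /to_free_product !reprK.
Qed.

End Geodesics.

(** * Pairs of cells, and cells between two points *)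

Lemma take_crossed (T : eqType) (u w : seq T) i :
  i \in iota (size (lcp u w)).+1 (size u - size (lcp u w)).-1 ->
  [/\ take i u != [::], take i u != u & ~~ prefix (take i u) w].
Proof.
rewrite mem_iota => iP; have si : size (take i u) = i by rewrite size_takel//; lia.
split.
- by apply/eqP => /(congr1 size); rewrite si /=; lia.
- by apply/eqP => /(congr1 size); rewrite si; lia.
- apply/negP => H; have : prefix (take i u) (lcp u w) by rewrite prefix_lcp prefix_take.
  by move/size_prefix; rewrite si; lia.
Qed.

Lemma tree_dist_le_crossed (T : eqType) (u w : seq T) :
  (tree_dist u w <= (size u - size (lcp u w)).-1 + (size w - size (lcp w u)).-1 + 2)%N.
Proof. by rewrite [size (lcp w u)]lcpC /tree_dist; lia. Qed.

Section CellPairs.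
Context {R : realType} {X Y : metricType R} {NX : net X} {NY : net Y}.
Context {epsX : NX} {epsY : NY}.

Local Notation letter := ({x0 : NX | x0 != epsX} + {y0 : NY | y0 != epsY})%type.
Local Notation word := (seq letter).
Local Notation pre := (pre_free_product epsX epsY).
Local Notation FP := (free_product epsX epsY).
Local Notation cell := (@cell R X Y NX NY epsX epsY).
Implicit Types (p q g : pre) (c : cell) (u : word).

Definition collapse c (A : pred pre) : Prop :=
  forall p q, A p -> A q -> cell_pdist c p q = 0.

(** The set [A] consists of points that project to one point of [c], and [B] of points
that project to one point of [c']. In a tree of cells these are the sets of points on
the side of [c'] as seen from [c], and conversely. *)
Definition opposite c c' : Prop := exists A B : pred pre,
  [/\ forall p, A p || B p, collapse c A & collapse c' B].

Lemma opposite_sym c c' : opposite c c' -> opposite c' c.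
Proof.
by case=> A [B [AB cA cB]]; exists B, A; split=> // p; rewrite orbC.
Qed.

(** If the word of [c] is a proper prefix of that of [c'], the points whose word extends
the latter project to one point of [c], and all the others to the base point of [c'].
If neither word is a prefix of the other, no point has a word that extends both. *)
Lemma opposite_words c c' : cell_word c != cell_word c' -> opposite c c'.
Proof.
have below d d' : cell_word d != cell_word d' ->
    prefix (cell_word d) (cell_word d') -> opposite d d'.
  move=> dd' pdd'; pose A p := prefix (cell_word d') (pre_word p).
  exists A, (fun p => ~~ A p); split=> [p|p q pA qA|p q pA qA].
  - exact: orbN.
  - exact: cell_pdist_beyond dd' pdd' pA qA.
  - exact: cell_pdist_noprefix.
move=> cc'; have [|N1] := boolP (prefix (cell_word c) (cell_word c')).
  exact: below.
have [|N2] := boolP (prefix (cell_word c') (cell_word c)).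
  by move=> h; apply/opposite_sym/below => //; rewrite eq_sym.
exists (fun p => ~~ prefix (cell_word c) (pre_word p)),
  (fun p => ~~ prefix (cell_word c') (pre_word p)); split=> [p|p q|p q].
- rewrite -negb_and; apply/negP => /andP[pc pc'].
  case: (leqP (size (cell_word c)) (size (cell_word c'))) => [|/ltnW] s.
    by rewrite (prefix_comparable pc pc' s) in N1.
  by rewrite (prefix_comparable pc' pc s) in N2.
- exact: cell_pdist_noprefix.
- exact: cell_pdist_noprefix.
Qed.

(** Interior points of the root edge belong to neither side of it. *)
Definition root_sideX p : bool :=
  match p with
  | SheetX w _ => if val w is inr _ :: _ then false else true
  | SheetY w _ => if val w is inl _ :: _ then true else false
  | EdgeX w x0 _ => if rcons (val w) (inl x0) is inl _ :: _ then true else false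
  | EdgeY w y0 _ => if rcons (val w) (inr y0) is inl _ :: _ then true else false
  | EdgeE _ => false
  end.

Definition root_sideY p : bool :=
  if p is EdgeE _ then false else ~~ root_sideX p.

Lemma retractX_root p : ~~ root_sideX p ->
  retractX (WX0 epsX epsY) p = net_base NX.
Proof.
case: p => [w x|w y|w x0 t|w y0 t|t] //=; rewrite /word_dirX ?drop0.
- case: eqP => [->//|_].
  by case: w => -[|[a|a] s].
- by case: w => -[|[a|a] s].
- by case: w => -[|[a|a] s].
- by case: w => -[|[a|a] s].
Qed.

Lemma retractY_root p : ~~ root_sideY p ->
  retractY (WY0 epsX epsY) p = net_base NY.
Proof.
case: p => [w x|w y|w x0 t|w y0 t|t] //=; rewrite /word_dirY ?drop0.
- by case: w => -[|[a|a] s].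
- case: eqP => [->//|_].
  by case: w => -[|[a|a] s].
- by case: w => -[|[a|a] s].
- by case: w => -[|[a|a] s].
Qed.

Lemma edge_root_sideX p : root_sideX p -> edge_pos [::] p = 0.
Proof.
case: p => [w x|w y|w x0 t|w y0 t|t] //=; rewrite /edge_pos /=.
all: by case: w => -[|[a|a] s].
Qed.

Lemma edge_root_sideY p : root_sideY p -> edge_pos [::] p = 1.
Proof.
case: p => [w x|w y|w x0 t|w y0 t|t] //=; rewrite /edge_pos /root_sideY /=.
all: by case: w => -[|[a|a] s].
Qed.

Lemma root_sides p : ~~ root_sideX p || ~~ root_sideY p.
Proof. by case: p => *; rewrite /root_sideY ?negbK ?orNb// orbC orNb. Qed.

Definition inside_edge u p : bool := ~~ is_sheet p && (pre_word p == u).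

Lemma retractX_inside v p : inside_edge (val v) p -> retractX v p = net_base NX.
Proof.
by rewrite /inside_edge; case: p => [w x|w y|w x0 t|w y0 t|t] //= /eqP E;
  rewrite E word_dirX_refl.
Qed.

Lemma retractY_inside v p : inside_edge (val v) p -> retractY v p = net_base NY.
Proof.
by rewrite /inside_edge; case: p => [w x|w y|w x0 t|w y0 t|t] //= /eqP E;
  rewrite E word_dirY_refl.
Qed.

Lemma edge_pos_past u p : u != [::] -> prefix u (pre_word p) ->
  ~~ inside_edge u p -> edge_pos u p = 1.
Proof.
case/lastP: u => // u a _; rewrite edge_pos_rcons /inside_edge.
case: p => [w x|w y|w x0 t|w y0 t|t] /=; do 1?[by move=> ->].
- by move=> -> /negbTE ->.
- by move=> -> /negbTE ->.
- by case: u.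
Qed.

(** The word of a sheet other than the two root sheets is also that of the edge leading to
it: a point inside this edge or not beyond it projects to the base point of the
sheet, and the remaining points to the end of the edge. Both root sheets have the
empty word, as does the root edge between them. *)
Lemma opposite_sheet_edge c u : cell_word c = u -> c <> CellE u ->
  opposite c (CellE u).
Proof.
have [->|u0] := eqVneq u [::].
  case: c => [v|v|v] /= v0 cE; last by rewrite v0 in cE.
    have -> : v = WX0 epsX epsY by exact: val_inj.
    exists (fun p => ~~ root_sideX p), root_sideX; split=> [p|p q pA qA|p q pA qA].
    - exact: orNb.
    - by rewrite /= !retractX_root// mdistxx.
    - by rewrite /cell_pdist !edge_root_sideX// subrr normr0.
  have -> : v = WY0 epsX epsY by exact: val_inj.
  exists (fun p => ~~ root_sideY p), root_sideY; split=> [p|p q pA qA|p q pA qA].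
  - exact: orNb.
  - by rewrite /= !retractY_root// mdistxx.
  - by rewrite /cell_pdist !edge_root_sideY// subrr normr0.
move=> cu cE; pose B p := prefix u (pre_word p) && ~~ inside_edge u p.
have BN p : ~~ B p -> ~~ prefix u (pre_word p) || inside_edge u p.
  by rewrite negb_and negbK.
exists (fun p => ~~ B p), B; split=> [p|p q|p q /andP[p1 p2] /andP[q1 q2]].
- exact: orNb.
- move=> /BN pA /BN qA; move: pA qA; case: c cu cE => [v|v|v] /= vu cE;
    last by rewrite vu in cE.
  + rewrite -vu => pA qA; have H p' :
        ~~ prefix (val v) (pre_word p') || inside_edge (val v) p' ->
        retractX v p' = net_base NX.
      by case/orP; [exact: retractX_noprefix|exact: retractX_inside].
    by rewrite /= !H// mdistxx.
  + rewrite -vu => pA qA; have H p' :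
        ~~ prefix (val v) (pre_word p') || inside_edge (val v) p' ->
        retractY v p' = net_base NY.
      by case/orP; [exact: retractY_noprefix|exact: retractY_inside].
    by rewrite /= !H// mdistxx.
- by rewrite /cell_pdist !edge_pos_past// subrr normr0.
Qed.

Lemma opposite_cells c c' : c <> c' -> opposite c c'.
Proof.
move=> cc'; have [ww|] := eqVneq (cell_word c) (cell_word c'); last exact: opposite_words.
have XY v v' : val v = val v' -> opposite (CellX v) (CellY v').
  move=> vv'; have v0 := WX_WY_nil vv'; have v'0 := v0; rewrite vv' in v'0.
  have -> : v = WX0 epsX epsY by exact: val_inj.
  have -> : v' = WY0 epsX epsY by exact: val_inj.
  exists (fun p => ~~ root_sideX p), (fun p => ~~ root_sideY p).
  split=> [p|p q pA qA|p q pA qA]; first exact: root_sides.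
  - by rewrite /= !retractX_root// mdistxx.
  - by rewrite /= !retractY_root// mdistxx.
case: c' cc' ww => [v'|v'|u'] cc' ww.
- case: c cc' ww => [v|v|u] cc' ww.
  + by rewrite (val_inj ww) in cc'.
  + exact/opposite_sym/XY.
  + by apply/opposite_sym/opposite_sheet_edge.
- case: c cc' ww => [v|v|u] cc' ww.
  + exact: XY.
  + by rewrite (val_inj ww) in cc'.
  + by apply/opposite_sym/opposite_sheet_edge.
- exact: opposite_sheet_edge.
Qed.

(** The prefixes of the two words from the branching point on, which is listed once. *)
Definition between (u w : word) : seq word :=
  [seq take i u | i <- iota (size (lcp u w)) (size u - size (lcp u w)).+1] ++
  [seq take i w | i <- iota (size (lcp u w)).+1 (size w - size (lcp u w))].

Lemma size_between u w : size (between u w) = (tree_dist u w).+1.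
Proof. by rewrite size_cat !size_map !size_iota addSn. Qed.

Lemma prefix_take_size (T : eqType) (u w : seq T) : prefix u w -> u = take (size u) w.
Proof. by rewrite prefixE => /eqP. Qed.

(** A word that is a prefix of neither word is excluded by [cell_pdist_noprefix], and one
that lies strictly above the branching point by [cell_pdist_beyond]. *)
Lemma cell_pdist_between c p q : cell_pdist c p q != 0 ->
  cell_word c \in between (pre_word p) (pre_word q).
Proof.
move=> D0; set u := cell_word c; set s := pre_word p; set t := pre_word q.
have far : prefix u (lcp s t) -> u = lcp s t.
  move=> ul; apply/eqP; apply: contraNT D0 => ulN; apply/eqP.
  by apply: cell_pdist_beyond ulN ul _ _; [exact: lcp_prefixl|exact: lcp_prefixr].
have [us|usN] := boolP (prefix u s).
  rewrite mem_cat; apply/orP; left; apply/mapP; exists (size u).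
    rewrite mem_iota; have := size_prefix us.
    have [le|lt] := leqP (size (lcp s t)) (size u); first by rewrite /= => ?; lia.
    have E : u = lcp s t.
      by apply: far; rewrite prefix_lcp us (prefix_size_lcp us (ltnW lt)).
    by rewrite E ltnn in lt.
  exact: prefix_take_size.
have [ut|utN] := boolP (prefix u t); last first.
  by move: D0; rewrite cell_pdist_noprefix ?eqxx.
rewrite mem_cat; apply/orP; right; apply/mapP; exists (size u).
  rewrite mem_iota; have := size_prefix ut.
  have [le|lt] := leqP (size u) (size (lcp s t)); last by rewrite /= => ?; lia.
  rewrite lcpC in le; have us := prefix_size_lcp ut le.
  by rewrite us in usN.
exact: prefix_take_size.
Qed.

Definition cell_kind c : nat :=
  match c with CellX _ => 0 | CellY _ => 1 | CellE _ => 2 end.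

Lemma cell_kind_word c c' :
  cell_kind c = cell_kind c' -> cell_word c = cell_word c' -> c = c'.
Proof.
by case: c c' => [v|v|v] [v'|v'|v'] //= _ => [/val_inj|/val_inj|] ->.
Qed.

(** At most three cells share the same word. *)
Lemma count_cells p q (L : seq cell) : uniq L ->
  (size [seq c <- L | cell_pdist c p q != 0%R]
    <= 3 * (tree_dist (pre_word p) (pre_word q)).+1)%N.
Proof.
move=> uL; rewrite -size_between.
pose f c := (cell_kind c, cell_word c).
have f_inj : injective f by move=> c c' [? ?]; exact: cell_kind_word.
rewrite -(size_map f) -[3%N]/(size [:: 0%N; 1%N; 2%N]) -(size_allpairs pair).
apply: uniq_leq_size; first by rewrite map_inj_uniq ?filter_uniq.
move=> _ /mapP[c + ->]; rewrite mem_filter => /andP[/cell_pdist_between cw _].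
by apply: allpairs_f => //; case: (c).
Qed.

(** The edges to the words strictly between the branching point and [u]; the last edge
before [u] is left out because a point with word [u] may lie inside it. *)
Definition crossed_edges (u w : word) : seq cell :=
  [seq CellE (take i u) | i <- iota (size (lcp u w)).+1 (size u - size (lcp u w)).-1].

Lemma crossed_edges_uniq u w : uniq (crossed_edges u w).
Proof.
rewrite map_inj_in_uniq ?iota_uniq// => i j; rewrite !mem_iota => iP jP [].
by move/(congr1 size); rewrite !size_takel//; lia.
Qed.

Lemma crossed_edgesP c p q : c \in crossed_edges (pre_word p) (pre_word q) ->
  exists2 u, c = CellE u & edge_pos u p = 1 /\ edge_pos u q = 0.
Proof.
case/mapP => i /take_crossed[t0 ts npre] ->; eexists; first by [].
split; last exact: edge_pos_noprefix.
rewrite (edge_pos_beyond ts) ?prefix_take ?prefix_refl//.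
by case: (take _ _) t0.
Qed.

Lemma crossing_edges p q : exists K : seq cell,
  [/\ uniq K, (tree_dist (pre_word p) (pre_word q) <= size K + 2)%N &
      forall c, c \in K -> exists2 u, c = CellE u & cell_pdist c p q = 1].
Proof.
set s := pre_word p; set t := pre_word q.
exists (crossed_edges s t ++ crossed_edges t s); split.
- rewrite cat_uniq !crossed_edges_uniq andbT /=; apply/hasPn => c.
  case/crossed_edgesP => u -> [uq up]; apply/negP => /crossed_edgesP[_ [<-] [up' _]].
  by move: up' => /eqP; rewrite up eq_sym oner_eq0.
- by rewrite size_cat !size_map !size_iota tree_dist_le_crossed.
- move=> c; rewrite mem_cat => /orP[] /crossed_edgesP[u -> [pu qu]]; exists u => //=.
    by rewrite pu qu subr0 normr1.
  by rewrite pu qu sub0r normrN1.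
Qed.

Lemma edge_pos_itv u p : 0 <= edge_pos u p <= 1.
Proof.
have b01 (b : bool) : 0 <= b%:R :> R by exact: ler0n.
have b11 (b : bool) : b%:R <= 1 :> R by rewrite lern1 leq_b1.
case/lastP: u => [|u a]; last first.
  rewrite edge_pos_rcons; case: p => [w x|w y|w x0 t|w y0 t|t] /=;
    rewrite ?b01 ?b11 ?lexx ?ler01//; case: ifP => _; rewrite ?b01 ?b11 ?ge0 ?le1//.
rewrite /edge_pos; case: p => [w x|w y|w x0 t|w y0 t|t] /=;
  by rewrite ?ge0 ?le1//; case: (val w) => [|[b|b] s] /=; rewrite ?lexx ?ler01.
Qed.

Lemma cell_pdist_edge_le1 u p q : cell_pdist (CellE u) p q <= 1.
Proof.
have /andP[p0 p1] := edge_pos_itv u p; have /andP[q0 q1] := edge_pos_itv u q.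
by rewrite /= ler_norml; apply/andP; split; lra.
Qed.

End CellPairs.

(** * Metric spaces decomposed into cells *)

Section Reformulations.
Context {R : realType}.

(** The two alternatives of Gromov's inequality, with the products written out. *)
Definition four_point (T : Type) (delta : R) (d : T -> T -> R) : Prop :=
  forall x y z w, d x z + d y w <= d x y + d z w + 2 * delta \/
                  d x z + d y w <= d x w + d y z + 2 * delta.

Lemma gromov_hyperbolicP (Z : metricType R) :
  gromov_hyperbolic Z <->
  exists2 delta : R, 0 <= delta & four_point delta (@mdist R Z).
Proof.
split=> -[delta delta0 H]; exists delta => // x y z w; have := H x y z w;
  rewrite /gromov_product.
  rewrite lerBlDr ge_min => /orP[] h; [left|right]; lra.
by rewrite lerBlDr ge_min => -[] h; apply/orP; [left|right]; lra.
Qed.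

Definition coarse_embedding (Z : metricType R) (E : normedModType R) (F : Z -> E) :=
  (forall M : R, exists B : R, forall x y, mdist x y <= M -> `|F x - F y| <= B) /\
  (forall M : R, exists B : R, forall x y, `|F x - F y| <= M -> mdist x y <= B).

(** The control functions are recovered as the supremum of the distances of images of
points at distance at most [t], and as an infimum for points at distance at least
[t]. To make them tend to infinity even on a bounded space, the number [t] is added to
the supremum, and the infimum is also taken over the numbers above [t]. *)
Lemma coarsely_embeddableP (Z : metricType R) :
  coarsely_embeddable_in_uniformly_convex_Banach Z <->
  exists (E : completeNormedModType R) (F : Z -> E),
    uniformly_convex E /\ coarse_embedding F.
Proof.
split.
  case=> E [F [rho1 [rho2 [ucE [mono1 [mono2 [lim1 [_ FE]]]]]]]].
  exists E, F; split=> //; split=> M.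
    exists (rho2 M) => x y xyM; have /andP[_ /le_trans] := FE x y; apply.
    by apply: mono2; rewrite ?mdist_ge0.
  have /cvgryPgt /(_ M) [A [_ rhoA]] := lim1.
  exists (A + 1) => x y xyM; rewrite leNgt; apply/negP => far.
  have /andP[+ _] := FE x y; rewrite leNgt => /negP; apply.
  by apply: le_lt_trans xyM _; apply: rhoA; apply: lt_trans far; rewrite ltrDl.
case=> E [F [ucE [up low]]].
pose below t := [set r : R | r = 0 \/ exists x y, mdist x y <= t /\ r = `|F x - F y|].
pose above t := [set r : R | t <= r \/ exists x y, t <= mdist x y /\ r = `|F x - F y|].
have sup_below t : has_sup (below t).
  split; first by exists 0; left.
  have [B FB] := up t; exists (maxr 0 B) => r [->|[x [y [xy ->]]]].
    by rewrite le_max lexx.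
  by rewrite le_max FB ?orbT.
have inf_above t : has_inf (above t).
  split; first by exists t; left.
  exists (minr 0 t) => r [tr|[x [y [_ ->]]]]; first by rewrite ge_min tr orbT.
  by rewrite ge_min normr_ge0.
exists E, F, (fun t => inf (above t)), (fun t => sup (below t) + t).
split=> //; split.
  move=> s t s0 st; apply: lb_le_inf; first by case: (inf_above t).
  move=> r ar; apply: ge_inf; first by case: (inf_above s).
  case: ar => [tr|[x [y [xy ->]]]]; [left|right; exists x, y; split=> //].
    exact: le_trans tr.
  exact: le_trans xy.
split.
  move=> s t s0 st; apply: lerD => //; apply: ge_sup; first by case: (sup_below s).
  move=> r br; apply: sup_upper_bound => //.
  case: br => [->|[x [y [xy ->]]]]; [by left|right; exists x, y; split=> //].
  exact: le_trans st.
split.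
  apply/cvgryPge => A; have [B FB] := low A.
  near=> t; apply: lb_le_inf; first by case: (inf_above t).
  move=> r [tr|[x [y [xy ->]]]].
    by apply: le_trans tr; near: t; apply: nbhs_pinfty_ge; rewrite num_real.
  rewrite leNgt; apply/negP => /ltW/FB; rewrite leNgt => /negP; apply.
  by apply: lt_le_trans xy; near: t; apply: nbhs_pinfty_gt; rewrite num_real.
split.
  apply/cvgryPge => A; near=> t; apply: (@le_trans _ _ t).
    by near: t; apply: nbhs_pinfty_ge; rewrite num_real.
  by rewrite lerDr; apply: sup_upper_bound; [exact: sup_below|left].
move=> x y; apply/andP; split.
  by apply: ge_inf; [case: (inf_above (mdist x y))|right; exists x, y].
rewrite (@le_trans _ _ (sup (below (mdist x y))))// ?lerDl ?mdist_ge0//.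
by apply: sup_upper_bound; [exact: sup_below|right; exists x, y].
Unshelve. all: by end_near. Qed.

End Reformulations.

Section CellDecomposition.
Context {R : realType} {Z : metricType R} {C : choiceType}.
Variable D : C -> Z -> Z -> R.

(** Here [D c] is the pseudo-metric pulled back from the cell [c]; the sum over all cells
is expressed by finite lists of cells that contain all nonzero terms. *)
Record cell_decomposition : Prop := CellDecomposition {
  cell_xx : forall c p, D c p p = 0;
  cell_ge0 : forall c p q, 0 <= D c p q;
  cell_sym : forall c p q, D c p q = D c q p;
  cell_triangle : forall c p q s, D c p s <= D c p q + D c q s;
  cell_finite : forall p q, exists L : seq C, forall c, c \notin L -> D c p q = 0;
  cell_sum : forall p q (L : seq C), uniq L ->
    (forall c, c \notin L -> D c p q = 0) -> mdist p q = \sum_(c <- L) D c p q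
}.

Hypothesis dec : cell_decomposition.

Lemma cell_support (s : seq Z) : exists L : seq C, uniq L /\
  {in s &, forall p q c, c \notin L -> D c p q = 0}.
Proof.
have [L LE] : exists L : seq C, {in s &, forall p q c, c \notin L -> D c p q = 0}.
  case: s => [|o s]; first by exists [::] => ?.
  have [L LE] : exists L : seq C, {in o :: s, forall p c, c \notin L -> D c o p = 0}.
    elim: (o :: s) => [|p s' [L LE]]; first by exists [::].
    have [L' L'E] := cell_finite dec o p; exists (L' ++ L) => q.
    rewrite inE => /predU1P[->|qs] c; rewrite mem_cat negb_or => /andP[cL' cL].
      exact: L'E.
    exact: LE.
  exists L => p q ps qs c cL; apply/le_anti; rewrite (cell_ge0 dec) andbT.
  apply: le_trans (cell_triangle dec c _ o _) _.
  by rewrite (cell_sym dec c p) !LE// addr0.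
exists (undup L); split; first exact: undup_uniq.
by move=> p q ps qs c; rewrite mem_undup; exact: LE.
Qed.

Lemma cell_support2 p q : exists L : seq C, uniq L /\
  forall c, c \notin L -> D c p q = 0.
Proof.
have [L [uL LE]] := cell_support [:: p; q]; exists L; split=> // c.
by apply: LE; rewrite !inE eqxx ?orbT.
Qed.

Lemma cell_le_dist c p q : D c p q <= mdist p q.
Proof.
have [L [uL LE]] := cell_support2 p q.
have [cL|/LE->] := boolP (c \in L); last exact: mdist_ge0.
rewrite (cell_sum dec uL LE) (bigD1_seq c)//= lerDl sumr_ge0// => *.
exact: cell_ge0.
Qed.

Section Hyperbolic.

Hypothesis opp : forall c c', c != c' -> exists A B : pred Z,
  [/\ forall p, A p || B p, forall p q, A p -> A q -> D c p q = 0 &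
      forall p q, B p -> B q -> D c' p q = 0].

Lemma cell_same c p q s : D c p q = 0 -> D c p s = D c q s.
Proof.
move=> pq; apply/le_anti/andP; split.
  by rewrite (le_trans (cell_triangle dec c p q s))// pq add0r.
by rewrite (le_trans (cell_triangle dec c q p s))// (cell_sym dec) pq add0r.
Qed.

Lemma cell_diagonal c x y z w :
  D c x z = 0 -> D c x z + D c y w <= D c x y + D c z w.
Proof.
move=> xz; rewrite xz add0r -(cell_same w xz) (cell_sym dec c x y).
exact: (cell_triangle dec).
Qed.

Lemma cell_side c x y z w : D c z w = 0 -> D c x z + D c y w <= D c x w + D c y z.
Proof.
move=> zw; rewrite (cell_sym dec c x z) (cell_same x zw) (cell_sym dec c w x).
by rewrite (cell_sym dec c y w) -(cell_same y zw) (cell_sym dec c z y).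
Qed.

(** The four points are distributed over two sets, one of which is collapsed in [c] and
the other in [c']. If the opposite corners [x] and [z] of the quadrilateral
[x], [y], [z], [w] are collapsed in [c], the first inequality is the triangle
inequality; the same holds for [c'] and the second one. Otherwise a side is collapsed: in [c] the side [xw] or [yz], or
in [c'] the side [xy] or [zw]. *)
Lemma opposite_four_point c c' x y z w : c != c' ->
  D c x z + D c y w <= D c x y + D c z w \/
  D c' x z + D c' y w <= D c' x w + D c' y z.
Proof.
move=> /opp[A [B [AB cA cB]]].
have sym := cell_sym dec.
case/orP: (AB x) => hx; case/orP: (AB z) => hz.
- by left; exact/cell_diagonal/cA.
- case/orP: (AB w) => hw; last by right; exact/cell_side/cB.
  left; rewrite (sym c x z) (sym c x y) [leRHS]addrC; exact/cell_side/cA.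
- case/orP: (AB y) => hy.
    by left; rewrite (sym c y w) (sym c z w); exact/cell_side/cA.
  right; rewrite (sym c' x z) (sym c' y w) (sym c' x w) (sym c' y z) [leRHS]addrC.
  exact/cell_side/cB.
- by right; rewrite (sym c' y w) (sym c' y z); exact/cell_diagonal/cB.
Qed.

Lemma sum_le_except (c0 : C) (L : seq C) (f g : C -> R) (e : R) : uniq L -> 0 <= e ->
  (forall c, c != c0 -> f c <= g c) -> f c0 <= g c0 + e ->
  \sum_(c <- L) f c <= \sum_(c <- L) g c + e.
Proof.
move=> uL e0 fg fg0; have [c0L|c0L] := boolP (c0 \in L).
  rewrite !(bigD1_seq c0)//= addrAC lerD//; exact: ler_sum.
apply: le_trans (_ : \sum_(c <- L) g c <= _); last by rewrite lerDl.
rewrite big_seq [leRHS]big_seq; apply: ler_sum => c cL.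
by apply: fg; apply: contraNneq c0L => <-.
Qed.

(** If neither alternative holds in all cells, then by [opposite_four_point] both are
violated in the same cell, and hold in all the others. Hyperbolicity of this one cell
decides which of them holds for the sum. *)
Theorem decomposition_hyperbolic delta : 0 <= delta ->
  (forall c, four_point delta (D c)) -> four_point delta (@mdist R Z).
Proof.
move=> delta0 hyp x y z w.
have [L [uL LE]] := cell_support [:: x; y; z; w].
have dE p q : p \in [:: x; y; z; w] -> q \in [:: x; y; z; w] ->
    mdist p q = \sum_(c <- L) D c p q.
  by move=> ps qs; apply: (cell_sum dec uL) => c; exact: LE.
rewrite !dE ?inE ?eqxx ?orbT// -!big_split /=.
have d2 : 0 <= 2 * delta by rewrite mulr_ge0.
have [s1|/existsNP[c1 /negP]] :=
  pselect (forall c, D c x z + D c y w <= D c x y + D c z w).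
  by left; rewrite -[leLHS]addr0 lerD//; apply: ler_sum.
rewrite -ltNge => s1.
have [s2|/existsNP[c2 /negP]] :=
  pselect (forall c, D c x z + D c y w <= D c x w + D c y z).
  by right; rewrite -[leLHS]addr0 lerD//; apply: ler_sum.
rewrite -ltNge => s2.
have c12 : c1 = c2.
  apply/eqP; apply: contraT => /(opposite_four_point x y z w).
  by rewrite leNgt s1 leNgt s2 => -[].
subst c2.
have [h|h] := hyp c1 x y z w; [left|right]; apply: (sum_le_except uL d2) h => c cc1.
  by have := opposite_four_point x y z w cc1; rewrite [X in _ \/ is_true X]leNgt s2 => -[].
rewrite eq_sym in cc1.
by have := opposite_four_point x y z w cc1; rewrite [X in is_true X \/ _]leNgt s1 => -[].
Qed.

End Hyperbolic.

Section BoundedlyManyCells.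

Context {T : eqType}.
Variables (word : Z -> seq T) (is_edge : pred C).
Local Notation tdist p q := (tree_dist (word p) (word q)).

Hypothesis count : forall p q (L : seq C), uniq L ->
  (size [seq c <- L | D c p q != 0%R] <= 3 * (tdist p q).+1)%N.
Hypothesis crossing : forall p q, exists K : seq C,
  [/\ uniq K, (tdist p q <= size K + 2)%N &
      forall c, c \in K -> is_edge c /\ D c p q = 1].

(** Every edge crossed from end to end contributes 1 to the distance. *)
Lemma tree_dist_le_dist p q : (tdist p q)%:R <= mdist p q + 2.
Proof.
have [K [uK tK KE]] := crossing p q.
have [L [uL LE]] := cell_support2 p q.
have : \sum_(c <- K) D c p q <= \sum_(c <- L) D c p q.
  apply: sum_subset_le => // [c|c cK]; first exact: cell_ge0.
  apply: contraT => /LE; have [_ ->] := KE _ cK.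
  by move=> /eqP; rewrite oner_eq0.
rewrite -(cell_sum dec uL LE); under eq_big_seq => c cK do rewrite (KE c cK).2.
rewrite big_const_seq count_predT iter_addr addr0 => KM.
by rewrite -lerBlDr (le_trans _ KM)// lerBlDr -natrD ler_nat.
Qed.

Lemma dist_le_cells p q (B : R) : 0 <= B -> (forall c, D c p q <= B) ->
  mdist p q <= (3 * (tdist p q).+1)%:R * B.
Proof.
move=> B0 DB; have [L [uL LE]] := cell_support2 p q.
rewrite (cell_sum dec uL LE) (bigID (fun c => D c p q == 0)) /= big1 => [|c /eqP//].
rewrite add0r -big_filter.
apply: (@le_trans _ _ (\sum_(c <- [seq c <- L | D c p q != 0]) B)).
  exact: ler_sum.
rewrite big_const_seq count_predT iter_addr addr0 -[leLHS]mulr_natl.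
by rewrite ler_wpM2r// ler_nat count.
Qed.

Section Embedding.

Variables (o : Z) (E : C -> completeNormedModType R) (F : forall c, Z -> E c).
Hypothesis gain : forall a, 0 < a ->
  exists2 g, 0 < g & forall c, square_convex_gain a g (E c).
Hypothesis F0 : forall c p q, D c p q = 0 -> F c p = F c q.
Hypothesis F1 : forall c p q, is_edge c -> D c p q = 1 -> `|F c p - F c q| = 1.
Hypothesis up : forall M, exists B, forall c p q,
  D c p q <= M -> `|F c p - F c q| <= B.
Hypothesis low : forall M, exists B, forall c p q,
  `|F c p - F c q| <= M -> D c p q <= B.

Fact cell_vector_bounded p :
  exists M, forall s, l2_family E s (fun c => F c p - F c o) <= M.
Proof.
have [L [_ LE]] := cell_support2 p o.
by apply: (@l2_finite_support_bounded _ _ _ L) => c /LE/F0 ->; rewrite subrr.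
Qed.

(** Subtracting the image of a base point leaves finitely many nonzero coordinates. *)
Definition cell_vector p : l2_sum E := BoundedVector (cell_vector_bounded p).

Lemma cell_vectorB p q c : (cell_vector p - cell_vector q) c = F c p - F c q.
Proof. by rewrite /= scaleN1r opprB addrA subrK. Qed.

(** In both directions the number of cells that separate two points has to be bounded: by
their distance, or by the distance of their images, since every edge crossed from end
to end contributes 1 to the square of the latter. *)
Theorem decomposition_coarse_embedding : coarse_embedding cell_vector.
Proof.
split=> M.
  have [B FB] := up M.
  exists (1 + 3 * (M + 3) * B ^+ 2) => p q pqM.
  have [L [uL LE]] := cell_support2 p q.
  have t3 : (3 * (tdist p q).+1)%:R <= 3 * (M + 3) :> R.
    rewrite natrM ler_pM2l// -natr1; have := tree_dist_le_dist p q; lra.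
  have N2 : `|cell_vector p - cell_vector q| ^+ 2 <= 3 * (M + 3) * B ^+ 2.
    rewrite (@l2_norm_support _ _ _ L)//; last first.
      by move=> c /LE/F0 e; rewrite cell_vectorB e subrr.
    under eq_bigr do rewrite cell_vectorB.
    rewrite (bigID (fun c => D c p q == 0)) /= big1 => [|c /eqP/F0 ->]; last first.
      by rewrite subrr normr0 expr0n.
    rewrite add0r -big_filter.
    apply: (@le_trans _ _ (\sum_(c <- [seq c <- L | D c p q != 0]) B ^+ 2)).
      apply: ler_sum => c _.
      have FcB : `|F c p - F c q| <= B.
        by apply: FB; apply: le_trans pqM; exact: cell_le_dist.
      by rewrite lerXn2r ?nnegrE// (le_trans _ FcB).
    rewrite big_const_seq count_predT iter_addr addr0 -[leLHS]mulr_natl.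
    rewrite ler_wpM2r ?sqr_ge0// (le_trans _ t3)// ler_nat count//.
  have := sqr_ge0 (`|cell_vector p - cell_vector q| - 1).
  have := sqr_ge0 `|cell_vector p - cell_vector q|; nra.
have [B FB] := low M.
exists (3 * (M ^+ 2 + 3) * maxr B 0) => p q pqM.
have M2 : `|cell_vector p - cell_vector q| ^+ 2 <= M ^+ 2.
  by rewrite lerXn2r ?nnegrE// (le_trans _ pqM).
have t2 : (tdist p q)%:R <= M ^+ 2 + 2.
  have [K [uK tK KE]] := crossing p q.
  have : \sum_(c <- K) `|(cell_vector p - cell_vector q) c| ^+ 2 <= M ^+ 2.
    by apply: le_trans M2; exact: l2_sum_le_norm.
  under eq_big_seq => c cK do
    rewrite cell_vectorB (F1 (KE c cK).1 (KE c cK).2) expr1n.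
  rewrite big_const_seq count_predT iter_addr addr0 => KM.
  by rewrite -lerBlDr (le_trans _ KM)// lerBlDr -natrD ler_nat.
have DB c : D c p q <= maxr B 0.
  rewrite le_max FB// -cell_vectorB.
  have := @l2_sum_le_norm _ _ _ [:: c] (cell_vector p - cell_vector q) isT.
  rewrite big_seq1 => cpq; have M0 : 0 <= M by apply: le_trans pqM.
  rewrite -(@ler_pXn2r _ 2) ?nnegrE//; exact: le_trans M2.
have B0 : 0 <= maxr B 0 by rewrite le_max lexx orbT.
apply: le_trans (dist_le_cells B0 DB) _; rewrite ler_wpM2r//.
by rewrite natrM ler_pM2l// -natr1; lra.
Qed.

Lemma decomposition_coarsely_embeddable :
  coarsely_embeddable_in_uniformly_convex_Banach Z.
Proof.
apply/coarsely_embeddableP; exists (l2_sum E), cell_vector; split.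
  exact: l2_sum_uniformly_convex.
exact: decomposition_coarse_embedding.
Qed.

End Embedding.

Section PropertyA.

Hypothesis kernels : forall eta M : R, 0 < eta -> 0 < M ->
  exists k : C -> Z -> Z -> R,
  [/\ forall c, positive_type (k c), forall c p q, D c p q = 0 -> k c p q = 1,
      forall c p q, D c p q <= M -> 1 - eta <= k c p q
    & exists2 r : R, 0 < r & forall c p q, r <= D c p q -> k c p q = 0].

Lemma prod_ge1B (s : seq C) (f : C -> R) (e : R) : 0 <= e -> e <= 1 ->
  (forall c, 1 - e <= f c) -> 1 - (size s)%:R * e <= \prod_(c <- s) f c.
Proof.
move=> e0 e1 fe; suff [] : 0 <= \prod_(c <- s) f c /\
    1 - (size s)%:R * e <= \prod_(c <- s) f c by [].
elim: s => [|c s [IH0 IH]]; first by rewrite big_nil mul0r subr0.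
rewrite big_cons -natr1 mulrDl mul1r.
have f0 : 0 <= f c by apply: le_trans (fe c); rewrite subr_ge0.
split; first exact: mulr_ge0.
have : (1 - e) * \prod_(c <- s) f c <= f c * \prod_(c <- s) f c by rewrite ler_wpM2r.
have : (1 - e) * (1 - (size s)%:R * e) <= (1 - e) * \prod_(c <- s) f c.
  by rewrite ler_wpM2l// subr_ge0.
have : 0 <= e * ((size s)%:R * e) by rewrite !mulr_ge0.
lra.
Qed.

Lemma prod_support (L L' : seq C) (f : C -> R) : uniq L -> uniq L' ->
  (forall c, c \notin L -> f c = 1) -> (forall c, c \notin L' -> f c = 1) ->
  \prod_(c <- L) f c = \prod_(c <- L') f c.
Proof.
move=> uL uL' fL fL'.
have H L0 : \prod_(c <- L0) f c = \prod_(c <- [seq c <- L0 | f c != 1]) f c.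
  rewrite (bigID (fun c => f c == 1)) /= big1 => [|c /eqP//].
  by rewrite mul1r big_filter.
rewrite H [RHS]H; apply: perm_big; apply: uniq_perm; rewrite ?filter_uniq// => c.
rewrite !mem_filter; case: eqP => //= fc.
by apply/idP/idP => _; apply: contraT; do 1?[by move/fL'|by move/fL].
Qed.

(** The product of the kernels of all cells is at least 1 minus the sum of the defects of
the factors. Where it does not vanish, the distance in every cell is at most [r]; where
the kernel on words does not vanish, the number of separating cells is bounded; where
neither vanishes, the distance is bounded. *)
Theorem decomposition_property_A : property_A Z.
Proof.
apply/property_A_kernel => eta0 M eta00 M0.
pose eta := minr eta0 1.
have eta_gt0 : 0 < eta by rewrite lt_min eta00 ltr01.
have eta1 : eta <= 1 by rewrite ge_min lexx orbT.
have eta_le : eta <= eta0 by rewrite ge_min lexx.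
clearbody eta.
(* At distance at most [M] there are at most [3 * (M + 3)] separating cells. A defect
   [e] in each of their kernels costs [eta / 2] altogether, and the choice of [n]
   leaves the other half for the kernel on words. *)
have M3 : 0 < 6 * (M + 3) by rewrite mulr_gt0// addr_gt0.
have e0 : 0 < eta / (6 * (M + 3)) by rewrite divr_gt0.
set e := eta / (6 * (M + 3)) in e0 *.
have eE : 3 * (M + 3) * e = eta / 2 by rewrite /e; field; lra.
have e1 : e <= 1 by rewrite /e ler_pdivrMr// mul1r; lra.
clearbody e.
have [k [kp k1 near [r r0 far]]] := kernels e0 M0.
have [n] : exists n : nat, 2 * (M + 2) / eta < n.+1%:R.
  by exists (truncn (2 * (M + 2) / eta)); exact: truncnS_gt.
rewrite ltr_pdivrMr// => nM; set m := n.+1 in nM.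
pose L p q := projT1 (cid (cell_support2 p q)).
have uL p q : uniq (L p q) by rewrite /L; case: cid => ? [].
have LE p q c : c \notin L p q -> D c p q = 0.
  by rewrite /L; case: cid => ? [] ? /=; apply.
pose K p q := \prod_(c <- L p q) k c p q.
have KE p q L' : uniq L' -> (forall c, c \notin L' -> D c p q = 0) ->
    K p q = \prod_(c <- L') k c p q.
  by move=> uL' L'E; apply: prod_support => // c; [move/LE/k1|move/L'E/k1].
have Kp : positive_type K.
  apply: positive_type_local => s; have [L' [uL' L'E]] := cell_support s.
  exists (fun p q => \prod_(c <- L') k c p q); split; first exact: positive_type_prod.
  by move=> p q ps qs; apply: KE => // c; exact: L'E.
exists (fun p q => K p q * tree_kernel m (word p) (word q)); split.
- apply: positive_type_mul => //; apply: (positive_type_comp word).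
  exact: tree_kernel_positive.
- move=> p; rewrite tree_kernel1// (KE p p [::])//.
    by rewrite big_nil mulr1.
  by move=> c _; exact: cell_xx.
- move=> p q pqM.
  have tM := tree_dist_le_dist p q.
  have T_ge : 1 - eta / 2 <= tree_kernel m (word p) (word q).
    apply: le_trans (tree_kernel_ge _ _ _) => //.
    rewrite lerD2l lerN2 ler_pdivrMr ?ltr0n//; lra.
  have K_ge : 1 - eta / 2 <= K p q.
    rewrite /K (bigID (fun c => D c p q == 0)) /= big1 => [|c /eqP/k1//].
    rewrite mul1r -big_filter.
    apply: le_trans (prod_ge1B _ (ltW e0) e1 _); last first.
      move=> c; apply: near; apply: le_trans pqM; exact: cell_le_dist.
    rewrite lerD2l lerN2 -eE ler_wpM2r ?(ltW e0)//.
    apply: (@le_trans _ _ (3 * (tdist p q).+1)%:R); first by rewrite ler_nat count.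
    rewrite natrM ler_pM2l// -natr1; lra.
  have : 0 <= (K p q - (1 - eta / 2)) * tree_kernel m (word p) (word q).
    by rewrite mulr_ge0 ?subr_ge0// (le_trans _ T_ge)//; lra.
  have : 0 <= (1 - eta / 2) * (tree_kernel m (word p) (word q) - (1 - eta / 2)).
    by rewrite mulr_ge0 ?subr_ge0//; lra.
  have := sqr_ge0 eta; lra.
- have six : (0 : R) < (6 * m)%:R * r + 1.
    by rewrite ltr_wpDl// mulr_ge0// ltW.
  exists ((6 * m)%:R * r + 1) => // p q pq.
  have [tn|tn] := leqP (2 * m) (tdist p q); first by rewrite tree_kernel_far ?mulr0.
  have [D_lt|/existsNP[c /negP]] := pselect (forall c, D c p q <= r).
    have := dist_le_cells (ltW r0) D_lt.
    have : (3 * (tdist p q).+1)%:R * r <= (6 * m)%:R * r.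
      rewrite ler_wpM2r ?(ltW r0)// ler_nat (_ : 6 * m = 3 * (2 * m))%N.
        by rewrite leq_mul2l.
      by rewrite mulnA.
    lra.
  rewrite -ltNge => rD.
  have cL : c \in L p q.
    by apply: contraT => /LE Dc; move: rD; rewrite Dc ltNge (ltW r0).
  by rewrite /K (bigD1_seq c)//= (far _ _ _ (ltW rD)) !mul0r.
Qed.

End PropertyA.
End BoundedlyManyCells.
End CellDecomposition.

(** * The three properties of free products *)

Section FreeProductProperties.
Context {R : realType} {X Y : metricType R} {NX : net X} {NY : net Y}.
Variables (epsX : NX) (epsY : NY).

Local Notation FP := (free_product epsX epsY).
Local Notation cell := (@cell R X Y NX NY epsX epsY).

Definition free_product_pdist (c : cell) (P Q : FP) : R :=
  cell_pdist c (repr P) (repr Q).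
Local Notation D := free_product_pdist.

Definition free_product_word (P : FP) := pre_word (repr P).

Definition is_edge_cell : pred cell := fun c => if c is CellE _ then true else false.

Lemma free_product_decomposition : cell_decomposition D.
Proof.
split=> [c P|c P Q|c P Q|c P Q S|P Q|P Q L].
- exact: cell_pdistxx.
- exact: cell_pdist_ge0.
- exact: cell_pdist_sym.
- exact: cell_pdist_triangle.
- exact: cell_pdist_finite.
- exact: dist_sum_cells.
Qed.

Lemma free_product_count (P Q : FP) (L : seq cell) : uniq L ->
  (size [seq c <- L | D c P Q != 0%R]
    <= 3 * (tree_dist (free_product_word P) (free_product_word Q)).+1)%N.
Proof. exact: count_cells. Qed.

Lemma free_product_crossing (P Q : FP) : exists K : seq cell,
  [/\ uniq K,
      (tree_dist (free_product_word P) (free_product_word Q) <= size K + 2)%N &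
      forall c, c \in K -> is_edge_cell c /\ D c P Q = 1].
Proof.
have [K [uK tK KE]] := crossing_edges (repr P) (repr Q); exists K; split=> // c.
by case/KE => u ->.
Qed.

(** Edges have diameter 1, so the four-point inequality holds in them with [delta = 1]. *)
Lemma free_product_hyperbolic : gromov_hyperbolic X -> gromov_hyperbolic Y ->
  gromov_hyperbolic FP.
Proof.
move=> /gromov_hyperbolicP[dX dX0 hX] /gromov_hyperbolicP[dY dY0 hY].
apply/gromov_hyperbolicP; pose d := maxr 1 (maxr dX dY).
have d1 : 1 <= d by rewrite le_max lexx.
have dXd : dX <= d by rewrite !le_max lexx orbT.
have dYd : dY <= d by rewrite !le_max lexx !orbT.
exists d; first lra.
apply: (decomposition_hyperbolic free_product_decomposition); last 2 first.
- lra.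
- move=> [v|v|u] P Q S T; rewrite /D /=.
  + have [h|h] := hX (retractX v (repr P)) (retractX v (repr Q))
      (retractX v (repr S)) (retractX v (repr T)); [left|right]; lra.
  + have [h|h] := hY (retractY v (repr P)) (retractY v (repr Q))
      (retractY v (repr S)) (retractY v (repr T)); [left|right]; lra.
  + left; have := cell_pdist_edge_le1 u (repr P) (repr S).
    have := cell_pdist_edge_le1 u (repr Q) (repr T).
    have := cell_pdist_ge0 (CellE u) (repr P) (repr Q).
    have := cell_pdist_ge0 (CellE u) (repr S) (repr T).
    rewrite /cell_pdist; lra.
move=> c c' /eqP/opposite_cells[A [B [AB cA cB]]].
exists (fun P => A (repr P)), (fun P => B (repr P)); split=> [P|P Q|P Q].
- exact: AB.
- exact: cA.
- exact: cB.
Qed.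

Lemma free_product_property_A : property_A X -> property_A Y -> property_A FP.
Proof.
move=> /property_A_kernel AX /property_A_kernel AY.
apply: (decomposition_property_A free_product_decomposition
          free_product_count free_product_crossing).
move=> eta M eta0 M0.
have [kX [pX oneX nearX [rX rX0 farX]]] := AX eta M eta0 M0.
have [kY [pY oneY nearY [rY rY0 farY]]] := AY eta M eta0 M0.
exists (fun c P Q => match c with
  | CellX v => kX (retractX v (repr P)) (retractX v (repr Q))
  | CellY v => kY (retractY v (repr P)) (retractY v (repr Q))
  | CellE _ => 1
  end); split=> [[v|v|u]|[v|v|u] P Q|[v|v|u] P Q|].
- exact: (positive_type_comp (fun P : FP => retractX v (repr P))).
- exact: (positive_type_comp (fun P : FP => retractY v (repr P))).
- exact: positive_type1.
- by move=> /mdist_positivity ->.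
- by move=> /mdist_positivity ->.
- by [].
- exact: nearX.
- exact: nearY.
- by move=> _; rewrite lerBlDr lerDl ltW.
exists (maxr 2 (maxr rX rY)) => [|c P Q]; first by rewrite lt_max ltr0n.
rewrite !ge_max => /and3P[r2 rX1 rY1]; case: c r2 rX1 rY1 => [v|v|u] r2 rX1 rY1.
- exact: farX.
- exact: farY.
- by have := cell_pdist_edge_le1 u (repr P) (repr Q); rewrite /D in r2; lra.
Qed.

Lemma free_product_coarsely_embeddable :
  coarsely_embeddable_in_uniformly_convex_Banach X ->
  coarsely_embeddable_in_uniformly_convex_Banach Y ->
  coarsely_embeddable_in_uniformly_convex_Banach FP.
Proof.
move=> /coarsely_embeddableP[EX [FX [ucX [upX lowX]]]].
move=> /coarsely_embeddableP[EY [FY [ucY [upY lowY]]]].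
pose E (c : cell) : completeNormedModType R :=
  match c with CellX _ => EX | CellY _ => EY | CellE _ => R^o end.
pose F (c : cell) (P : FP) : E c :=
  match c return E c with
  | CellX v => FX (retractX v (repr P))
  | CellY v => FY (retractY v (repr P))
  | CellE u => edge_pos u (repr P)
  end.
apply: (@decomposition_coarsely_embeddable _ _ _ _ free_product_decomposition
  _ _ _ free_product_count free_product_crossing
  (to_free_product (SheetX (WX0 epsX epsY) (net_base NX))) E F).
- move=> a a0.
  have [gX gX0 gainX] := uniformly_convex_gain ucX a0.
  have [gY gY0 gainY] := uniformly_convex_gain ucY a0.
  have [gE gE0 gainE] := uniformly_convex_gain (@uniformly_convex_R R) a0.
  pose g := minr gX (minr gY gE).
  have g0 : 0 < g by rewrite !lt_min gX0 gY0 gE0.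
  exists g => // -[v|v|u].
  + by apply: square_convex_gain_le gainX; rewrite // ge_min lexx.
  + by apply: square_convex_gain_le gainY; rewrite // !ge_min lexx orbT.
  + by apply: square_convex_gain_le gainE; rewrite // !ge_min lexx !orbT.
- move=> [v|v|u] P Q; rewrite /D /=.
  + by move=> /mdist_positivity ->.
  + by move=> /mdist_positivity ->.
  + by move=> /eqP; rewrite normr_eq0 subr_eq0 => /eqP.
- by move=> [v|v|u] P Q.
- move=> M; have [BX BXE] := upX M; have [BY BYE] := upY M.
  exists (maxr M (maxr BX BY)) => -[v|v|u] P Q; rewrite /D /= => h.
  + by rewrite !le_max BXE ?orbT.
  + by rewrite !le_max BYE ?orbT.
  + by rewrite !le_max h.
- move=> M; have [BX BXE] := lowX M; have [BY BYE] := lowY M.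
  exists (maxr M (maxr BX BY)) => -[v|v|u] P Q; rewrite /D /= => h.
  + by rewrite !le_max BXE ?orbT.
  + by rewrite !le_max BYE ?orbT.
  + by rewrite !le_max h.
Qed.

End FreeProductProperties.

Theorem theorem1p1 (R : realType) (X Y : metricType R)
    (NX : net X) (NY : net Y) (epsX : NX) (epsY : NY)
    (hX : net_map epsX = net_base NX) (hY : net_map epsY = net_base NY) :
  (coarsely_embeddable_in_uniformly_convex_Banach X ->
   coarsely_embeddable_in_uniformly_convex_Banach Y ->
   coarsely_embeddable_in_uniformly_convex_Banach (free_product epsX epsY))
  /\ (property_A X -> property_A Y -> property_A (free_product epsX epsY))
  /\ (gromov_hyperbolic X -> gromov_hyperbolic Y ->
      gromov_hyperbolic (free_product epsX epsY)).
Proof.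
split; first exact: free_product_coarsely_embeddable.
by split; [exact: free_product_property_A|exact: free_product_hyperbolic].
Qed.
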